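(* Fix $\boldsymbol{\hat\omega}\in\hat\Omega$ and write $\lambda_n(\mathbf A)=\lambda_n(\boldsymbol{\hat\omega},\mathbf A)$ for $\mathbf A\in\mathcal B^{\mathbb C}$. (1) Let $0\le k\le 2d$. Then the restriction of $\lambda_n$ to $\hat\Sigma_k$ is continuous for every $1\le n\le (N+1)d-k$. Moreover, the restriction of $\lambda_n$ to $\mathcal O_\emptyset^{\mathbb C}$ is continuous for every $1\le n\le (N+1)d$. (2) Let $\emptyset\ne K\subset\{1,\dots,2d\}$ and consider the restriction of $\lambda_n$ to $\mathcal O_K^{\mathbb C}$. Let $(r^0,r^+,r^-)$ and $(r_1^0,r_1^+,r_1^-)$ be triples of nonnegative integers, each with sum $\sharp(K)$, such that $0\le r^0<r_1^0\le\sharp(K)$ and $r^\pm\ge r_1^\pm$. Then for any $\mathbf A\in J_K^{(r_1^0,r_1^+,r_1^-)}$, $$\lim_{J_K^{(r^0,r^+,r^-)}\ni\mathbf B\to\mathbf A}\lambda_n(\mathbf B)=-\infty,\quad 1\le n\le r^+-r_1^+,$$ $$\lim_{J_K^{(r^0,r^+,r^-)}\ni\mathbf B\to\mathbf A}\lambda_n(\mathbf B)=\lambda_{n-(r^+-r_1^+)}(\mathbf A),\quad r^+-r_1^+<n\le (N+1)d-r^0-(r^--r_1^-),$$ $$\lim_{J_K^{(r^0,r^+,r^-)}\ni\mathbf B\to\mathbf A}\lambda_n(\mathbf B)=+\infty,\quad (N+1)d-r^0-(r^--r_1^-)<n\le (N+1)d-r^0.$$ Consequently, the singular set in $\mathcal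 B^{\mathbb C}$ is $\bigcup_{1\le k\le 2d}\hat\Sigma_k$.
   Context: Let $d\ge1$, $N>1$, and fix a partition $a=a_0<b_0<a_1<b_1<\cdots<a_N<b_N=b$. $\hat\Omega$ is the set of triples $\boldsymbol{\hat\omega}=(\hat P^{-1},\hat Q,\hat W)$ of integrable Hermitian $d\times d$ matrix-valued functions on $(a,b)$ (elements of $L((a,b),\mathbb C^{d\times d})$, $L=L^1$) such that: $\hat P^{-1}\equiv0$ on $[a_i,b_i]$ and $\int_{a_i}^{b_i}\hat W(s)\,ds$ is positive definite for $0\le i\le N$; and $\hat Q\equiv\hat W\equiv0$ on $[b_{j-1},a_j]$ and $\int_{b_{j-1}}^{a_j}\hat P^{-1}(s)\,ds$ is invertible for $1\le j\le N$. $\mathcal B^{\mathbb C}$ is the space of self-adjoint boundary conditions: the quotient, with the quotient topology, of $\{(A,B)\in\mathcal M_{2d,4d}(\mathbb C):\operatorname{rank}(A,B)=2d,\ AB^*=BA^*\}$ ($A,B$ being $2d\times2d$) by left multiplication by $\mathrm{GL}(2d,\mathbb C)$. The class of $(A,B)$ is written $[A\,|\,B]$. The Sturm-Liouville problem of Atkinson type $(\boldsymbol{\hat\omega},\mathbf A)$, $\mathbf A=[A\,|\,B]$, is $$-(\hat Py')'+\hat Qy=\lambda\hat Wy\ \text{ on }(a,b),\qquad A\begin{pmatrix}-y(a)\\ y(b)\end{pmatrix}+B\begin{pmatrix}(\hat Py')(a)\\ (\hat Py')(b)\end{pmatrix}=0,$$ where the equation is understood as the first-order system $u'=\hat P^{-1}v$,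 $v'=(\hat Q-\lambda\hat W)u$ with $u=y$, $v=\hat Py'$. Eigenvalues are those $\lambda$ with a nontrivial solution, counted with multiplicity (number of linearly independent eigenfunctions). They are real and finite in number and listed as $\lambda_1(\boldsymbol{\hat\omega},\mathbf A)\le\lambda_2(\boldsymbol{\hat\omega},\mathbf A)\le\cdots$. For $K\subset\{1,\dots,2d\}$, $E_1$ (resp. $E_2$) is the diagonal $d\times d$ matrix whose $i$-th diagonal entry is $0$ if $i\in K$ (resp. $d+i\in K$) and $1$ otherwise. Let $$E_K=\begin{pmatrix}E_1&0&I_d-E_1&0\\ 0&E_2&0&I_d-E_2\\ E_1-I_d&0&E_1&0\\ 0&E_2-I_d&0&E_2\end{pmatrix},$$ and $\mathcal O_K^{\mathbb C}=\{[(S\,|\,I_{2d})E_K]:S\text{ a Hermitian }2d\times2d\text{ matrix}\}$. For $\mathbf A=[(S\,|\,I_{2d})E_K]$ write $S=S(\mathbf A)$. The $\mathcal O_K^{\mathbb C}$ are local coordinate systems covering $\mathcal B^{\mathbb C}$. For $K=\{n_1,\dots,n_{m_0}\}\neq\emptyset$ let $\hat E_0=(\hat e_{n_1},\dots,\hat e_{n_{m_0}})$, with $\hat e_i$ the $i$-th column of $I_{2d}$, and for $\mathbf A\in\mathcal O_K^{\mathbb C}$ let $S_K^A(\mathbf A)=\hat E_0^*S(\mathbf A)\hat E_0$. For Hermitian $M$, $r^0(M),r^+(M),r^-(M)$ are the total multiplicities of its zero, positive, negative eigenvalues. For $\mathbf A=[A\,|\,B]$, $r^0(B)$ means $2d-\operatorname{rank}B$.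 Define $$\hat\Sigma_k=\{[A\,|\,B]\in\mathcal B^{\mathbb C}:r^0(B)=k\},\qquad J_K^{(r^0,r^+,r^-)}=\{\mathbf A\in\mathcal O_K^{\mathbb C}:r^0(S_K^A(\mathbf A))=r^0,\ r^\pm(S_K^A(\mathbf A))=r^\pm\}$$ for nonnegative integers with $r^0+r^++r^-=m_0=\sharp(K)$. Singular set: $\lambda_n$ is regarded as a function on the part of the considered space where there are at least $n$ eigenvalues. The singular set is the set of points of the space at which some $\lambda_n$ is discontinuous. Here a point at which $\lambda_n$ is not defined but which is a limit of points at which it is defined counts as a discontinuity point. *)

(* Defs.v *)
From HB Require Import structures.
From mathcomp Require Import all_boot all_order all_algebra generic_quotient.
From mathcomp Require Import all_classical all_reals all_analysis.
From mathcomp Require Import complex.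

Set Implicit Arguments.
Unset Strict Implicit.
Unset Printing Implicit Defensive.

Import Order.TTheory GRing.Theory Num.Theory.
Import numFieldNormedType.Exports.

Local Open Scope classical_set_scope.
Local Open Scope ring_scope.
Local Open Scope complex_scope.
Local Open Scope sesquilinear_scope.
Local Open Scope quotient_scope.

Section Integration.
Context {R : realType}.
Local Notation mu := (@lebesgue_measure R).

Definition cintegrable (D : set R) (f : R -> R[i]) : Prop :=
  mu.-integrable D (fun x => (complex.Re (f x))%:E) /\
  mu.-integrable D (fun x => (complex.Im (f x))%:E).

Definition cintegral (D : set R) (f : R -> R[i]) : R[i] :=
  (\int[mu]_(x in D) complex.Re (f x)) +i* (\int[mu]_(x in D) complex.Im (f x)).

Definition mxintegrable m n (D : set R) (F : R -> 'M[R[i]]_(m, n)) : Prop :=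
  forall i j, cintegrable D (fun x => F x i j).

Definition mxintegral m n (D : set R) (F : R -> 'M[R[i]]_(m, n)) :
    'M[R[i]]_(m, n) :=
  \matrix_(i, j) cintegral D (fun x => F x i j).

(* F is absolutely continuous on [a, b] with F' = G almost everywhere: F is an
   indefinite Lebesgue integral of the integrable function G. *)
Definition AC_with_derivative m n (a b : R) (F G : R -> 'M[R[i]]_(m, n)) :
    Prop :=
  mxintegrable `]a, b[ G /\
  forall t, t \in `[a, b] -> F t = F a + mxintegral `]a, t[ G.

End Integration.

Definition posdefmx (R : realType) n (M : 'M[R[i]]_n) : Prop :=
  forall x : 'cV[R[i]]_n, x != 0 -> 0 < (x ^t* *m M *m x) 0 0.

(* The total multiplicities r^0, r^+, r^- are counted on the list of the roots,
   with multiplicity, of the characteristic polynomial.  In R[i], [0 < z] means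
   that z is real and positive. *)
Section Inertia.
Context {R : realType} {n : nat}.
Implicit Type M : 'M[R[i]]_n.

Definition char_roots M : seq R[i] :=
  sval (closed_field_poly_normal (char_poly M)).

Definition r0 M : nat := count (fun z => z == 0) (char_roots M).
Definition rplus M : nat := count (fun z => 0 < z) (char_roots M).
Definition rminus M : nat := count (fun z => z < 0) (char_roots M).

End Inertia.

(* The coefficients are representatives of classes in L^1, so that the
   pointwise conditions on them are required almost everywhere. *)
Record coefficients (R : realType) (d : nat) := Coefficients {
  Pinv : R -> 'M[R[i]]_d ;
  Qcoef : R -> 'M[R[i]]_d ;
  Wcoef : R -> 'M[R[i]]_d
}.

Section Atkinson.
Context {R : realType} {d : nat}.
Local Notation mu := (@lebesgue_measure R).

(* Only the values al 0, .., al N and be 0, .., be N matter. *)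
Definition is_partition (N : nat) (al be : nat -> R) : Prop :=
  (forall i, (i <= N)%N -> al i < be i) /\
  (forall j, (1 <= j <= N)%N -> be j.-1 < al j).

Definition hermitian_L1 (a b : R) (F : R -> 'M[R[i]]_d) : Prop :=
  mxintegrable `]a, b[ F /\
  {ae mu, forall x, x \in `]a, b[ -> F x \is hermsymmx}.

Definition vanishes_on (a b : R) (F : R -> 'M[R[i]]_d) : Prop :=
  {ae mu, forall x, x \in `[a, b] -> F x = 0}.

Definition Omega (N : nat) (al be : nat -> R) (om : coefficients R d) : Prop :=
  [/\ [/\ hermitian_L1 (al 0%N) (be N) (Pinv om),
          hermitian_L1 (al 0%N) (be N) (Qcoef om) &
          hermitian_L1 (al 0%N) (be N) (Wcoef om)],
      forall i, (i <= N)%N ->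
        vanishes_on (al i) (be i) (Pinv om) /\
        posdefmx (mxintegral `[al i, be i] (Wcoef om)) &
      forall j, (1 <= j <= N)%N ->
        [/\ vanishes_on (be j.-1) (al j) (Qcoef om),
            vanishes_on (be j.-1) (al j) (Wcoef om) &
            mxintegral `[be j.-1, al j] (Pinv om) \in unitmx]].

End Atkinson.

Section BoundaryConditions.
Variables (R : realType) (d : nat).

(* The pairs (A, B) are the matrices row_mx A B.  The ascription of R[i] to
   numFieldType is what equips the matrices with their topology. *)
Definition bcmx : topologicalType :=
  'M[(R[i] : numFieldType)]_(d + d, (d + d) + (d + d)).

Definition bcA (M : bcmx) : 'M[R[i]]_(d + d) := lsubmx M.
Definition bcB (M : bcmx) : 'M[R[i]]_(d + d) := rsubmx M.

Definition sa_pairs : set bcmx :=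
  [set M : bcmx | \rank (M : 'M[R[i]]_(_, _)) = (d + d)%N /\
                  bcA M *m (bcB M) ^t* = bcB M *m (bcA M) ^t*].

(* sabc carries the topology induced by that of the matrices *)
Definition sabc := set_type sa_pairs.

Definition gl_equiv (p q : sabc) : bool :=
  `[< exists2 T : 'M[R[i]]_(d + d), T \in unitmx &
      (set_val q : 'M[R[i]]_(_, _)) = T *m (set_val p : 'M[R[i]]_(_, _)) >].

Lemma gl_equiv_refl : reflexive gl_equiv.
Proof.
by move=> p; apply/asboolP; exists 1%:M; rewrite ?unitmx1 ?mul1mx.
Qed.

Lemma gl_equiv_sym : symmetric gl_equiv.
Proof.
suff h p q : gl_equiv p q -> gl_equiv q p by move=> p q; apply/idP/idP; exact: h.
move=> /asboolP[T Tu e]; apply/asboolP; exists (invmx T); first by rewrite unitmx_inv.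
by rewrite e mulmxA mulVmx // mul1mx.
Qed.

Lemma gl_equiv_trans : transitive gl_equiv.
Proof.
move=> q p r /asboolP[T Tu e] /asboolP[U Uu f]; apply/asboolP.
exists (U *m T); first by rewrite unitmx_mul Uu.
by rewrite f e mulmxA.
Qed.

Canonical gl_equiv_rel :=
  EquivRel gl_equiv gl_equiv_refl gl_equiv_sym gl_equiv_trans.

Definition bcspace : topologicalType :=
  quotient_topology {eq_quot gl_equiv}.

Definition bcclass (p : sabc) : bcspace := \pi_{eq_quot gl_equiv} p.

(* "A is the class of M"; in particular M is an admissible pair. *)
Definition is_class_of (A : bcspace) (M : bcmx) : Prop :=
  exists2 p : sabc, set_val p = M & A = bcclass p.

Definition bcrepr (A : bcspace) : bcmx :=
  set_val (repr (A : {eq_quot gl_equiv})).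

End BoundaryConditions.

Section Eigenvalues.
Context {R : realType} {d : nat}.
Variables (a b : R) (om : coefficients R d).

Definition SL_solution (z : R[i]) (u v : R -> 'cV[R[i]]_d) : Prop :=
  AC_with_derivative a b u (fun t => Pinv om t *m v t) /\
  AC_with_derivative a b v (fun t => (Qcoef om t - z *: Wcoef om t) *m u t).

Definition satisfies_bc (M : bcmx R d) (u v : R -> 'cV[R[i]]_d) : Prop :=
  bcA M *m col_mx (- u a) (u b) + bcB M *m col_mx (v a) (v b) = 0.

(* u and v matter on [a, b] only, hence the form of linear independence. *)
Definition has_independent_eigenfunctions (M : bcmx R d) (z : R[i]) (m : nat) :
    Prop :=
  exists u v : 'I_m -> R -> 'cV[R[i]]_d,
    (forall k, SL_solution z (u k) (v k) /\ satisfies_bc M (u k) (v k)) /\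
    (forall c : 'I_m -> R[i],
       (forall t, t \in `[a, b] ->
          \sum_k c k *: u k t = 0 /\ \sum_k c k *: v k t = 0) ->
       forall k, c k = 0).

Definition multiplicity (M : bcmx R d) (z : R[i]) (m : nat) : Prop :=
  has_independent_eigenfunctions M z m /\
  ~ has_independent_eigenfunctions M z m.+1.

(* s lists all the complex eigenvalues, which are real and finite in number, in
   nondecreasing order and counted with multiplicity. *)
Definition is_eigenvalue_list (M : bcmx R d) (s : seq R) : Prop :=
  sorted <=%R s /\
  forall z : R[i], multiplicity M z (count_mem z [seq x%:C | x <- s]).

Definition eigenvalue_list (A : bcspace R d) : seq R :=
  xget [::] [set s | is_eigenvalue_list (bcrepr A) s].

(* lambda_n, with n starting from 1; its value is meaningful on lambda_dom n
   only. *)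
Definition lambda (n : nat) (A : bcspace R d) : R :=
  nth 0 (eigenvalue_list A) n.-1.

Definition lambda_dom (n : nat) : set (bcspace R d) :=
  [set A | (1 <= n <= size (eigenvalue_list A))%N].

Definition lambda_continuous_on (n : nat) (X : set (bcspace R d)) : Prop :=
  X `<=` lambda_dom n /\ {within X, continuous (lambda n)}.

Definition singular_set : set (bcspace R d) :=
  [set A | exists2 n : nat, (1 <= n)%N &
     closure (lambda_dom n) A /\
     ~ (lambda_dom n A /\
        lambda n B @[B --> within (lambda_dom n) (nbhs A)] --> lambda n A)].

End Eigenvalues.

Section Charts.
Context {R : realType} {d : nat}.
Implicit Type K : {set 'I_(d + d)}.

Definition E1 K : 'M[R[i]]_d :=
  diag_mx (\row_i (lshift d i \notin K)%:R).
Definition E2 K : 'M[R[i]]_d :=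
  diag_mx (\row_i (rshift d i \notin K)%:R).

Definition EK K : 'M[R[i]]_((d + d) + (d + d)) :=
  block_mx
    (block_mx (E1 K) 0 0 (E2 K)) (block_mx (1%:M - E1 K) 0 0 (1%:M - E2 K))
    (block_mx (E1 K - 1%:M) 0 0 (E2 K - 1%:M)) (block_mx (E1 K) 0 0 (E2 K)).

Definition chart_coord K (A : bcspace R d) (S : 'M[R[i]]_(d + d)) : Prop :=
  S \is hermsymmx /\ is_class_of A (row_mx S 1%:M *m EK K).

Definition OK K : set (bcspace R d) :=
  [set A | exists S, chart_coord K A S].

(* S(A), for A in OK K *)
Definition Smx K (A : bcspace R d) : 'M[R[i]]_(d + d) :=
  xget 0 [set S | chart_coord K A S].

Definition E0hat K : 'M[R[i]]_(d + d, #|K|) :=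
  \matrix_(i, j) (i == enum_val j)%:R.

Definition SKA K (A : bcspace R d) : 'M[R[i]]_#|K| :=
  (E0hat K) ^t* *m Smx K A *m E0hat K.

Definition JK K (s0 sp sm : nat) : set (bcspace R d) :=
  OK K `&` [set A | [/\ r0 (SKA K A) = s0, rplus (SKA K A) = sp &
                        rminus (SKA K A) = sm]].

Definition Sigma (k : nat) : set (bcspace R d) :=
  [set @bcclass R d p | p in
     [set p | (d + d - \rank (bcB (set_val p)))%N = k]].

End Charts.

(* Main.v *)
Require Import Defs.
From HB Require Import structures.
From mathcomp Require Import all_boot all_order all_algebra generic_quotient.
From mathcomp Require Import all_classical all_reals all_analysis.
From mathcomp Require Import complex.
From mathcomp Require Import zify.

Set Implicit Arguments.
Unset Strict Implicit.
Unset Printing Implicit Defensive.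

Import Order.TTheory GRing.Theory Num.Theory.
Import numFieldNormedType.Exports.

Local Open Scope classical_set_scope.
Local Open Scope ring_scope.
Local Open Scope complex_scope.
Local Open Scope sesquilinear_scope.

Local Open Scope quotient_scope.

(** The idea.

    Since [P^-1] vanishes on the intervals [[al i, be i]] and [Q], [W] vanish on the
    intervals between them, a solution is piecewise constant in [u] and [v] in turn,
    and is determined by finitely many samples.  Let [U] collect the [N + 1] samples
    of [u] and [V] the two boundary values of [v].  The equation becomes
    [(H - z W) U = T^* V] with [H], [W] Hermitian of size [m = (N + 1) d] and [W]
    positive definite, [T U] being the boundary values of [u] ([solution_profile],
    [solution_exists], [sel_residual]).  If the boundary condition has the
    coordinate [S] in the chart [K], eliminating the momenta outside [K] identifies
    the eigenfunctions with the kernel of a bordered Hermitian pencil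

      [[ H' - z W, G ], [ G^*, B ]],

    where [B] is the block of [S] on [K] and [G] is injective
    ([independent_eigenfunctions_pencil]).

    Sylvester's law of inertia counts the eigenvalues of such a pencil: there are
    [m - r0 B] of them, all real, and for real [x] the negative inertia of the pencil
    at [x] is the number of eigenvalues below [x], plus [rminus B + r0 B]
    ([pencil_spectrum]).  If [x] is not an eigenvalue at [A], the pencil at [x] is
    invertible there.  Both its positive and its negative inertia are lower
    semicontinuous, and their sum is the size already, so both are constant near
    [A].  Hence near [A] the number of eigenvalues below [x] changes exactly as
    [- (rminus + r0)] of the block on [K] ([near_count]).

    The theorem follows.  Along the stratum [(s0, sp, sm)], towards a point of the
    stratum [(t0, tp, tm)], the number of eigenvalues below every such [x] exceeds
    that at the limit by [sp - tp].  So the first [sp - tp] eigenvalues escape to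
    [-oo], the following ones converge to those of the limit, and the remaining ones
    escape to [+oo] ([nth_cvg_ninfty], [nth_cvg_finite], [nth_cvg_pinfty]).  On a set
    [Sigma k], where [r0] is constant, the inertia of the block is locally constant
    and all eigenvalues are continuous; [Sigma 0] is open, being the chart of the
    empty set.  For [k > 0], a point of [Sigma k] has only [m - k] eigenvalues, while
    adding suitable small multiples of the identity to [S] yields points with [m] of
    them ([regular_dense]).

    The topology enters through two facts: the class map is open, so that one can
    argue on pairs near a representative, where [S] is a continuous function
    ([nbhs_bcclass], [chartS_cvg]); and the charts cover the space
    ([chart_exists]). *)

(** * Conjugate transposes and Hermitian matrices *)

Section Adjoint.
Context {C : numClosedFieldType}.

Lemma ctrE m n (A : 'M[C]_(m, n)) i j : (A ^t*) i j = (A j i)^*%R.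
Proof. by rewrite !mxE. Qed.

Lemma ctrM m n p (A : 'M[C]_(m, n)) (B : 'M[C]_(n, p)) :
  (A *m B) ^t* = B ^t* *m A ^t*.
Proof. by rewrite trmx_mul map_mxM. Qed.

Lemma ctrD m n (A B : 'M[C]_(m, n)) : (A + B) ^t* = A ^t* + B ^t*.
Proof. by rewrite linearD map_mxD. Qed.

Lemma ctrB m n (A B : 'M[C]_(m, n)) : (A - B) ^t* = A ^t* - B ^t*.
Proof. by rewrite linearB map_mxB. Qed.

Lemma ctrN m n (A : 'M[C]_(m, n)) : (- A) ^t* = - A ^t*.
Proof. by rewrite linearN map_mxN. Qed.

Lemma ctr0 m n : (0 : 'M[C]_(m, n)) ^t* = 0.
Proof. by rewrite linear0 map_mx0. Qed.

Lemma ctr1 n : (1%:M : 'M[C]_n) ^t* = 1%:M.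
Proof. by rewrite trmx1 map_mx1. Qed.

Lemma ctrZ m n (c : C) (A : 'M[C]_(m, n)) : (c *: A) ^t* = c^*%R *: A ^t*.
Proof. by rewrite linearZ /= map_mxZ. Qed.

Lemma ctr_row m n1 n2 (A : 'M[C]_(m, n1)) (B : 'M[C]_(m, n2)) :
  (row_mx A B) ^t* = col_mx (A ^t*) (B ^t*).
Proof. by rewrite tr_row_mx map_col_mx. Qed.

Lemma ctr_col m1 m2 n (A : 'M[C]_(m1, n)) (B : 'M[C]_(m2, n)) :
  (col_mx A B) ^t* = row_mx (A ^t*) (B ^t*).
Proof. by rewrite tr_col_mx map_row_mx. Qed.

Lemma ctr_block m1 m2 n1 n2 (A : 'M[C]_(m1, n1)) (B : 'M[C]_(m1, n2))
    (D : 'M[C]_(m2, n1)) (E : 'M[C]_(m2, n2)) :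
  (block_mx A B D E) ^t* = block_mx (A ^t*) (D ^t*) (B ^t*) (E ^t*).
Proof. by rewrite tr_block_mx map_block_mx. Qed.

Lemma hermP n (A : 'M[C]_n) : (A \is hermsymmx) = (A ^t* == A).
Proof. by rewrite is_hermitianmxE expr0 scale1r eq_sym. Qed.

Lemma hermE n (A : 'M[C]_n) : A \is hermsymmx -> A ^t* = A.
Proof. by rewrite hermP => /eqP. Qed.

Lemma herm_congr n k (A : 'M[C]_n) (Z : 'M[C]_(n, k)) :
  A \is hermsymmx -> Z ^t* *m A *m Z \is hermsymmx.
Proof. by move=> /hermE hA; rewrite hermP !ctrM trmxCK hA mulmxA. Qed.

Lemma mxrank_ctr m n (A : 'M[C]_(m, n)) : \rank (A ^t*) = \rank A.
Proof. by rewrite mxrank_map mxrank_tr. Qed.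

Lemma unitmx_ctr n (A : 'M[C]_n) : (A ^t* \in unitmx) = (A \in unitmx).
Proof. by rewrite map_unitmx unitmx_tr. Qed.

Lemma sqnorm_cV n (x : 'cV[C]_n) : (x ^t* *m x) 0 0 = \sum_i `|x i 0| ^+ 2.
Proof. by rewrite mxE; apply: eq_bigr => i _; rewrite ctrE mulrC -normCK. Qed.

Lemma sqnorm_cV_gt0 n (x : 'cV[C]_n) : x != 0 -> 0 < (x ^t* *m x) 0 0.
Proof.
move=> x0; rewrite sqnorm_cV lt_def sumr_ge0 ?andbT => [|i _]; last exact: exprn_ge0.
apply: contra x0; rewrite psumr_eq0 => [/allP h|i _]; last exact: exprn_ge0.
apply/eqP/matrixP => i j; rewrite ord1 mxE; apply/eqP.
by move: (h i (mem_index_enum _)); rewrite expf_eq0 normr_eq0.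
Qed.

Lemma diag_form n (x : 'rV[C]_n) (y : 'cV[C]_n) :
  (y ^t* *m diag_mx x *m y) 0 0 = \sum_i x 0 i * `|y i 0| ^+ 2.
Proof.
rewrite mxE; apply: eq_bigr => i _; rewrite mul_mx_diag !mxE normCK.
by rewrite mulrAC mulrC; congr (_ * _); rewrite mulrC.
Qed.

End Adjoint.

(** * Inertia of Hermitian matrices *)

Section InertiaTheory.
Context {R : realType}.
Local Notation C := R[i].

Lemma herm_diag n (M : 'M[C]_n) : M \is hermsymmx ->
  exists V : 'M[C]_n, exists x : 'I_n -> R,
    [/\ V *m V ^t* = 1%:M, V ^t* *m V = 1%:M &
        M = V ^t* *m diag_mx (\row_i (x i)%:C) *m V].
Proof.
move=> hM; exists (spectralmx M), (fun i => complex.Re (spectral_diag M 0 i)).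
have U := spectral_unitarymx M.
have U1 : spectralmx M *m (spectralmx M) ^t* = 1%:M by apply/unitarymxP.
split=> //; first exact: mulmx1C.
have -> : \row_i (complex.Re (spectral_diag M 0 i))%:C = spectral_diag M.
  apply/rowP => i; rewrite mxE.
  by have /mxOverP/(_ 0 i)/complex_realP[r ->] := hermitian_spectral_diag_real hM.
rewrite -(invmx_unitary U).
exact/orthomx_spectralP/hermitian_normalmx.
Qed.

Lemma char_rootsE n (M : 'M[C]_n) (s : seq C) :
  char_poly M = \prod_(z <- s) ('X - z%:P) -> perm_eq (char_roots M) s.
Proof.
rewrite /char_roots; case: closed_field_poly_normal => r /= e h.
apply: prod_XsubC_eq; rewrite -h e.
by rewrite (monicP (char_poly_monic M)) scale1r.
Qed.

Lemma char_roots_diag n (V : 'M[C]_n) (x : 'I_n -> R) :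
  V *m V ^t* = 1%:M ->
  perm_eq (char_roots (V ^t* *m diag_mx (\row_i (x i)%:C) *m V))
          [seq (x i)%:C | i <- enum 'I_n].
Proof.
move=> VV; apply: char_rootsE; rewrite big_map /char_poly.
have VV' := mulmx1C VV.
set D := diag_mx _.
have -> : char_poly_mx (V ^t* *m D *m V) =
    map_mx polyC (V ^t*) *m char_poly_mx D *m map_mx polyC V.
  rewrite /char_poly_mx mulmxBr mulmxBl -!map_mxM /=; congr (_ - _).
  by rewrite mul_mx_scalar -scalemxAl -map_mxM VV' map_mx1 scalemx1.
rewrite !det_mulmx mulrC mulrA -det_mulmx -map_mxM VV map_mx1 det1 mul1r.
rewrite -[\det _]/(char_poly D) char_poly_trig ?diag_mx_is_trig //.
by rewrite big_enum; apply: eq_bigr => i _; rewrite !mxE eqxx mulr1n.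
Qed.

Lemma ltc0 (r : R) : ((0 : C) < r%:C) = (0 < r).
Proof. by rewrite -[0]/((0 : R)%:C) ltcR. Qed.

Lemma ltc0N (r : R) : (r%:C < (0 : C)) = (r < 0).
Proof. by rewrite -[0]/((0 : R)%:C) ltcR. Qed.

Lemma eqc0 (r : R) : (r%:C == 0 :> C) = (r == 0).
Proof. by rewrite eq_complex /= eqxx andbT. Qed.

Lemma conjCR (r : R) : (r%:C : C)^*%R = r%:C.
Proof. exact: conjc_real. Qed.

Section Diagonalised.
Variables (n : nat) (V : 'M[C]_n) (x : 'I_n -> R).
Hypothesis VV : V *m V ^t* = 1%:M.
Let M := V ^t* *m diag_mx (\row_i (x i)%:C) *m V.

Lemma r0_diag : r0 M = #|[pred i | x i == 0]|.
Proof.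
rewrite /r0 (permP (char_roots_diag x VV)) count_map enumT cardE size_filter.
by apply: eq_count => i /=; rewrite eqc0.
Qed.

Lemma rplus_diag : rplus M = #|[pred i | 0 < x i]|.
Proof.
rewrite /rplus (permP (char_roots_diag x VV)) count_map enumT cardE size_filter.
by apply: eq_count => i /=; rewrite ltc0.
Qed.

Lemma rminus_diag : rminus M = #|[pred i | x i < 0]|.
Proof.
rewrite /rminus (permP (char_roots_diag x VV)) count_map enumT cardE size_filter.
by apply: eq_count => i /=; rewrite ltc0N.
Qed.

End Diagonalised.
End InertiaTheory.

Section KernelVector.
Context {F : fieldType}.

Lemma col_kernel_vector p k (A : 'M[F]_(p, k)) : (\rank A < k)%N ->
  exists2 c : 'cV[F]_k, c != 0 & A *m c = 0.
Proof.
rewrite -mxrank_tr => rA.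
have /rowV0Pn[v /sub_kermxP vA v0] : kermx A^T != 0.
  by rewrite -mxrank_eq0 mxrank_ker subn_eq0 -ltnNge.
exists v^T; first by rewrite trmx_eq0.
by apply: trmx_inj; rewrite trmx_mul trmxK vA trmx0.
Qed.

Lemma col_free_rank p k (A : 'M[F]_(p, k)) :
  (forall c : 'cV[F]_k, A *m c = 0 -> c = 0) -> \rank A = k.
Proof.
move=> inj; apply/eqP; rewrite eqn_leq rank_leq_col leqNgt.
by apply/negP => /col_kernel_vector[c /eqP c0 /inj].
Qed.

End KernelVector.

Section InertiaLaws.
Context {R : realType}.
Local Notation C := R[i].

Lemma hermN n (M : 'M[C]_n) : M \is hermsymmx -> - M \is hermsymmx.
Proof. by move=> /hermE h; rewrite hermP ctrN h. Qed.

Lemma inertia_opp n (M : 'M[C]_n) : M \is hermsymmx ->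
  [/\ r0 (- M) = r0 M, rplus (- M) = rminus M & rminus (- M) = rplus M].
Proof.
move=> /herm_diag[V [x [VV _ ->]]].
have -> : - (V ^t* *m diag_mx (\row_i (x i)%:C) *m V) =
    V ^t* *m diag_mx (\row_i (- x i)%:C) *m V.
  have -> : \row_i (- x i)%:C = - \row_i (x i)%:C :> 'rV[C]_n.
    by apply/rowP => i; rewrite !mxE rmorphN.
  by rewrite linearN mulmxN mulNmx.
rewrite !r0_diag // !rplus_diag // !rminus_diag //.
by split; apply: eq_card => i; rewrite !inE ?oppr_eq0 ?oppr_gt0 ?oppr_lt0.
Qed.

Lemma inertia_sum n (M : 'M[C]_n) : M \is hermsymmx ->
  (r0 M + rplus M + rminus M)%N = n.
Proof.
move=> /herm_diag[V [x [VV _ ->]]].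
rewrite r0_diag // rplus_diag // rminus_diag // -[RHS](card_ord n).
rewrite -(cardC [pred i | x i == 0]) -addnA; congr addn.
rewrite -(cardID [pred i | 0 < x i] [predC _]); congr addn; apply: eq_card => i.
  by rewrite !inE; case: ltgtP.
by rewrite !inE; case: ltgtP.
Qed.

Lemma diag_neg_basis n (x : 'I_n -> R) (P : {pred 'I_n}) k :
  #|P| = k -> {in P, forall i, x i < 0} ->
  exists Y : 'M[C]_(n, k), Y ^t* *m diag_mx (\row_i (x i)%:C) *m Y = - 1%:M.
Proof.
move=> <- neg.
pose Y := \matrix_(i, j) (if i == enum_val j then (Num.sqrt (- x i))^-1%:C else 0)
  : 'M[C]_(n, #|P|).
exists Y; apply/matrixP => j l; rewrite mul_mx_diag mxE.
under eq_bigr do rewrite !mxE.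
rewrite (bigD1 (enum_val j)) //= eqxx big1 => [|i /negPf ->]; last first.
  by rewrite conjC0 !mul0r.
rewrite addr0 (inj_eq enum_val_inj) !mxE.
case: eqVneq => _; last by rewrite mulr0 mulr0n oppr0.
have xj := neg _ (enum_valP j).
rewrite conjCR -!rmorphM /= mulrAC -expr2 exprVn sqr_sqrtr.
  by rewrite mulr1n invrN mulNr mulVf ?lt_eqF // rmorphN.
by rewrite oppr_ge0 ltW.
Qed.

(** One half of Sylvester's law of inertia; [rminus_max] is the other.  The
    inequalities between inertias below come from combining the two. *)
Lemma rminus_basis n (M : 'M[C]_n) : M \is hermsymmx ->
  exists Y : 'M[C]_(n, rminus M), Y ^t* *m M *m Y = - 1%:M.
Proof.
move=> /herm_diag[V [x [VV VV' ->]]].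
have [Y eY] : exists Y : 'M[C]_(n, #|[pred i | x i < 0]|),
    Y ^t* *m diag_mx (\row_i (x i)%:C) *m Y = - 1%:M.
  by apply: (@diag_neg_basis _ _ [pred i | x i < 0]) => // i; rewrite inE.
rewrite rminus_diag //; exists (V ^t* *m Y); rewrite ctrM trmxCK -!mulmxA.
by rewrite (mulmxA V) VV mul1mx (mulmxA V) VV mul1mx mulmxA.
Qed.

Lemma posdef_id n : posdefmx (1%:M : 'M[C]_n).
Proof. by move=> x x0; rewrite mulmx1 sqnorm_cV_gt0. Qed.

(** On a subspace of larger dimension some nonzero vector has no component along
    the eigenvectors of negative eigenvalue, and the form is nonnegative on it. *)
Lemma rminus_max n k (M : 'M[C]_n) (Y : 'M[C]_(n, k)) : M \is hermsymmx ->
  posdefmx (- (Y ^t* *m M *m Y)) -> (k <= rminus M)%N.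
Proof.
move=> /herm_diag[V [x [VV VV' ->]]]; set D := diag_mx _ => pos.
rewrite rminus_diag // leqNgt; apply/negP => lt.
pose P := [pred i | x i < 0].
pose Sel := \matrix_(j < #|P|, i < n) (i == enum_val j)%:R : 'M[C]_(_, _).
have [|c c0 e] := @col_kernel_vector _ _ _ (Sel *m V *m Y).
  by apply: leq_ltn_trans (rank_leq_row _) lt.
have := pos c c0; rewrite mulmxN mulNmx mxE oppr_gt0.
have -> : c ^t* *m (Y ^t* *m (V ^t* *m D *m V) *m Y) *m c =
    (V *m Y *m c) ^t* *m D *m (V *m Y *m c) by rewrite !ctrM !mulmxA.
rewrite diag_form; apply/negP; rewrite le_gtF // sumr_ge0 // => i _.
rewrite mxE; have [xi|xi] := leP 0 (x i).
  by rewrite mulr_ge0 ?exprn_ge0 // -[0]/((0 : R)%:C) lecR.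
have Pi : i \in P by [].
have Seli l : Sel (enum_rank_in Pi i) l = (l == i)%:R.
  by rewrite mxE enum_rankK_in.
move/matrixP/(_ (enum_rank_in Pi i) 0): e; rewrite -!mulmxA [LHS]mxE [RHS]mxE.
rewrite (bigD1 i) //= big1 => [|l /negPf li]; last by rewrite Seli li mul0r.
by rewrite Seli eqxx mul1r addr0 => ->; rewrite normr0 expr0n mulr0.
Qed.

Lemma rminus_congr_le n k (M : 'M[C]_n) (Z : 'M[C]_(n, k)) : M \is hermsymmx ->
  (rminus (Z ^t* *m M *m Z) <= rminus M)%N.
Proof.
move=> hM; have [Y eY] := rminus_basis (herm_congr Z hM).
apply: (rminus_max (Y := Z *m Y)) => //.
have -> : (Z *m Y) ^t* *m M *m (Z *m Y) = Y ^t* *m (Z ^t* *m M *m Z) *m Y.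
  by rewrite ctrM !mulmxA.
by rewrite eY opprK; exact: posdef_id.
Qed.

Lemma rplus_basis n (M : 'M[C]_n) : M \is hermsymmx ->
  exists Y : 'M[C]_(n, rplus M), Y ^t* *m M *m Y = 1%:M.
Proof.
move=> hM; have [_ _ <-] := inertia_opp hM.
have [Y /eqP eY] := rminus_basis (hermN hM); exists Y.
by move: eY; rewrite mulmxN mulNmx eqr_opp => /eqP.
Qed.

Lemma mxrank_diag (F : fieldType) n (x : 'rV[F]_n) :
  \rank (diag_mx x) = #|[pred i | x 0 i != 0]|.
Proof.
set P := [pred i | _]; pose f : 'I_#|P| -> 'I_n := enum_val.
pose A := \matrix_(i, j) ((i == f j)%:R * x 0 i) : 'M[F]_(n, #|P|).
have rA : \rank A = #|P|.
  apply: col_free_rank => c /matrixP Ac; apply/matrixP => j k; rewrite ord1 !mxE.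
  have := Ac (f j) 0; rewrite !mxE (bigD1 j) //= !mxE eqxx mul1r big1 => [|l lj].
    rewrite addr0 => /eqP; rewrite mulf_eq0 => /orP[|/eqP //].
    by have := enum_valP j; rewrite inE => /negPf ->.
  by rewrite !mxE (inj_eq enum_val_inj) eq_sym (negPf lj) !mul0r.
apply/eqP; rewrite -rA eqn_leq; apply/andP; split.
  have -> : diag_mx x = A *m \matrix_(j, k) (k == f j)%:R.
    apply/matrixP => i k; rewrite !mxE.
    have [xi|xi] := eqVneq (x 0 i) 0.
      by rewrite xi mul0rn big1 // => j _; rewrite !mxE xi mulr0 mul0r.
    have Pi : i \in P by [].
    rewrite (bigD1 (enum_rank_in Pi i)) //= !mxE [f _]enum_rankK_in // eqxx mul1r.
    rewrite mulr_natr (eq_sym k) big1 ?addr0 // => j ji; rewrite !mxE.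
    case: (i =P f j) => [e|_]; last by rewrite !mul0r.
    case/eqP: ji; apply: enum_val_inj; rewrite -[LHS]e.
    by apply/esym/enum_rankK_in.
  exact: mxrankM_maxl.
have -> : A = diag_mx x *m \matrix_(k, j) (k == f j)%:R.
  by apply/matrixP => i j; rewrite mul_diag_mx !mxE mulrC.
exact: mxrankM_maxl.
Qed.

Lemma r0_rank n (M : 'M[C]_n) : M \is hermsymmx -> r0 M = (n - \rank M)%N.
Proof.
move=> /herm_diag[V [x [VV VV' ->]]]; rewrite r0_diag //.
have uV : V \in unitmx by have /mulmx1_unit[] := VV.
rewrite mxrankMfree ?row_free_unit // eqmxMfull ?row_full_unit ?unitmx_ctr //.
rewrite mxrank_diag -[X in (X - _)%N](card_ord n) -(cardC [pred i | x i == 0]).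
set a := (X in (_ + X)%N); set b := (X in (_ - X)%N).
suff -> : a = b by rewrite addnK.
by apply: eq_card => i; rewrite !inE mxE eqc0.
Qed.

End InertiaLaws.

Lemma block_mxN1 (F : fieldType) n1 n2 :
  - block_mx (- 1%:M) 0 0 (- 1%:M) = 1%:M :> 'M[F]_(n1 + n2).
Proof. by rewrite opp_block_mx !opprK !oppr0 -scalar_mx_block. Qed.

Section InertiaSplit.
Context {R : realType}.
Local Notation C := R[i].

(** The sum of two negative subspaces that are orthogonal for the form is negative. *)
Lemma rminus_ortho n k1 k2 (M : 'M[C]_n) (Y1 : 'M[C]_(n, k1)) (Y2 : 'M[C]_(n, k2)) :
  M \is hermsymmx -> Y1 ^t* *m M *m Y2 = 0 ->
  (rminus (Y1 ^t* *m M *m Y1) + rminus (Y2 ^t* *m M *m Y2) <= rminus M)%N.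
Proof.
move=> hM o12.
have o21 : Y2 ^t* *m M *m Y1 = 0.
  by move: (congr1 (fun X => X ^t*) o12); rewrite !ctrM trmxCK hermE // ctr0 mulmxA.
have [B1 e1] := rminus_basis (herm_congr Y1 hM).
have [B2 e2] := rminus_basis (herm_congr Y2 hM).
apply: (rminus_max (Y := row_mx (Y1 *m B1) (Y2 *m B2))) => //.
rewrite ctr_row mul_col_mx mul_col_row !ctrM.
have -> : B1 ^t* *m Y1 ^t* *m M *m (Y1 *m B1) = B1 ^t* *m (Y1 ^t* *m M *m Y1) *m B1.
  by rewrite !mulmxA.
have -> : B2 ^t* *m Y2 ^t* *m M *m (Y2 *m B2) = B2 ^t* *m (Y2 ^t* *m M *m Y2) *m B2.
  by rewrite !mulmxA.
have -> : B1 ^t* *m Y1 ^t* *m M *m (Y2 *m B2) = B1 ^t* *m (Y1 ^t* *m M *m Y2) *m B2.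
  by rewrite !mulmxA.
have -> : B2 ^t* *m Y2 ^t* *m M *m (Y1 *m B1) = B2 ^t* *m (Y2 ^t* *m M *m Y1) *m B1.
  by rewrite !mulmxA.
rewrite e1 e2 o12 o21 !(mulmx0, mul0mx).
by rewrite block_mxN1; exact: posdef_id.
Qed.

Lemma rplus_ortho n k1 k2 (M : 'M[C]_n) (Y1 : 'M[C]_(n, k1)) (Y2 : 'M[C]_(n, k2)) :
  M \is hermsymmx -> Y1 ^t* *m M *m Y2 = 0 ->
  (rplus (Y1 ^t* *m M *m Y1) + rplus (Y2 ^t* *m M *m Y2) <= rplus M)%N.
Proof.
move=> hM o12; have [_ _ <-] := inertia_opp hM.
have [_ _ <-] := inertia_opp (herm_congr Y1 hM).
have [_ _ <-] := inertia_opp (herm_congr Y2 hM).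
have := @rminus_ortho _ _ _ (- M) Y1 Y2 (hermN hM).
by rewrite !(mulmxN, mulNmx) o12 oppr0 => /(_ erefl).
Qed.

Lemma herm1 n : (1%:M : 'M[C]_n) \is hermsymmx.
Proof. by rewrite hermP ctr1. Qed.

Lemma rplus1 n : rplus (1%:M : 'M[C]_n) = n.
Proof.
have h1 := herm1 n; apply/eqP; rewrite eqn_leq; apply/andP; split.
  by rewrite -[leqRHS](inertia_sum h1) addnAC leq_addl.
have [_ _ <-] := inertia_opp h1.
apply: (rminus_max (Y := 1%:M)); first exact: hermN.
by rewrite ctr1 mul1mx mulmx1 opprK; exact: posdef_id.
Qed.

Lemma rminusN1 n : rminus (- 1%:M : 'M[C]_n) = n.
Proof. by have [_ _ ->] := inertia_opp (herm1 n); exact: rplus1. Qed.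

Lemma posdef_normalise n (W : 'M[C]_n) : W \is hermsymmx -> posdefmx W ->
  exists Y : 'M[C]_n, Y ^t* *m W *m Y = 1%:M.
Proof.
move=> hW pW; have e : rplus W = n.
  apply/eqP; rewrite eqn_leq; apply/andP; split.
    by rewrite -[leqRHS](inertia_sum hW) addnAC leq_addl.
  have [_ _ <-] := inertia_opp hW.
  apply: (rminus_max (Y := 1%:M)); first exact: hermN.
  by rewrite ctr1 mul1mx mulmx1 opprK.
by have := rplus_basis hW; rewrite e.
Qed.

Lemma posdef_congr n k (W : 'M[C]_n) (Y : 'M[C]_(n, k)) : posdefmx W ->
  (forall c : 'cV_k, Y *m c = 0 -> c = 0) -> posdefmx (Y ^t* *m W *m Y).
Proof.
move=> pW inj x x0; have -> : x ^t* *m (Y ^t* *m W *m Y) *m x =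
  (Y *m x) ^t* *m W *m (Y *m x) by rewrite ctrM !mulmxA.
by apply: pW; apply: contra_neq x0 => /inj.
Qed.

Lemma col_inj_rank n k (Y : 'M[C]_(n, k)) :
  \rank Y = k -> forall c : 'cV_k, Y *m c = 0 -> c = 0.
Proof.
move=> rY c /(congr1 trmx); rewrite trmx_mul trmx0 => e.
apply: trmx_inj; rewrite trmx0; apply/eqP.
by rewrite -(mulmx_free_eq0 _ (B := Y^T)) ?e // /row_free mxrank_tr rY.
Qed.

End InertiaSplit.

(** * The spectrum of a bordered Hermitian pencil *)

Section HyperbolicSplit.
Context {R : realType}.
Local Notation C := R[i].

(** The isotropic columns [Z0], dual to [Yw], form with them a hyperbolic space,
    whose inertia is [r] of each sign.  Either sign [sg] can be exhibited: [Yw]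
    plus a combination of [Z0] has Gram matrix [sg], and a combination of [Z0]
    subtracted from [N] makes [N] orthogonal to it, without changing the form on
    [N].  The columns [ZR], where the form is already [sg], are added to these. *)
Lemma hyperbolic_split n q p r (D : 'M[C]_n) (N : 'M[C]_(n, q)) (ZR : 'M[C]_(n, p))
    (Z0 Yw : 'M[C]_(n, r)) (sg : R) :
  D \is hermsymmx ->
  Z0 ^t* *m D *m N = 0 -> ZR ^t* *m D *m N = 0 -> Z0 ^t* *m D *m Z0 = 0 ->
  Z0 ^t* *m D *m ZR = 0 -> ZR ^t* *m D *m ZR = (sg%:C)%:M ->
  Z0 ^t* *m D *m Yw = 1%:M -> ZR ^t* *m D *m Yw = 0 ->
  exists N' : 'M[C]_(n, q), exists Y : 'M[C]_(n, p + r),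
    [/\ N' ^t* *m D *m N' = N ^t* *m D *m N, Y ^t* *m D *m Y = (sg%:C)%:M &
        N' ^t* *m D *m Y = 0].
Proof.
move=> hD; pose b k1 k2 (X : 'M[C]_(n, k1)) (Y : 'M[C]_(n, k2)) := X ^t* *m D *m Y.
have bC k1 k2 (X : 'M[C]_(n, k1)) (Y : 'M[C]_(n, k2)) : b _ _ X Y = (b _ _ Y X) ^t*.
  by rewrite /b !ctrM trmxCK hermE // mulmxA.
have bDl k1 k2 (X X' : 'M[C]_(n, k1)) (Y : 'M[C]_(n, k2)) :
    b _ _ (X + X') Y = b _ _ X Y + b _ _ X' Y by rewrite /b ctrD !mulmxDl.
have bDr k1 k2 (X : 'M[C]_(n, k1)) (Y Y' : 'M[C]_(n, k2)) :
    b _ _ X (Y + Y') = b _ _ X Y + b _ _ X Y' by rewrite /b !mulmxDr.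
have bNl k1 k2 (X : 'M[C]_(n, k1)) (Y : 'M[C]_(n, k2)) :
    b _ _ (- X) Y = - b _ _ X Y by rewrite /b ctrN !mulNmx.
have bNr k1 k2 (X : 'M[C]_(n, k1)) (Y : 'M[C]_(n, k2)) :
    b _ _ X (- Y) = - b _ _ X Y by rewrite /b !mulmxN.
have bMl k1 k2 k3 (X : 'M[C]_(n, k1)) (Y : 'M[C]_(n, k2)) (T : 'M[C]_(k1, k3)) :
    b _ _ (X *m T) Y = T ^t* *m b _ _ X Y by rewrite /b ctrM !mulmxA.
have bMr k1 k2 k3 (X : 'M[C]_(n, k1)) (Y : 'M[C]_(n, k2)) (T : 'M[C]_(k2, k3)) :
    b _ _ X (Y *m T) = b _ _ X Y *m T by rewrite /b !mulmxA.
have brow k1 k2 k3 k4 (X : 'M[C]_(n, k1)) (X' : 'M[C]_(n, k2))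
    (Y : 'M[C]_(n, k3)) (Y' : 'M[C]_(n, k4)) :
    b _ _ (row_mx X X') (row_mx Y Y') =
    block_mx (b _ _ X Y) (b _ _ X Y') (b _ _ X' Y) (b _ _ X' Y').
  by rewrite /b ctr_row mul_col_mx mul_col_row.
have bcol k1 k2 k3 (X : 'M[C]_(n, k1)) (Y : 'M[C]_(n, k2)) (Y' : 'M[C]_(n, k3)) :
    b _ _ X (row_mx Y Y') = row_mx (b _ _ X Y) (b _ _ X Y').
  by rewrite /b mul_mx_row.
suff claim : b _ _ Z0 N = 0 -> b _ _ ZR N = 0 -> b _ _ Z0 Z0 = 0 ->
    b _ _ Z0 ZR = 0 -> b _ _ ZR ZR = (sg%:C)%:M ->
    b _ _ Z0 Yw = 1%:M -> b _ _ ZR Yw = 0 ->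
    exists N' : 'M[C]_(n, q), exists Y : 'M[C]_(n, p + r),
    [/\ b _ _ N' N' = b _ _ N N, b _ _ Y Y = (sg%:C)%:M & b _ _ N' Y = 0] by [].
move: (b) bC bDl bDr bNl bNr bMl bMr brow bcol.
move=> {}b bC bDl bDr bNl bNr bMl bMr brow bcol Z0N ZRN Z0Z0 Z0ZR ZRZR Z0Yw ZRYw.
have NZ0 : b _ _ N Z0 = 0 by rewrite bC Z0N ctr0.
have NZR : b _ _ N ZR = 0 by rewrite bC ZRN ctr0.
have ZRZ0 : b _ _ ZR Z0 = 0 by rewrite bC Z0ZR ctr0.
have YwZ0 : b _ _ Yw Z0 = 1%:M by rewrite bC Z0Yw ctr1.
have YwZR : b _ _ Yw ZR = 0 by rewrite bC ZRYw ctr0.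
pose E := b _ _ Yw Yw.
have hE : E ^t* = E by rewrite /E -bC.
(* Adding [Z0 T] to [Yw] adds [T + T^*] to its Gram matrix [E], and half of
   [sg - E] is Hermitian. *)
pose T := ((2%:R^-1)%:C : C) *: ((sg%:C)%:M - E).
have hT : T ^t* = T.
  by rewrite /T ctrZ conjCR ctrB hE tr_scalar_mx map_scalar_mx /= conjCR.
have TT : T + T = (sg%:C)%:M - E.
  rewrite -scalerDl -rmorphD /= -mulr2n -[_^-1 *+ 2]mulr_natl mulfV ?pnatr_eq0 //.
  by rewrite scale1r.
pose Y3 := Yw + Z0 *m T.
exists (N + - (Z0 *m b _ _ Yw N)), (row_mx ZR Y3); split.
- by rewrite !(bDl, bDr, bNl, bNr, bMl, bMr, Z0Z0, Z0N, NZ0)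
    !(mulmx0, mul0mx, oppr0, addr0).
- rewrite brow !(bDl, bDr, bMl, bMr, Z0Z0, Z0Yw, ZRZ0, Z0ZR, ZRYw, YwZ0, YwZR, ZRZR).
  rewrite !(mulmx0, mul0mx, addr0, mulmx1, mul1mx) -/E hT -addrA TT addrC subrK.
  by rewrite -scalar_mx_block.
rewrite bcol !(bDl, bDr, bNl, bNr, bMl, bMr, Z0Z0, Z0N, NZ0, Z0ZR, NZR, Z0Yw).
rewrite !(mulmx0, mul0mx, oppr0, addr0, mulmx1) -bC subrr.
exact: row_mx0.
Qed.

End HyperbolicSplit.

Section Pencil.
Context {R : realType} {m k : nat}.
Local Notation C := R[i].
Variables (H W : 'M[C]_m) (G : 'M[C]_(m, k)) (B : 'M[C]_k).
Hypotheses (hH : H \is hermsymmx) (hW : W \is hermsymmx) (pW : posdefmx W).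
Hypotheses (hB : B \is hermsymmx) (rG : \rank G = k).

Definition pencil (z : C) : 'M[C]_(m + k) := block_mx (H - z *: W) G (G ^t*) B.

Lemma herm_pencil (x : R) : pencil x%:C \is hermsymmx.
Proof.
by rewrite hermP ctr_block trmxCK ctrB ctrZ conjCR !hermE.
Qed.

Let r : nat := \rank (kermx B).
Let N0 : 'M[C]_(k, r) := (row_base (kermx B)) ^t*.

Let N0B : N0 ^t* *m B = 0.
Proof.
by rewrite /N0 trmxCK; apply/sub_kermxP; rewrite eq_row_base.
Qed.

Let BN0 : B *m N0 = 0.
Proof.
have := congr1 (fun Z => Z ^t*) N0B.
by rewrite ctrM trmxCK ctr0 hermE.
Qed.

Let rE : r = r0 B.
Proof. by rewrite /r mxrank_ker r0_rank. Qed.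

Let X : 'M[C]_(r, m) := (G *m N0) ^t*.

Let rX : \rank X = r.
Proof.
rewrite /X mxrank_ctr; apply: col_free_rank => c; rewrite -mulmxA.
move/(col_inj_rank rG); apply: col_inj_rank.
by rewrite /N0 mxrank_ctr eq_row_base.
Qed.

Let q : nat := \rank (cokermx X).

Let qE : q = (m - r0 B)%N.
Proof. by rewrite /q mxrank_coker rX rE. Qed.

(* A basis of the orthogonal of the range of [G N0], chosen orthonormal for [W]
   so that the pencil restricted to it is of the form [A - z]. *)
Let frame : exists Nu : 'M[C]_(m, q),
  [/\ X *m Nu = 0, Nu ^t* *m W *m Nu = 1%:M &
      forall p (v : 'M[C]_(m, p)), Nu ^t* *m v = 0 -> exists s, v = G *m N0 *m s].
Proof.
pose N1 := col_base (cokermx X).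
have XN1 : X *m N1 = 0.
  apply: (row_free_inj (row_base_free (cokermx X))).
  by rewrite -mulmxA mulmx_base mulmx_coker mul0mx.
have N1inj (c : 'cV_q) : N1 *m c = 0 -> c = 0.
  apply: col_inj_rank; rewrite -(mxrank_tr N1); apply/eqP; rewrite mxrank_tr.
  by rewrite -/(row_full _) col_base_full.
have [Y eY] := posdef_normalise (herm_congr N1 hW) (posdef_congr pW N1inj).
have uY : Y \in unitmx.
  by have /mulmx1C/mulmx1_unit[] : (Y ^t* *m (N1 ^t* *m W *m N1)) *m Y = 1%:M.
exists (N1 *m Y); split.
- by rewrite mulmxA XN1 mul0mx.
- by rewrite ctrM -eY !mulmxA.
move=> p v; rewrite ctrM => e.
have e1 : N1 ^t* *m v = 0.
  have uYs : Y ^t* \in unitmx by rewrite unitmx_ctr.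
  by rewrite -[LHS](mulKmx uYs) (mulmxA (Y ^t*)) e mulmx0.
have /submxP[s es] : (v ^t* <= X)%MS.
  rewrite submxE -(mulmx_base (cokermx X)) mulmxA -/N1.
  have -> : v ^t* *m N1 = 0 by rewrite -[N1]trmxCK -ctrM e1 ctr0.
  by rewrite mul0mx.
exists (s ^t*); rewrite -[LHS]trmxCK es /X.
by rewrite ctrM trmxCK.
Qed.

Let left_inverse : exists w : 'M[C]_(m, r), w ^t* *m (G *m N0) = 1%:M.
Proof.
exists (pinvmx X); rewrite -[G *m N0]trmxCK -ctrM -/X.
by rewrite mulmxVp ?ctr1 // /row_free rX.
Qed.

Let solve p (Z : 'M[C]_(p, k)) : Z *m N0 = 0 -> exists Y, Z = Y *m B.
Proof.
move=> ZN; suff /submxP[Y ->] : (Z <= B)%MS by exists Y.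
rewrite submxE.
have /submxP[Y eY] : ((cokermx B) ^t* <= N0 ^t*)%MS.
  rewrite /N0 trmxCK eq_row_base; apply/sub_kermxP.
  by rewrite -[X in _ *m X](hermE hB) -ctrM mulmx_coker ctr0.
have -> : cokermx B = N0 *m Y ^t* by rewrite -[LHS]trmxCK eY ctrM trmxCK.
by rewrite mulmxA ZN mul0mx.
Qed.

Let pencil_mul (z : C) p1 p2 (u1 : 'M[C]_(m, p1)) (y1 : 'M[C]_(k, p1))
    (u2 : 'M[C]_(m, p2)) (y2 : 'M[C]_(k, p2)) :
  (col_mx u1 y1) ^t* *m pencil z *m (col_mx u2 y2) =
  u1 ^t* *m ((H - z *: W) *m u2 + G *m y2) + y1 ^t* *m (G ^t* *m u2 + B *m y2).
Proof. by rewrite ctr_col -mulmxA mul_block_col mul_row_col. Qed.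

(** Let [N0] span the kernel of [B] and let [Nu] span the orthogonal of the range
    of [G N0].  Since [G^* Nu] is orthogonal to the kernel of [B], the columns
    [Nu] extend to columns [N = (Nu, Np)] killed by the second row of the pencil;
    on them the pencil is [A - z] with [A] Hermitian of size [m - r0 B].  The
    columns [(0, y)] are orthogonal to [N]; [B] gives there [rminus B] negative
    and [rplus B] positive directions, and the isotropic columns [(0, N0)], paired
    with columns [(w, y)], give [r0 B] more of each sign.  These lower bounds for
    the inertia of the pencil add up to its size, hence are equalities, and [s]
    is the spectrum of [A]. *)
Lemma pencil_spectrum : exists s : seq R,
  [/\ sorted <=%R s, size s = (m - r0 B)%N,
      forall x : R, rminus (pencil x%:C) =
        (count (fun y => (y < x)%R) s + (rminus B + r0 B))%N &
      forall z : C, (m + k - \rank (pencil z))%N =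
        count_mem z [seq y%:C | y <- s]].
Proof.
have [Nu [XNu WNu spanNu]] := frame.
have [w wX] := left_inverse.
have [Np eNp] : exists Np, G ^t* *m Nu + B *m Np = 0.
  have [|Y eY] := @solve _ (Nu ^t* *m G).
    by rewrite -mulmxA -[G *m N0]trmxCK -ctrM XNu ctr0.
  exists (- Y ^t*); rewrite mulmxN -{1}(hermE hB) -ctrM -eY ctrM trmxCK.
  exact: subrr.
have NuGN0 : Nu ^t* *m G *m N0 = 0.
  by rewrite -mulmxA -[G *m N0]trmxCK -ctrM XNu ctr0.
pose N := col_mx Nu Np; pose Z0 := col_mx (0 : 'M[C]_(m, r)) N0.
pose A := Nu ^t* *m (H *m Nu + G *m Np).
have pencilN (z : C) : N ^t* *m pencil z *m N = A - z%:M.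
  rewrite pencil_mul eNp mulmx0 addr0 mulmxBl addrAC mulmxBr -/A.
  by rewrite -scalemxAl -scalemxAr mulmxA WNu scalemx1.
have hA : A \is hermsymmx.
  have -> : A = N ^t* *m pencil 0 *m N by rewrite pencilN raddf0 subr0.
  exact/herm_congr/(herm_pencil 0).
have [V [a [VV VV' eA]]] := herm_diag hA.
have eAx (x : R) : A - (x%:C)%:M = V ^t* *m diag_mx (\row_i (a i - x)%:C) *m V.
  have -> : \row_i (a i - x)%:C = \row_i (a i)%:C - const_mx x%:C :> 'rV[C]_q.
    by apply/rowP => i; rewrite !mxE rmorphB.
  rewrite linearB /= mulmxBr mulmxBl -eA diag_const_mx mul_mx_scalar -scalemxAl VV'.
  by rewrite scalemx1.
have rleB : (r0 B <= m)%N by rewrite -rE -rX rank_leq_col.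
have Nuinj p (c : 'M[C]_(q, p)) : Nu *m c = 0 -> c = 0.
  by move/(congr1 (mulmx (Nu ^t* *m W))); rewrite mulmxA WNu mul1mx mulmx0.
have b0 (z : C) p (y : 'M[C]_(k, p)) : (col_mx 0 y) ^t* *m pencil z *m N = 0.
  by rewrite pencil_mul eNp ctr0 mul0mx mulmx0 addr0.
have split_at (x sg : R) p (Rs : 'M[C]_(k, p)) : sg * sg = 1 ->
    Rs ^t* *m B *m Rs = (sg%:C)%:M ->
  exists N' : 'M[C]_(m + k, q), exists Y : 'M[C]_(m + k, p + r),
    [/\ N' ^t* *m pencil x%:C *m N' = A - (x%:C)%:M,
        Y ^t* *m pencil x%:C *m Y = (sg%:C)%:M &
        N' ^t* *m pencil x%:C *m Y = 0].
  move=> sg2 eRs; pose y := - (sg%:C *: (Rs *m (Rs ^t* *m (G ^t* *m w)))).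
  rewrite -pencilN.
  apply: (@hyperbolic_split _ _ _ _ _ _ N (col_mx 0 Rs) Z0 (col_mx w y)) => //.
  - exact: herm_pencil.
  - exact: b0.
  - by rewrite pencil_mul ctr0 mul0mx add0r !mulmxDr BN0 !mulmx0 addr0.
  - by rewrite pencil_mul ctr0 mul0mx add0r !mulmx0 add0r mulmxA N0B mul0mx.
  - by rewrite pencil_mul ctr0 mul0mx add0r !mulmx0 add0r mulmxA eRs.
  - rewrite pencil_mul ctr0 mul0mx add0r mulmxDr [X in _ + X]mulmxA N0B mul0mx addr0.
    by move: (congr1 (fun Z => Z ^t*) wX); rewrite !ctrM (trmxCK w) ctr1 mulmxA.
  rewrite pencil_mul ctr0 mul0mx add0r mulmxDr mulmxN mulmxN -!scalemxAr.
  rewrite (mulmxA B) (mulmxA _ (B *m Rs)) (mulmxA _ B) eRs mul_scalar_mx scalerA.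
  by rewrite -rmorphM /= sg2 scale1r subrr.
have rminus_ge (x : R) :
    (rminus (A - (x%:C)%:M) + (rminus B + r) <= rminus (pencil x%:C))%N.
  have [Rm eRm] := rminus_basis hB.
  have [||N' [Y [NN YY NY]]] := @split_at x (-1) _ Rm.
  - by rewrite mulrNN mulr1.
  - by rewrite eRm rmorphN raddfN.
  have := rminus_ortho (herm_pencil x) NY.
  by rewrite NN YY rmorphN raddfN /= rminusN1.
have rplus_ge (x : R) :
    (rplus (A - (x%:C)%:M) + (rplus B + r) <= rplus (pencil x%:C))%N.
  have [Rm eRm] := rplus_basis hB.
  have [||N' [Y [NN YY NY]]] := @split_at x 1 _ Rm.
  - by rewrite mulr1.
  - by rewrite eRm.
  have := rplus_ortho (herm_pencil x) NY.
  by rewrite NN YY rplus1.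
have r0_ge (x : R) : (r0 (A - (x%:C)%:M) <= r0 (pencil x%:C))%N.
  rewrite r0_rank; last by rewrite hermP ctrB tr_scalar_mx map_scalar_mx /= conjCR hermE.
  rewrite r0_rank; last exact: herm_pencil.
  pose K := (row_base (kermx (A - (x%:C)%:M)^T))^T.
  have AK : (A - (x%:C)%:M) *m K = 0.
    apply: trmx_inj; rewrite trmx_mul trmx0 trmxK; apply/sub_kermxP.
    by rewrite eq_row_base.
  (* For [c] in the kernel of [A - x], the first row of the pencil sends [N c] to
     a vector orthogonal to [Nu], which a correction by [Z0] cancels. *)
  have [|S eS] := spanNu _ (((H - x%:C *: W) *m Nu + G *m Np) *m K).
    rewrite mulmxA (_ : _ *m (_ + _) = A - (x%:C)%:M) //.
    by rewrite -pencilN pencil_mul eNp mulmx0 addr0.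
  have eZ : pencil x%:C *m (N *m K - Z0 *m S) = 0.
    rewrite mulmxBr !mulmxA !mul_block_col eNp BN0 !mulmx0 add0r addr0 !mul_col_mx.
    by rewrite eS !mul0mx subrr.
  have rZ : \rank (N *m K - Z0 *m S) = (q - \rank (A - (x%:C)%:M)%R)%N.
    rewrite col_free_rank ?mxrank_ker ?mxrank_tr // => c.
    rewrite /N /Z0 !mul_col_mx opp_col_mx add_col_mx mul0mx subr0 mul_col_mx.
    rewrite -(col_mx0 _ m k) => /eq_col_mx[+ _]; rewrite -mulmxA => /Nuinj.
    by apply: col_inj_rank; rewrite mxrank_tr eq_row_base.
  by rewrite leq_subRL ?rank_leq_row // -rZ mulmx0_rank_max.
have hAx (x : R) : A - (x%:C)%:M \is hermsymmx.
  by rewrite hermP ctrB tr_scalar_mx map_scalar_mx /= conjCR hermE.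
have mE : m = (q + r0 B)%N by rewrite qE subnK.
have exact_at (x : R) : rminus (pencil x%:C) =
    (rminus (A - (x%:C)%:M)%R + (rminus B + r0 B))%N /\
    r0 (pencil x%:C) = r0 (A - (x%:C)%:M).
  have := rminus_ge x; have := rplus_ge x; have := r0_ge x; rewrite rE.
  have := inertia_sum (herm_pencil x); have := inertia_sum (hAx x).
  have := inertia_sum hB; lia.
pose s := sort <=%R [seq a i | i <- enum 'I_q].
have countE (p : pred R) : count p s = #|[pred i | p (a i)]|.
  by rewrite (permP (permEl (perm_sort _ _))) count_map enumT cardE size_filter.
exists s; split.
- exact: (sort_sorted (@le_total _ R)).
- by rewrite size_sort size_map size_enum_ord.
- move=> x; have [-> _] := exact_at x; congr addn.
  rewrite eAx rminus_diag // countE; apply: eq_card => i.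
  by rewrite !inE subr_lt0.
(* A kernel vector [(u, y)] at a nonreal [z] has [u = 0], as [z (u^* W u)] is the
   value of a Hermitian form; then [y = 0] since [G] is injective. *)
move=> z; have [/complex_realP[x ->]|zNreal] := boolP (z \is Num.real).
  rewrite -r0_rank; last exact: herm_pencil.
  have [_ ->] := exact_at x; rewrite eAx r0_diag // count_map countE.
  by apply: eq_card => i; rewrite !inE subr_eq0 eq_complex /= eqxx andbT.
rewrite [RHS](_ : _ = 0%N); last first.
  apply/count_memPn/mapP => -[x _ e]; case/negP: zNreal; rewrite e.
  by apply/complex_realP; exists x.
rewrite col_free_rank ?subnn // => c ec; rewrite -[c]vsubmxK.
set u := usubmx c; set y := dsubmx c.
have eq0 : (c ^t* *m pencil z *m c) 0 0 = 0 by rewrite -mulmxA ec mulmx0 mxE.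
have [u0|u0] := eqVneq u 0.
  move: ec; rewrite -[c]vsubmxK -/u -/y u0 mul_block_col mulmx0 add0r -(col_mx0 _ m k).
  by move=> /eq_col_mx[/(col_inj_rank rG) -> _]; rewrite col_mx0.
case/negP: zNreal.
have hpos := pW u0.
have epz : pencil z = pencil 0 - z *: block_mx W 0 0 0.
  by rewrite /pencil scale_block_mx opp_block_mx add_block_mx !scaler0 !subr0 scale0r subr0.
have ez : (c ^t* *m pencil 0 *m c) 0 0 = z * (u ^t* *m W *m u) 0 0.
  have cW : c ^t* *m block_mx W 0 0 0 *m c = u ^t* *m W *m u.
    rewrite -[c]vsubmxK -/u -/y ctr_col mul_row_block !mulmx0 !addr0 mul_row_col.
    by rewrite mul0mx addr0.
  move: eq0; rewrite epz mulmxBr mulmxBl -scalemxAr -scalemxAl cW mxE.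
  rewrite [X in _ + X]mxE [X in _ - X]mxE.
  by move=> /eqP; rewrite subr_eq0 => /eqP.
have -> : z = (c ^t* *m pencil 0 *m c) 0 0 / (u ^t* *m W *m u) 0 0.
  by rewrite ez mulfK // gt_eqF.
rewrite realM ?realV ?(gtr0_real hpos) // CrealE.
have := herm_congr c (herm_pencil 0) => /hermE/matrixP/(_ 0 0).
by rewrite ctrE => ->.
Qed.

End Pencil.

(** * Integrals of complex and matrix functions *)

Section ComplexIntegral.
Context {R : realType}.
Local Notation mu := (@lebesgue_measure R).
Local Notation C := R[i].

Lemma ReM (x y : C) :
  complex.Re (x * y) = complex.Re x * complex.Re y - complex.Im x * complex.Im y.
Proof. by case: x; case: y. Qed.

Lemma ImM (x y : C) :
  complex.Im (x * y) = complex.Re x * complex.Im y + complex.Im x * complex.Re y.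
Proof. by case: x; case: y. Qed.

Lemma ReD (x y : C) : complex.Re (x + y) = complex.Re x + complex.Re y.
Proof. by case: x; case: y. Qed.

Lemma ImD (x y : C) : complex.Im (x + y) = complex.Im x + complex.Im y.
Proof. by case: x; case: y. Qed.

Lemma integrableDE D (f g : R -> R) : measurable D ->
  mu.-integrable D (EFin \o f) -> mu.-integrable D (EFin \o g) ->
  mu.-integrable D (EFin \o (fun x => f x + g x)).
Proof. by move=> mD fi gi; apply: eq_integrable (integrableD mD fi gi). Qed.

Lemma integrableBE D (f g : R -> R) : measurable D ->
  mu.-integrable D (EFin \o f) -> mu.-integrable D (EFin \o g) ->
  mu.-integrable D (EFin \o (fun x => f x - g x)).
Proof. by move=> mD fi gi; apply: eq_integrable (integrableB mD fi gi). Qed.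

(** The factors by which an integrable function can be multiplied. *)
Definition bounded_measurable (D : set R) (h : R -> R) : Prop :=
  measurable_fun D h /\ exists M, forall x, D x -> `|h x| <= M.

Definition cbounded_measurable (D : set R) (h : R -> C) : Prop :=
  bounded_measurable D (fun x => complex.Re (h x)) /\
  bounded_measurable D (fun x => complex.Im (h x)).

Lemma integrableMb D (f h : R -> R) : measurable D ->
  mu.-integrable D (EFin \o f) -> bounded_measurable D h ->
  mu.-integrable D (EFin \o (fun x => f x * h x)).
Proof.
move=> mD fi [mh [M hM]]; apply: eq_integrable (integrableMl mD fi mh _) => //.
exists M; split; first exact: num_real.
by move=> y My x Dx /=; rewrite (le_trans (hM _ Dx)) // ltW.
Qed.

Lemma bounded_measurable_cst D (c : R) : bounded_measurable D (fun=> c).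
Proof. by split; [exact: measurable_cst|exists `|c|]. Qed.

Lemma cbounded_measurable_cst D (c : C) : cbounded_measurable D (fun=> c).
Proof. by split; exact: bounded_measurable_cst. Qed.

Lemma bounded_measurableD D f g :
  bounded_measurable D f -> bounded_measurable D g ->
  bounded_measurable D (fun x => f x + g x).
Proof.
move=> [mf [M fM]] [mg [M' gM]]; split; first exact: measurable_realfun.measurable_funD.
by exists (M + M') => x Dx; rewrite (le_trans (ler_normD _ _)) // lerD ?fM ?gM.
Qed.

Lemma cintegrableM D (f h : R -> C) : measurable D ->
  cintegrable D f -> cbounded_measurable D h -> cintegrable D (fun x => f x * h x).
Proof.
move=> mD [f1 f2] [h1 h2]; split.
  under [X in integrable _ _ X]eq_fun do rewrite ReM.
  by apply: integrableBE => //; exact: integrableMb.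
under [X in integrable _ _ X]eq_fun do rewrite ImM.
by apply: integrableDE => //; exact: integrableMb.
Qed.

Lemma cintegrableD D (f g : R -> C) : measurable D ->
  cintegrable D f -> cintegrable D g -> cintegrable D (fun x => f x + g x).
Proof.
move=> mD [f1 f2] [g1 g2]; split.
  under [X in integrable _ _ X]eq_fun do rewrite ReD.
  exact: integrableDE.
under [X in integrable _ _ X]eq_fun do rewrite ImD.
exact: integrableDE.
Qed.

Lemma cintegralD D (f g : R -> C) : measurable D ->
  cintegrable D f -> cintegrable D g ->
  cintegral D (fun x => f x + g x) = cintegral D f + cintegral D g.
Proof.
move=> mD [f1 f2] [g1 g2]; rewrite /cintegral.
transitivity ((\int[mu]_(x in D) (complex.Re (f x) + complex.Re (g x))) +i*
              (\int[mu]_(x in D) (complex.Im (f x) + complex.Im (g x)))).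
  by congr (_ +i* _); apply: eq_Rintegral => x _; rewrite ?ReD ?ImD.
by rewrite !RintegralD.
Qed.

Lemma cintegralMr D (f : R -> C) (c : C) : measurable D -> cintegrable D f ->
  cintegral D (fun x => f x * c) = cintegral D f * c.
Proof.
move=> mD [f1 f2]; rewrite /cintegral.
transitivity
 ((\int[mu]_(x in D) (complex.Re (f x) * complex.Re c - complex.Im (f x) * complex.Im c))
  +i*
  (\int[mu]_(x in D) (complex.Re (f x) * complex.Im c + complex.Im (f x) * complex.Re c))).
  by congr (_ +i* _); apply: eq_Rintegral => x _; rewrite ?ReM ?ImM.
rewrite RintegralB //; try exact: integrableMb (bounded_measurable_cst _ _).
rewrite RintegralD //; try exact: integrableMb (bounded_measurable_cst _ _).
by rewrite !RintegralZr //; case: c.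
Qed.

Lemma cintegrable0 D : measurable D -> cintegrable D (fun=> 0 : C).
Proof. by move=> mD; split; exact: integrable0. Qed.

Lemma cintegral0 D : cintegral D (fun=> 0 : C) = 0.
Proof. by rewrite /cintegral /Rintegral /= integral0. Qed.

Lemma cintegrable_sum D I (s : seq I) (f : I -> R -> C) : measurable D ->
  (forall i, cintegrable D (f i)) -> cintegrable D (fun x => \sum_(i <- s) f i x).
Proof.
move=> mD fi; elim: s => [|i s IH].
  by under eq_fun do rewrite big_nil; exact: cintegrable0.
by under eq_fun do rewrite big_cons; exact: cintegrableD.
Qed.

Lemma cintegral_sum D I (s : seq I) (f : I -> R -> C) : measurable D ->
  (forall i, cintegrable D (f i)) ->
  cintegral D (fun x => \sum_(i <- s) f i x) = \sum_(i <- s) cintegral D (f i).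
Proof.
move=> mD fi; elim: s => [|i s IH].
  by under eq_fun do rewrite big_nil; rewrite big_nil cintegral0.
under eq_fun do rewrite big_cons.
by rewrite big_cons cintegralD // ?IH //; exact: cintegrable_sum.
Qed.

Lemma cintegrableS (D D' : set R) (f : R -> C) : measurable D -> measurable D' ->
  D' `<=` D -> cintegrable D f -> cintegrable D' f.
Proof. by move=> mD mD' sD [f1 f2]; split; [move: f1|move: f2]; exact: integrableS. Qed.

Lemma ae_imply (P Q : R -> Prop) : (forall x, P x -> Q x) ->
  {ae mu, forall x, P x} -> {ae mu, forall x, Q x}.
Proof. by move=> PQ; apply: filterS PQ; exact: (ae_filter_ringOfSetsType mu). Qed.

Lemma ae_and (P Q : R -> Prop) :
  {ae mu, forall x, P x} -> {ae mu, forall x, Q x} -> {ae mu, forall x, P x /\ Q x}.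
Proof. by apply: filterI; exact: (ae_filter_ringOfSetsType mu). Qed.

Lemma ae_below (P : nat -> R -> Prop) N :
  (forall i, (i < N)%N -> {ae mu, forall x, P i x}) ->
  {ae mu, forall x, forall i, (i < N)%N -> P i x}.
Proof.
elim: N => [_|N IH PN].
  by apply: ae_imply (@filterT _ _ (ae_filter_ringOfSetsType mu)).
have := ae_and (IH (fun i iN => PN i (ltnW iN))) (PN N (ltnSn N)).
apply: ae_imply => x [Pi PNx] i; rewrite ltnS leq_eqVlt => /predU1P[->//|].
exact: Pi.
Qed.

Lemma Rintegral_ae_eq D (f g : R -> R) : measurable D ->
  mu.-integrable D (EFin \o f) -> mu.-integrable D (EFin \o g) ->
  {ae mu, forall x, D x -> f x = g x} ->
  \int[mu]_(x in D) f x = \int[mu]_(x in D) g x.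
Proof.
move=> mD /integrableP[mf _] /integrableP[mg _] fg; congr fine.
apply: ae_eq_integral => //.
by apply: filterS fg => x + Dx => /(_ Dx) /= ->.
Qed.

Lemma Rintegral_split (r s t : R) (f : R -> R) : r <= s -> s <= t ->
  mu.-integrable `]r, t[ (EFin \o f) ->
  \int[mu]_(x in `]r, t[) f x =
  \int[mu]_(x in `]r, s[) f x + \int[mu]_(x in `]s, t[) f x.
Proof.
move=> rs; rewrite le_eqVlt => /predU1P[->|st] fi.
  by rewrite [X in _ + X](_ : _ = 0) ?addr0 // set_itv_ge ?bnd_simp ?ltxx // Rintegral_set0.
rewrite -(@Rintegral_itvB _ f (BRight r) (BLeft t) s) // -Rintegral_itv_bndo_bndc.
  by rewrite addrC subrK.
by apply: integrableS fi => //; apply: subset_itvl; rewrite bnd_simp ltW.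
Qed.

Lemma cintegral_split (r s t : R) (f : R -> C) : r <= s -> s <= t ->
  cintegrable `]r, t[ f ->
  cintegral `]r, t[ f = cintegral `]r, s[ f + cintegral `]s, t[ f.
Proof.
by move=> rs st [f1 f2]; rewrite /cintegral (Rintegral_split rs st) //
  (Rintegral_split (f := fun x => complex.Im (f x)) rs st).
Qed.

End ComplexIntegral.

Section IndefiniteIntegral.
Context {R : realType}.
Local Notation mu := (@lebesgue_measure R).
Local Notation C := R[i].

(** Measurability comes from continuity, known for the integral over [[a, t]] of a
    function integrable on [[a, b]]: hence the restriction of [f]. *)
Lemma bounded_measurable_primitive (a b : R) (f : R -> R) : a < b ->
  mu.-integrable `]a, b[ (EFin \o f) ->
  bounded_measurable `]a, b[ (fun t => \int[mu]_(x in `]a, t[) f x).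
Proof.
move=> ab fi.
have fiS t : t \in `]a, b[ -> mu.-integrable `]a, t[ (EFin \o f).
  rewrite in_itv /= => /andP[_ tb]; apply: integrableS fi => //.
  by apply: subset_itvl; rewrite bnd_simp ltW.
split; last first.
  exists (\int[mu]_(x in `]a, b[) `|f x|) => t /= tab.
  rewrite (le_trans (le_normr_Rintegral _ (fiS _ tab))) //.
  move: tab; rewrite in_itv /= => /andP[at_ tb].
  rewrite (@Rintegral_split _ a t b) ?(ltW at_) ?(ltW tb) //.
    by rewrite lerDl Rintegral_ge0.
  exact: integrable_norm.
have gi : mu.-integrable `[a, b] (EFin \o (f \_ `]a, b[)).
  rewrite -restrict_EFin; apply/integrable_restrict => //.
  by rewrite setIidr //; apply: subset_itvScc; rewrite bnd_simp.
have ctn := parameterized_integral_continuous (ltW ab) gi.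
have mab := measurable_realfun.subspace_continuous_measurable_fun
  (measurable_itv `[a, b]) ctn.
have sab : `]a, b[ `<=` `[a, b] := @subset_itv_oo_cc _ R a b.
have := measurable_funS (measurable_itv `[a, b]) sab mab.
apply: eq_measurable_fun => t; rewrite inE /= => tab.
suff : parameterized_integral mu a t (f \_ `]a, b[) = \int[mu]_(x in `]a, t[) f x by [].
rewrite /parameterized_integral -Rintegral_mkcondr.
have -> : [set` `[a, t]] `&` [set` `]a, b[] = [set` `]a, t]].
  apply/seteqP; split => y /=; rewrite !in_itv /=.
    by move=> [/andP[_ ->] /andP[-> _]].
  move=> /andP[ay yt]; move: tab; rewrite in_itv /= => /andP[at_ tb].
  by rewrite ay yt (ltW ay) (le_lt_trans yt tb).
by rewrite -Rintegral_itv_bndo_bndc //; exact: fiS.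
Qed.

Lemma cbounded_measurable_primitive (a b : R) (f : R -> C) : a < b ->
  cintegrable `]a, b[ f -> cbounded_measurable `]a, b[ (fun t => cintegral `]a, t[ f).
Proof. by move=> ab [f1 f2]; split; exact: bounded_measurable_primitive. Qed.

Lemma cbounded_measurableD D (f g : R -> C) :
  cbounded_measurable D f -> cbounded_measurable D g ->
  cbounded_measurable D (fun x => f x + g x).
Proof.
move=> [f1 f2] [g1 g2]; split.
  by under [X in bounded_measurable _ X]eq_fun do rewrite ReD; exact: bounded_measurableD.
by under [X in bounded_measurable _ X]eq_fun do rewrite ImD; exact: bounded_measurableD.
Qed.

Lemma bounded_measurable_step D (al c : R) :
  bounded_measurable D (fun x => if al <= x then c else 0).
Proof.
split; last by exists `|c| => x _; case: ifP => _; rewrite ?normr0.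
have -> : (fun x => if al <= x then c else 0) = (fun x => \1_(`[al, +oo[) x * c).
  apply/funext => x; rewrite indicE mem_setE in_itv /= andbT.
  by case: ifP; rewrite ?mul1r ?mul0r.
apply: measurable_realfun.measurable_funM; last exact: measurable_cst.
exact: measurable_realfun.measurable_indic.
Qed.

Lemma cbounded_measurable_step D (al : R) (c : C) :
  cbounded_measurable D (fun x => if al <= x then c else 0).
Proof.
split.
  by under [X in bounded_measurable _ X]eq_fun do rewrite (fun_if (@complex.Re R));
    exact: bounded_measurable_step.
by under [X in bounded_measurable _ X]eq_fun do rewrite (fun_if (@complex.Im R));
    exact: bounded_measurable_step.
Qed.

Lemma cbounded_measurable_sum D I (s : seq I) (f : I -> R -> C) :
  (forall i, cbounded_measurable D (f i)) ->
  cbounded_measurable D (fun x => \sum_(i <- s) f i x).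
Proof.
move=> fi; elim: s => [|i s IH].
  by under eq_fun do rewrite big_nil; exact: cbounded_measurable_cst.
by under eq_fun do rewrite big_cons; exact: cbounded_measurableD.
Qed.

End IndefiniteIntegral.

Section MatrixIntegral.
Context {R : realType}.
Local Notation mu := (@lebesgue_measure R).
Local Notation C := R[i].

Definition mxbounded_measurable m n (D : set R) (F : R -> 'M[C]_(m, n)) : Prop :=
  forall i j, cbounded_measurable D (fun x => F x i j).

Lemma mxintegrable_mul m n p D (F : R -> 'M[C]_(m, n)) (w : R -> 'M[C]_(n, p)) :
  measurable D -> mxintegrable D F -> mxbounded_measurable D w ->
  mxintegrable D (fun x => F x *m w x).
Proof.
move=> mD Fi wb i j; under [X in cintegrable _ X]eq_fun do rewrite mxE.
by apply: cintegrable_sum => // k; exact: cintegrableM.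
Qed.

Lemma mxintegral_mulr m n p D (F : R -> 'M[C]_(m, n)) (c : 'M[C]_(n, p)) :
  measurable D -> mxintegrable D F ->
  mxintegral D (fun x => F x *m c) = mxintegral D F *m c.
Proof.
move=> mD Fi; apply/matrixP => i j; rewrite !mxE.
under [X in cintegral _ X]eq_fun do rewrite mxE.
rewrite cintegral_sum // => [|k]; last exact: cintegrableM (cbounded_measurable_cst _ _).
by apply: eq_bigr => k _; rewrite cintegralMr // mxE.
Qed.

Lemma mxintegrableS m n (D D' : set R) (F : R -> 'M[C]_(m, n)) :
  measurable D -> measurable D' -> D' `<=` D -> mxintegrable D F -> mxintegrable D' F.
Proof. by move=> mD mD' sD Fi i j; apply: cintegrableS (Fi i j). Qed.

Lemma mxintegral_split m n (r s t : R) (F : R -> 'M[C]_(m, n)) : r <= s -> s <= t ->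
  mxintegrable `]r, t[ F ->
  mxintegral `]r, t[ F = mxintegral `]r, s[ F + mxintegral `]s, t[ F.
Proof.
by move=> rs st Fi; apply/matrixP => i j; rewrite !mxE (cintegral_split rs st).
Qed.

Lemma mxintegral_ae_eq m n D (F G : R -> 'M[C]_(m, n)) : measurable D ->
  mxintegrable D F -> mxintegrable D G -> {ae mu, forall x, D x -> F x = G x} ->
  mxintegral D F = mxintegral D G.
Proof.
move=> mD Fi Gi FG; apply/matrixP => i j; rewrite !mxE /cintegral.
have [F1 F2] := Fi i j; have [G1 G2] := Gi i j.
congr (_ +i* _); apply: Rintegral_ae_eq => //.
  by apply: ae_imply FG => x FG Dx; rewrite FG.
by apply: ae_imply FG => x FG Dx; rewrite FG.
Qed.

Lemma mxintegral_eq m n D (F G : R -> 'M[C]_(m, n)) :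
  {in D, F =1 G} -> mxintegral D F = mxintegral D G.
Proof.
move=> FG; apply/matrixP => i j; rewrite !mxE /cintegral.
by congr (_ +i* _); apply: eq_Rintegral => x xD; rewrite FG.
Qed.

Lemma mxintegrable0 m n D : measurable D -> mxintegrable D (fun=> 0 : 'M[C]_(m, n)).
Proof.
by move=> mD i j; under [X in cintegrable _ X]eq_fun do rewrite mxE; exact: cintegrable0.
Qed.

Lemma mxintegral_ae0 m n D (F : R -> 'M[C]_(m, n)) : measurable D ->
  mxintegrable D F -> {ae mu, forall x, D x -> F x = 0} -> mxintegral D F = 0.
Proof.
move=> mD Fi F0; rewrite (mxintegral_ae_eq mD Fi (@mxintegrable0 m n _ mD) F0).
by apply/matrixP => i j; rewrite !mxE cintegral0.
Qed.

Lemma mxintegrable_pencil n D (Q W : R -> 'M[C]_n) (z : C) : measurable D ->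
  mxintegrable D Q -> mxintegrable D W ->
  mxintegrable D (fun x => Q x - z *: W x).
Proof.
move=> mD Qi Wi i j.
have -> : (fun x => (Q x - z *: W x) i j) = (fun x => Q x i j + W x i j * (- z)).
  by apply/funext => x; rewrite !mxE mulrN mulrC.
apply: cintegrableD => //.
exact: cintegrableM (cbounded_measurable_cst _ _).
Qed.

Lemma mxintegral_pencil n D (Q W : R -> 'M[C]_n) (z : C) : measurable D ->
  mxintegrable D Q -> mxintegrable D W ->
  mxintegral D (fun x => Q x - z *: W x) = mxintegral D Q - z *: mxintegral D W.
Proof.
move=> mD Qi Wi; apply/matrixP => i j; rewrite !mxE.
have -> : (fun x => (Q x - z *: W x) i j) = (fun x => Q x i j + W x i j * (- z)).
  by apply/funext => x; rewrite !mxE mulrN mulrC.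
rewrite cintegralD // ?cintegralMr // ?mulrN ?(mulrC z) //.
exact: cintegrableM (cbounded_measurable_cst _ _).
Qed.

Lemma mxintegral_cc m n (s t : R) (F : R -> 'M[C]_(m, n)) :
  mxintegrable `]s, t[ F -> mxintegral `[s, t] F = mxintegral `]s, t[ F.
Proof.
move=> Fi; apply/matrixP => i j; rewrite !mxE /cintegral.
have [/integrableP[F1 _] /integrableP[F2 _]] := Fi i j.
by congr (_ +i* _); congr fine; rewrite integral_itv_bndoo.
Qed.

End MatrixIntegral.

(** * Reduction of an Atkinson problem to a finite system *)

Section AtkinsonReduction.
Context {R : realType} {d : nat}.
Local Notation mu := (@lebesgue_measure R).
Local Notation C := R[i].
Variables (N : nat) (al be : nat -> R) (om : coefficients R d).
Hypotheses (part : is_partition N al be) (omO : Omega N al be om).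
Local Notation a := (al 0%N).
Local Notation b := (be N).

Let al_be i : (i <= N)%N -> al i < be i.
Proof. exact: part.1. Qed.

Let be_al j : (j < N)%N -> be j < al j.+1.
Proof. by move=> jN; apply: (part.2 j.+1). Qed.

Lemma partition_lt i j : (i < j <= N)%N -> be i < al j.
Proof.
elim: j => // j IH /andP[]; rewrite ltnS leq_eqVlt => /predU1P[->|ij] jN.
  exact: be_al.
apply: lt_trans (be_al jN); apply: lt_trans (al_be (ltnW jN)).
by apply: IH; rewrite ij ltnW.
Qed.

Lemma partition_al i : (i <= N)%N -> a <= al i.
Proof.
case: i => // i iN; apply: le_trans (ltW (partition_lt (i := 0) _)) => //.
by rewrite ltW // al_be.
Qed.

Lemma partition_be i : (i <= N)%N -> be i <= b.
Proof.
rewrite leq_eqVlt => /predU1P[->//|iN].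
by rewrite (le_trans (ltW (partition_lt (j := N) _))) ?iN ?leqnn // ltW // al_be.
Qed.

Lemma partition_cover t : a <= t <= b ->
  (exists2 i, (i <= N)%N & al i <= t <= be i) \/
  (exists2 j, (j < N)%N & be j <= t <= al j.+1).
Proof.
move=> /andP[at_]; suff H n : (n <= N)%N -> t <= be n ->
  (exists2 i, (i <= N)%N & al i <= t <= be i) \/
  (exists2 j, (j < N)%N & be j <= t <= al j.+1) by exact: H.
elim: n => [_ tb|n IH nN tb]; first by left; exists 0%N; rewrite ?at_.
have [tn|nt] := leP t (be n); first exact: IH (ltnW nN) tn.
have [ta|at2] := leP t (al n.+1); first by right; exists n => //; rewrite (ltW nt).
by left; exists n.+1 => //; rewrite (ltW at2).
Qed.

Lemma AC_incr m n (F G : R -> 'M[C]_(m, n)) s t : AC_with_derivative a b F G ->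
  a <= s -> s <= t -> t <= b -> F t = F s + mxintegral `]s, t[ G.
Proof.
move=> [Gi FG] as_ st tb.
rewrite (FG t) ?in_itv /= ?tb ?(le_trans as_ st) // (FG s) ?in_itv /= ?as_ ?(le_trans st tb) //.
rewrite -addrA -mxintegral_split //.
by apply: mxintegrableS Gi => //; apply: subset_itvl; rewrite bnd_simp.
Qed.

Lemma AC_constant m n (F G : R -> 'M[C]_(m, n)) s t : AC_with_derivative a b F G ->
  a <= s -> s <= t -> t <= b -> {ae mu, forall x, s <= x <= t -> G x = 0} -> F t = F s.
Proof.
move=> FG as_ st tb G0; rewrite (AC_incr FG as_ st tb) mxintegral_ae0 ?addr0 //.
  apply: mxintegrableS (FG.1) => //.
  by apply: subset_itv; rewrite bnd_simp.
apply: ae_imply G0 => x + xst; apply; move: xst => /=.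
by rewrite in_itv /= => /andP[/ltW -> /ltW ->].
Qed.

Lemma AC_linear m n (F : R -> 'cV[C]_m) (M : R -> 'M[C]_(m, n)) (w : R -> 'cV[C]_n)
    (c : 'cV[C]_n) s t : mxintegrable `]a, b[ M ->
  AC_with_derivative a b F (fun x => M x *m w x) ->
  a <= s -> s <= t -> t <= b -> (forall x, s < x < t -> w x = c) ->
  F t = F s + mxintegral `]s, t[ M *m c.
Proof.
move=> Mi FG as_ st tb wc; rewrite (AC_incr FG as_ st tb); congr (_ + _).
rewrite -mxintegral_mulr //.
  by apply: mxintegral_eq => x; rewrite inE /= in_itv /= => /wc ->.
by apply: mxintegrableS Mi => //; apply: subset_itv; rewrite bnd_simp.
Qed.

Let P := Pinv om.
Let Q z x := Qcoef om x - z *: Wcoef om x.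

Let Pi : mxintegrable `]a, b[ P.
Proof. by have [[[]]] := omO. Qed.

Let Qi : mxintegrable `]a, b[ (Qcoef om).
Proof. by have [[_ []]] := omO. Qed.

Let Wi : mxintegrable `]a, b[ (Wcoef om).
Proof. by have [[_ _ []]] := omO. Qed.

Let QWi z : mxintegrable `]a, b[ (Q z).
Proof. exact: mxintegrable_pencil. Qed.

Let P0 i : (i <= N)%N -> {ae mu, forall x, al i <= x <= be i -> P x = 0}.
Proof.
by move=> iN; have [_ /(_ i iN)[+ _] _] := omO; apply: ae_imply => x; rewrite in_itv.
Qed.

Let Q0 z j : (j < N)%N -> {ae mu, forall x, be j <= x <= al j.+1 -> Q z x = 0}.
Proof.
move=> jN; have [_ _ /(_ j.+1 jN)[h1 h2 _]] := omO.
have := ae_and h1 h2; apply: ae_imply => x; rewrite in_itv /= => -[+ +] xj.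
by rewrite /Q => -> // -> //; rewrite scaler0 subr0.
Qed.

(** These three integrals are all that the finite system below retains of the
    coefficients. *)
Definition Pint j := mxintegral `[be j, al j.+1] (Pinv om).
Definition Qint i := mxintegral `[al i, be i] (Qcoef om).
Definition Wint i := mxintegral `[al i, be i] (Wcoef om).

Let PintE j : (j < N)%N -> Pint j = mxintegral `]be j, al j.+1[ P.
Proof.
move=> jN; apply: mxintegral_cc; apply: mxintegrableS Pi => //.
apply: subset_itv; rewrite bnd_simp.
  by rewrite (le_trans (partition_al (ltnW jN))) // ltW // al_be // ltnW.
by rewrite (le_trans (ltW (al_be jN))) // partition_be.
Qed.

Let sub_ab i : (i <= N)%N -> `]al i, be i[ `<=` `]a, b[.
Proof.
by move=> iN; apply: subset_itv; rewrite bnd_simp ?partition_al ?partition_be.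
Qed.

Let QintE z i : (i <= N)%N -> Qint i - z *: Wint i = mxintegral `]al i, be i[ (Q z).
Proof.
move=> iN; have sub := sub_ab iN.
have Qi' : mxintegrable `]al i, be i[ (Qcoef om) by apply: mxintegrableS Qi.
have Wi' : mxintegrable `]al i, be i[ (Wcoef om) by apply: mxintegrableS Wi.
rewrite /Qint /Wint (mxintegral_cc Qi') (mxintegral_cc Wi').
by rewrite (mxintegral_pencil z _ Qi' Wi').
Qed.

(** The finite system to which an equation of Atkinson type reduces: [u i] is the
    constant value of [u] on [al i, be i], [v 0] the value of [v] at the left end,
    and [v i.+1] its constant value on [be i, al i.+1] (its value at the right end
    when [i = N]). *)
Definition atkinson_system z (u v : nat -> 'cV[C]_d) : Prop :=
  (forall i, (i <= N)%N -> v i.+1 = v i + (Qint i - z *: Wint i) *m u i) /\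
  (forall j, (j < N)%N -> u j.+1 = u j + Pint j *m v j.+1).

Definition sample_u (u : R -> 'cV[C]_d) i := u (al i).
Definition sample_v (v : R -> 'cV[C]_d) i := if i is j.+1 then v (be j) else v a.

(** On [[al i, be i]] the function [u] is constant, since [P^-1] vanishes, and [v]
    is then the integral of a known function; on [[be j, al j.+1]] the roles of [u]
    and [v] are exchanged.  In particular the solution is determined, linearly, by
    its samples. *)
Lemma solution_profile z u v : SL_solution a b om z u v ->
  [/\ atkinson_system z (sample_u u) (sample_v v),
      forall i t, (i <= N)%N -> al i <= t <= be i ->
        u t = sample_u u i /\
        v t = sample_v v i + mxintegral `]al i, t[ (Q z) *m sample_u u i &
      forall j t, (j < N)%N -> be j <= t <= al j.+1 ->
        v t = sample_v v j.+1 /\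
        u t = sample_u u j + mxintegral `]be j, t[ P *m sample_v v j.+1].
Proof.
move=> [ACu ACv].
have uW i t : (i <= N)%N -> al i <= t <= be i -> u t = u (al i).
  move=> iN /andP[it ti]; apply: (AC_constant ACu) => //.
  - exact: partition_al.
  - exact: le_trans ti (partition_be iN).
  apply: ae_imply (P0 iN) => x + /andP[ix xt]; rewrite ix (le_trans xt ti) => /(_ isT) Px.
  by rewrite -[Pinv om x]/(P x) Px mul0mx.
have vW i t : (i <= N)%N -> al i <= t <= be i ->
    v t = v (al i) + mxintegral `]al i, t[ (Q z) *m u (al i).
  move=> iN /andP[it ti]; apply: (AC_linear (QWi z) ACv) => //.
  - exact: partition_al.
  - exact: le_trans ti (partition_be iN).
  by move=> x /andP[ix xt]; apply: uW; rewrite // (ltW ix) (le_trans (ltW xt)).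
have be_le j : (j < N)%N -> a <= be j.
  by move=> jN; rewrite (le_trans (partition_al (ltnW jN))) // ltW // al_be // ltnW.
have al_le j : (j < N)%N -> al j.+1 <= b.
  by move=> jN; rewrite (le_trans (ltW (al_be jN))) // partition_be.
have vP j t : (j < N)%N -> be j <= t <= al j.+1 -> v t = v (be j).
  move=> jN /andP[jt tj]; apply: (AC_constant ACv) => //; first exact: be_le.
    exact: le_trans tj (al_le _ jN).
  apply: ae_imply (Q0 z jN) => x + /andP[ix xt]; rewrite ix (le_trans xt tj) => /(_ isT) Qx.
  by rewrite -[X in X *m _]/(Q z x) Qx mul0mx.
have uP j t : (j < N)%N -> be j <= t <= al j.+1 ->
    u t = u (be j) + mxintegral `]be j, t[ P *m v (be j).
  move=> jN /andP[jt tj]; apply: (AC_linear Pi ACu) => //; first exact: be_le.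
    exact: le_trans tj (al_le _ jN).
  by move=> x /andP[jx xt]; apply: vP; rewrite // (ltW jx) (le_trans (ltW xt)).
have v_al i : (i <= N)%N -> v (al i) = sample_v v i.
  by case: i => // j jN; rewrite (vP j) // lexx (ltW (be_al jN)).
have u_be i : (i <= N)%N -> u (be i) = u (al i).
  by move=> iN; apply: uW; rewrite // lexx ltW // al_be.
split.
- split=> [i iN|j jN].
    by rewrite /= (vW i) // ?v_al // ?QintE // lexx ltW // al_be.
  rewrite PintE // /sample_u (uP j) ?u_be //; first exact: ltnW.
  by rewrite lexx ltW // be_al.
- by move=> i t iN ti; rewrite -v_al //; split; [exact: uW|exact: vW].
- move=> j t jN tj; split; first exact: vP.
  by rewrite /sample_u -u_be ?(ltnW jN) //; exact: uP.
Qed.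

(** The function equal to [f i] on [[al i, al i.+1[], as a sum of jumps, which
    makes its measurability a matter of finite sums. *)
Definition step (f : nat -> 'cV[C]_d) (x : R) : 'cV[C]_d :=
  f 0%N + \sum_(j < N) (if al j.+1 <= x then f j.+1 - f j else 0).

Let al_le i j : (i <= j <= N)%N -> al i <= al j.
Proof.
move=> /andP[]; rewrite leq_eqVlt => /predU1P[->//|ij] jN.
apply: le_trans (ltW (partition_lt (i := i) _)); last by rewrite ij.
by rewrite ltW // al_be // (leq_trans (ltnW ij)).
Qed.

Lemma stepE f i x : (i <= N)%N -> al i <= x -> ((i < N)%N -> x < al i.+1) ->
  step f x = f i.
Proof.
move=> iN ix xi; rewrite /step.
have -> : \sum_(j < N) (if al j.+1 <= x then f j.+1 - f j else 0) =
    \sum_(j < N | (j < i)%N) (f j.+1 - f j).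
  rewrite [RHS]big_mkcond; apply: eq_bigr => j _; congr (if _ then _ else _).
  have [ji|ij] := ltnP j i; first by rewrite (le_trans _ ix) // al_le // ji.
  apply/negbTE; rewrite -ltNge; apply: lt_le_trans (xi _) _.
    exact: leq_ltn_trans ij (ltn_ord j).
  by apply: al_le; rewrite ltnS ij /=.
rewrite -(big_ord_widen N (fun j => f j.+1 - f j) iN) -(big_mkord xpredT (fun j => f j.+1 - f j)).
by rewrite telescope_sumr // addrC subrK.
Qed.

Let step_bounded f : mxbounded_measurable `]a, b[ (step f).
Proof.
move=> i j; rewrite /step.
have -> : (fun x => (f 0%N + \sum_(j < N) (if al j.+1 <= x then f j.+1 - f j else 0)) i j) =
  (fun x => f 0%N i j +
     \sum_(k < N) (if al k.+1 <= x then (f k.+1 - f k) i j else 0)).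
  apply/funext => x; rewrite mxE summxE; congr (_ + _); apply: eq_bigr => k _.
  by case: ifP => // _; rewrite mxE.
apply: cbounded_measurableD; first exact: cbounded_measurable_cst.
by apply: cbounded_measurable_sum => k; exact: cbounded_measurable_step.
Qed.

(** Integrating [P^-1] against the step function of [v] and [Q - z W] against that
    of [u] gives functions with the right samples.  Each of them agrees with its
    step function wherever the coefficient that multiplies it does not vanish, so
    they solve the equation. *)
Lemma solution_exists z (u v : nat -> 'cV[C]_d) : atkinson_system z u v ->
  exists us vs, [/\ SL_solution a b om z us vs,
    forall i, (i <= N)%N -> sample_u us i = u i &
    forall i, (i <= N.+1)%N -> sample_v vs i = v i].
Proof.
move=> [sysv sysu].
have ab : a < b by apply: le_lt_trans (partition_al (leqnn N)) (al_be (leqnn N)).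
pose Fu x := P x *m step (fun i => v i.+1) x.
pose Fv x := Q z x *m step u x.
have Fui : mxintegrable `]a, b[ Fu by exact: mxintegrable_mul.
have Fvi : mxintegrable `]a, b[ Fv by exact: mxintegrable_mul.
have I0 (F : R -> 'cV[C]_d) : mxintegral `]a, a[ F = 0.
  by rewrite set_itv_ge ?bnd_simp ?ltxx //; apply/matrixP => i j;
     rewrite !mxE /cintegral !Rintegral_set0.
pose us t := u 0%N + mxintegral `]a, t[ Fu.
pose vs t := v 0%N + mxintegral `]a, t[ Fv.
have ACu : AC_with_derivative a b us Fu by split=> // t _; rewrite /us I0 addr0.
have ACv : AC_with_derivative a b vs Fv by split=> // t _; rewrite /vs I0 addr0.
have be_ge j : (j < N)%N -> a <= be j.
  by move=> jN; rewrite (le_trans (partition_al (ltnW jN))) // ltW // al_be // ltnW.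
have al_leb j : (j < N)%N -> al j.+1 <= b.
  by move=> jN; rewrite (le_trans (ltW (al_be jN))) // partition_be.
have stepW f i x : (i <= N)%N -> al i <= x <= be i -> step f x = f i.
  move=> iN /andP[ix xi]; apply: stepE => // iN'.
  exact: le_lt_trans xi (be_al iN').
have stepP f j x : (j < N)%N -> be j < x < al j.+1 -> step f x = f j.
  move=> jN /andP[jx xj]; apply: stepE => //; first exact: ltnW.
  by rewrite (le_trans _ (ltW jx)) // ltW // al_be // ltnW.
have usW i t : (i <= N)%N -> al i <= t <= be i -> us t = us (al i).
  move=> iN /andP[it ti]; apply: (AC_constant ACu) => //.
  - exact: partition_al.
  - exact: le_trans ti (partition_be iN).
  apply: ae_imply (P0 iN) => x + /andP[ix xt]; rewrite ix (le_trans xt ti) => /(_ isT) Px.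
  by rewrite /Fu Px mul0mx.
have vsW i : (i <= N)%N -> vs (be i) = vs (al i) + (Qint i - z *: Wint i) *m u i.
  move=> iN; rewrite QintE //; apply: (AC_linear (QWi z) ACv) => //.
  - exact: partition_al.
  - exact/ltW/al_be.
  - exact: partition_be.
  by move=> x /andP[ix xi]; apply: stepW; rewrite // !ltW.
have vsP j t : (j < N)%N -> be j <= t <= al j.+1 -> vs t = vs (be j).
  move=> jN /andP[jt tj]; apply: (AC_constant ACv) => //; first exact: be_ge.
    exact: le_trans tj (al_leb _ jN).
  apply: ae_imply (Q0 z jN) => x + /andP[ix xt]; rewrite ix (le_trans xt tj) => /(_ isT) Qx.
  by rewrite /Fv Qx mul0mx.
have usP j : (j < N)%N -> us (al j.+1) = us (be j) + Pint j *m v j.+1.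
  move=> jN; rewrite PintE //; apply: (AC_linear Pi ACu) => //; first exact: be_ge.
  - exact/ltW/be_al.
  - exact: al_leb.
  by move=> x jx; apply: (stepP (fun i => v i.+1)).
have main i : (i <= N)%N -> us (al i) = u i /\ vs (al i) = v i.
  elim: i => [_|i IH iN]; first by rewrite /us /vs !I0 !addr0.
  have [ui vi] := IH (ltnW iN).
  have vbe : vs (be i) = v i.+1 by rewrite vsW ?vi ?sysv ?(ltnW iN).
  rewrite (vsP i) ?vbe ?lexx ?(ltW (be_al iN)) //; split=> //.
  by rewrite usP // sysu // (usW i) ?ui ?lexx ?(ltW (al_be _)) // ltnW.
have vbe i : (i <= N)%N -> vs (be i) = v i.+1.
  by move=> iN; rewrite vsW // (main i iN).2 sysv.
have vs_bounded : mxbounded_measurable `]a, b[ vs.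
  move=> i j; rewrite /vs; under [X in cbounded_measurable _ X]eq_fun do rewrite !mxE.
  apply: cbounded_measurableD; first exact: cbounded_measurable_cst.
  exact: cbounded_measurable_primitive.
have us_bounded : mxbounded_measurable `]a, b[ us.
  move=> i j; rewrite /us; under [X in cbounded_measurable _ X]eq_fun do rewrite !mxE.
  apply: cbounded_measurableD; first exact: cbounded_measurable_cst.
  exact: cbounded_measurable_primitive.
have ae0 : {ae mu, forall x,
    (forall i, (i < N.+1)%N -> al i <= x <= be i -> P x = 0) /\
    (forall j, (j < N)%N -> be j <= x <= al j.+1 -> Q z x = 0)}.
  apply: ae_and; apply: ae_below => i iN; first exact: P0.
  exact: Q0.
have aeu : {ae mu, forall x, x \in `]a, b[ -> Fu x = P x *m vs x}.
  apply: ae_imply ae0 => x [Px Qx]; rewrite in_itv /= => /andP[ax xb].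
  have [|[i iN xi]|[j jN xj]] := @partition_cover x; first by rewrite !ltW.
    by rewrite /Fu (Px i iN xi) !mul0mx.
  move: xj => /andP[jx]; rewrite le_eqVlt => /predU1P[ex|xj].
    have P_x : P x = 0 by apply: (Px j.+1) => //; rewrite ex lexx ltW // al_be.
    by rewrite /Fu P_x !mul0mx.
  move: jx; rewrite le_eqVlt => /predU1P[ex|jx].
    have P_x : P x = 0 by apply: (Px j); rewrite ?ltnS ?(ltnW jN) // -ex lexx ltW ?al_be // ltnW.
    by rewrite /Fu P_x !mul0mx.
  rewrite /Fu (stepP _ j) ?jx // (vsP j) ?vbe ?(ltnW jN) //.
  by rewrite !ltW.
have aev : {ae mu, forall x, x \in `]a, b[ -> Fv x = Q z x *m us x}.
  apply: ae_imply ae0 => x [Px Qx]; rewrite in_itv /= => /andP[ax xb].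
  have [|[i iN xi]|[j jN xj]] := @partition_cover x; first by rewrite !ltW.
    by rewrite /Fv (stepW _ i) // (usW i) // (main i iN).1.
  by rewrite /Fv (Qx j jN xj) !mul0mx.
have Pvi : mxintegrable `]a, b[ (fun x => P x *m vs x) by exact: mxintegrable_mul.
have Qui : mxintegrable `]a, b[ (fun x => Q z x *m us x) by exact: mxintegrable_mul.
exists us, vs; split.
- have Iu t : a <= t <= b ->
      mxintegral `]a, t[ Fu = mxintegral `]a, t[ (fun x => P x *m vs x).
    move=> /andP[at_ tb].
    have sub : `]a, t[ `<=` `]a, b[ by apply: subset_itv; rewrite bnd_simp.
    apply: mxintegral_ae_eq; first by [].
    - exact: (mxintegrableS (measurable_itv _) (measurable_itv _) sub Fui).
    - exact: (mxintegrableS (measurable_itv _) (measurable_itv _) sub Pvi).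
    by apply: ae_imply aeu => x + /sub; exact.
  have Iv t : a <= t <= b ->
      mxintegral `]a, t[ Fv = mxintegral `]a, t[ (fun x => Q z x *m us x).
    move=> /andP[at_ tb].
    have sub : `]a, t[ `<=` `]a, b[ by apply: subset_itv; rewrite bnd_simp.
    apply: mxintegral_ae_eq; first by [].
    - exact: (mxintegrableS (measurable_itv _) (measurable_itv _) sub Fvi).
    - exact: (mxintegrableS (measurable_itv _) (measurable_itv _) sub Qui).
    by apply: ae_imply aev => x + /sub; exact.
  split; split; [exact: Pvi| |exact: Qui|] => t tab.
    by rewrite (ACu.2 t tab) Iu //; move: tab; rewrite in_itv.
  by rewrite (ACv.2 t tab) Iv //; move: tab; rewrite in_itv.
- by move=> i /main[].
- by case=> [_|i iN]; [exact: (main 0%N _).2|exact: vbe].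
Qed.

End AtkinsonReduction.

(** * The finite system as a Hermitian matrix problem *)

Lemma regroup (V : zmodType) (x1 x2 x3 x4 x5 x6 : V) :
  x1 + (x2 - x3) - x4 - (x5 + x6) = x1 - x4 + (x2 - x5) - (x3 + x6).
Proof. by rewrite !opprD !addrA [LHS](ACl (1*4*2*5*3*6)). Qed.

Section Selectors.
Context {C : numClosedFieldType} (d N : nat).
Local Notation m := (N.+1 * d)%N.

(** The [i]-th block of [d] coordinates, for [i <= N].  The index is a bare natural
    number so that [i] and [i.+1] can be compared without casts. *)
Definition sel (i : nat) : 'M[C]_(d, m) := \matrix_(k, l) ((l : nat) == i * d + k)%:R.

Lemma sel_lt i (k : 'I_d) : (i <= N)%N -> (i * d + k < N.+1 * d)%N.
Proof.
move=> iN; apply: (@leq_trans (i * d + d)); first by rewrite ltn_add2l.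
by rewrite addnC -mulSn leq_mul2r ltnS iN orbT.
Qed.

Lemma sel_mulE p (U : 'M[C]_(m, p)) i (iN : (i <= N)%N) k j :
  (sel i *m U) k j = U (Ordinal (sel_lt k iN)) j.
Proof.
rewrite mxE (bigD1 (Ordinal (sel_lt k iN))) //= mxE eqxx mul1r big1 ?addr0 // => l.
by rewrite -val_eqE /= mxE => /negPf ->; rewrite mul0r.
Qed.

Lemma sel_ortho i j : (i <= N)%N -> (j <= N)%N ->
  sel i *m (sel j) ^t* = (i == j)%:R%:M.
Proof.
move=> iN jN; apply/matrixP => k l; rewrite sel_mulE !mxE /=.
have d0 : (0 < d)%N by apply: leq_trans (ltn_ord k).
have div (h : nat) (n : 'I_d) : h = ((h * d + n) %/ d)%N.
  by rewrite divnMDl // divn_small // addn0.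
have [<-|ij] := eqVneq i j.
  by rewrite eqn_add2l rmorph_nat mulr1n.
case: eqP => [e|_]; last by rewrite rmorph0 mul0rn.
by case/eqP: ij; rewrite (div i k) e -div.
Qed.

Lemma sel_ext p (U V : 'M[C]_(m, p)) :
  (forall i, (i <= N)%N -> sel i *m U = sel i *m V) -> U = V.
Proof.
move=> UV; apply/matrixP => l j.
have d0 : (0 < d)%N by have := leq_ltn_trans (leq0n l) (ltn_ord l); rewrite muln_gt0.
have lN : (l %/ d <= N)%N by rewrite -ltnS ltn_divLR.
have kd : (l %% d < d)%N by rewrite ltn_mod.
move/matrixP/(_ (Ordinal kd) j): (UV _ lN); rewrite !sel_mulE.
have -> // : Ordinal (sel_lt (Ordinal kd) lN) = l.
by apply: val_inj; rewrite /= -divn_eq.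
Qed.

Lemma sel_mk (u : nat -> 'cV[C]_d) i : (i <= N)%N ->
  sel i *m (\sum_(j < N.+1) (sel j) ^t* *m u j) = u i.
Proof.
move=> iN; rewrite mulmx_sumr (bigD1 (Ordinal (iN : (i < N.+1)%N))) //=.
rewrite mulmxA sel_ortho // eqxx mul1mx big1 ?addr0 // => j ji.
move: ji; rewrite -val_eqE /= eq_sym => /negPf ji.
by rewrite mulmxA sel_ortho // ?ji ?raddf0 ?mul0mx // -ltnS.
Qed.

End Selectors.

Section FiniteProblem.
Context {R : realType} (d N : nat).
Local Notation C := R[i].
Local Notation m := (N.+1 * d)%N.
Variables (P Q W : nat -> 'M[C]_d).
Hypothesis N_gt0 : (0 < N)%N.
Hypothesis P_unit : forall j, (j < N)%N -> P j \in unitmx.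
Hypothesis P_herm : forall j, (j < N)%N -> P j \is hermsymmx.
Hypothesis Q_herm : forall i, (i <= N)%N -> Q i \is hermsymmx.
Hypothesis W_herm : forall i, (i <= N)%N -> W i \is hermsymmx.
Hypothesis W_pos : forall i, (i <= N)%N -> posdefmx (W i).

Local Notation e := (@sel C d N).
Let diff j := e j.+1 - e j.

(** Solving the recurrence of [u] for [v], as [v j.+1 = (P j)^-1 (u j.+1 - u j)],
    leaves a second-order difference equation in [u], whose Hermitian form is
    [sum_i u_i^* Q_i u_i + sum_j (u_(j+1) - u_j)^* P_j^-1 (u_(j+1) - u_j)]. *)
Definition Hmx : 'M[C]_m :=
  \sum_(i < N.+1) (e i) ^t* *m Q i *m e i +
  \sum_(j < N) (diff j) ^t* *m invmx (P j) *m diff j.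

Definition Wmx : 'M[C]_m := \sum_(i < N.+1) (e i) ^t* *m W i *m e i.

(** The boundary values [(- u(a), u(b))] as a function of the samples of [u]. *)
Definition Tmx : 'M[C]_(d + d, m) := col_mx (- e 0%N) (e N).

Let herm_sum n (I : finType) (F : I -> 'M[C]_n) :
  (forall i, F i \is hermsymmx) -> \sum_i F i \is hermsymmx.
Proof.
move=> hF; rewrite hermP; apply/eqP.
rewrite raddf_sum map_mx_sum /=; apply: eq_bigr => i _.
exact: hermE.
Qed.

Let herm_add n (A B : 'M[C]_n) :
  A \is hermsymmx -> B \is hermsymmx -> A + B \is hermsymmx.
Proof. by move=> hA hB; rewrite hermP ctrD !hermE. Qed.

Lemma herm_Wmx : Wmx \is hermsymmx.
Proof. by apply: herm_sum => i; apply/herm_congr/W_herm; rewrite -ltnS. Qed.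

Lemma herm_inv n (A : 'M[C]_n) : A \is hermsymmx -> invmx A \is hermsymmx.
Proof. by move=> hA; rewrite hermP trmx_inv map_invmx hermE. Qed.

Lemma herm_Hmx : Hmx \is hermsymmx.
Proof.
apply: herm_add; apply: herm_sum => i; apply: herm_congr.
  by apply: Q_herm; rewrite -ltnS.
exact/herm_inv/P_herm.
Qed.

Lemma posdef_Wmx : posdefmx Wmx.
Proof.
move=> x x0.
have -> : (x ^t* *m Wmx *m x) 0 0 =
    \sum_(i < N.+1) ((e i *m x) ^t* *m W i *m (e i *m x)) 0 0.
  rewrite mulmx_sumr mulmx_suml summxE; apply: eq_bigr => i _.
  by rewrite ctrM !mulmxA.
have W_ge0 (i : 'I_N.+1) : 0 <= ((e i *m x) ^t* *m W i *m (e i *m x)) 0 0.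
  have [->|nz] := eqVneq (e i *m x) 0; first by rewrite mulmx0 mxE.
  by apply/ltW/W_pos; rewrite // -ltnS.
rewrite lt_def sumr_ge0 ?andbT //; apply: contra x0 => /eqP s0.
apply/eqP/(@sel_ext C d N) => i iN; rewrite mulmx0; apply/eqP; apply/negPn/negP => nz.
have /(_ (Ordinal (iN : (i < N.+1)%N)) isT) := psumr_eq0P (fun i _ => W_ge0 i) s0.
by move=> z; have := W_pos iN nz; rewrite z ltxx.
Qed.

Lemma Tmx_ortho : Tmx *m Tmx ^t* = 1%:M.
Proof.
have N0 : (N == 0%N) = false by rewrite eqn0Ngt N_gt0.
rewrite /Tmx ctr_col ctrN mul_col_row !(mulmxN, mulNmx) !sel_ortho //.
by rewrite !eqxx (eq_sym 0%N) N0 raddf0 oppr0 opprK -scalar_mx_block.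
Qed.

(** The samples of [v]: the interior ones follow from those of [u], and the two
    at the ends are the boundary values [V]. *)
Definition vseq (U : 'cV[C]_m) (V : 'cV[C]_(d + d)) (i : nat) : 'cV[C]_d :=
  if i is j.+1 then
    if (j < N)%N then invmx (P j) *m (e j.+1 *m U - e j *m U) else dsubmx V
  else usubmx V.

(** Block by block, [(H - z W) U = T^* V] is the recurrence of [v]: the difference
    operator contributes the interior values of [v], and [T^* V] those at the two
    ends. *)
Lemma sel_residual z (U : 'cV[C]_m) (V : 'cV[C]_(d + d)) i : (i <= N)%N ->
  e i *m ((Hmx - z *: Wmx) *m U - Tmx ^t* *m V) =
  (Q i - z *: W i) *m (e i *m U) + vseq U V i - vseq U V i.+1.
Proof.
move=> iN; pose oi := Ordinal (iN : (i < N.+1)%N).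
have diag (F : nat -> 'M[C]_d) :
    e i *m (\sum_(k < N.+1) (e k) ^t* *m F k *m e k) *m U = F i *m (e i *m U).
  rewrite mulmx_sumr mulmx_suml (bigD1 oi) //= big1 => [|k ki].
    by rewrite !mulmxA sel_ortho // eqxx mul1mx addr0.
  have kN : (k <= N)%N by rewrite -ltnS.
  move: ki; rewrite -val_eqE /= eq_sym => /negPf ki.
  by rewrite !mulmxA sel_ortho // ki raddf0 !mul0mx.
have hop : e i *m (\sum_(j < N) (diff j) ^t* *m invmx (P j) *m diff j) *m U =
    (if (0 < i)%N then vseq U V i else 0) - (if (i < N)%N then vseq U V i.+1 else 0).
  have term (j : 'I_N) : e i *m ((diff j) ^t* *m invmx (P j) *m diff j) *m U =
      (i == j.+1)%:R *: vseq U V j.+1 - (i == j)%:R *: vseq U V j.+1.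
    have ew : invmx (P j) *m (diff j *m U) = vseq U V j.+1.
      by rewrite /= ltn_ord mulmxBl.
    rewrite -!mulmxA ew mulmxA /diff ctrB mulmxBr !sel_ortho ?(ltnW (ltn_ord j)) //.
    by rewrite mulmxBl !mul_scalar_mx.
  rewrite mulmx_sumr mulmx_suml (eq_bigr _ (fun j _ => term j)) sumrB; congr (_ - _).
    case: i iN {oi diag term} => [|i] iN.
      by rewrite big1 // => j _; rewrite scale0r.
    rewrite (bigD1 (Ordinal iN)) //= eqxx scale1r big1 ?addr0 // => j.
    by rewrite -val_eqE /= eqSS eq_sym => /negPf ->; rewrite scale0r.
  case: ltnP => [iN'|Ni].
    rewrite (bigD1 (Ordinal iN')) //= eqxx scale1r big1 ?addr0 // => j.
    by rewrite -val_eqE /= eq_sym => /negPf ->; rewrite scale0r.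
  rewrite big1 // => j _; rewrite gtn_eqF ?scale0r //.
  exact: leq_trans (ltn_ord j) Ni.
have bd : e i *m (Tmx ^t* *m V) =
    (if (0 < i)%N then 0 else - vseq U V 0) + (if (i < N)%N then 0 else vseq U V N.+1).
  rewrite /Tmx ctr_col -{1}[V]vsubmxK mul_row_col mulmxDr !mulmxA ctrN mulmxN mulNmx.
  rewrite !sel_ortho //= ltnn; congr (_ + _).
    by case: (i) => [|j] /=; rewrite ?mul1mx // raddf0 mul0mx oppr0.
  have [->|ni] := eqVneq i N; first by rewrite ltnn mul1mx.
  by rewrite raddf0 mul0mx ltn_neqAle ni iN.
have eH : e i *m (Hmx *m U) = Q i *m (e i *m U) +
    ((if (0 < i)%N then vseq U V i else 0) - (if (i < N)%N then vseq U V i.+1 else 0)).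
  by rewrite mulmxA /Hmx mulmxDr mulmxDl (diag Q) hop.
have eW : e i *m (Wmx *m U) = W i *m (e i *m U) by rewrite mulmxA (diag W).
rewrite mulmxBr bd mulmxBl mulmxBr eH -scalemxAl -scalemxAr eW mulmxBl -scalemxAl.
set q := Q i *m _; set w := z *: _.
rewrite regroup.
congr (_ + _ - _).
  by case: (i) => [|j] /=; rewrite ?sub0r ?opprK ?subr0.
have [iN'|Ni] := ltnP i N; first by rewrite addr0.
have {Ni} -> : i = N by apply/eqP; rewrite eqn_leq iN.
by rewrite add0r.
Qed.

End FiniteProblem.

(** * The pencil of a boundary condition in a chart *)

Section ChartProjection.
Context {R : realType} {d : nat}.
Local Notation C := R[i].
Variable K : {set 'I_(d + d)}.
Local Notation n := (d + d)%N.
Local Notation E0 := (E0hat K : 'M[C]_(n, #|K|)).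

Lemma E0hat_ortho : E0 ^t* *m E0 = 1%:M.
Proof.
apply/matrixP => i j; rewrite !mxE (bigD1 (enum_val i)) //= !mxE eqxx.
rewrite big1 => [|l /negPf li]; last by rewrite !mxE li rmorph0 mul0r.
by rewrite rmorph1 mul1r addr0 (inj_eq enum_val_inj).
Qed.

(** The projection onto the coordinates outside [K]. *)
Definition Kproj : 'M[C]_n := 1%:M - E0 *m E0 ^t*.

Lemma Kproj_diag : Kproj = diag_mx (\row_i (i \notin K)%:R).
Proof.
apply/matrixP => i j; rewrite /Kproj !mxE.
have [iK|iK] := boolP (i \in K).
  rewrite (bigD1 (enum_rank_in iK i)) //= !mxE enum_rankK_in // eqxx mul1r.
  rewrite big1 => [|l li].
    by rewrite rmorph_nat addr0 eq_sym subrr mul0rn.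
  rewrite !mxE; case: eqP => [e|_]; last by rewrite mul0r.
  by case/eqP: li; apply: enum_val_inj; rewrite enum_rankK_in // -e.
rewrite big1 ?subr0 // => l _; rewrite !mxE.
case: eqP => [e|_]; last by rewrite mul0r.
by case/negP: iK; rewrite e enum_valP.
Qed.

Lemma Kproj_block : Kproj = block_mx (E1 K) 0 0 (E2 K).
Proof.
rewrite Kproj_diag /E1 /E2 -diag_mx_row; congr diag_mx; apply/rowP => i.
by case: (split_ordP i) => j ->; rewrite ?row_mxEl ?row_mxEr !mxE.
Qed.

Lemma EK_block : EK K = block_mx Kproj (1%:M - Kproj) (Kproj - 1%:M) Kproj :> 'M[C]_(n + n).
Proof.
by rewrite /EK Kproj_block (@scalar_mx_block _ d d) !opp_block_mx !add_block_mx !oppr0 !addr0.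
Qed.

Lemma Kproj_herm : Kproj ^t* = Kproj.
Proof. by rewrite /Kproj ctrB ctr1 ctrM trmxCK. Qed.

Lemma KprojE0 : Kproj *m E0 = 0.
Proof. by rewrite /Kproj mulmxBl mul1mx -mulmxA E0hat_ortho mulmx1 subrr. Qed.

Lemma E0Kproj : E0 ^t* *m Kproj = 0.
Proof. by rewrite -[Kproj]Kproj_herm -ctrM KprojE0 ctr0. Qed.

Lemma Kproj_idem : Kproj *m Kproj = Kproj.
Proof. by rewrite {1}/Kproj mulmxBl mul1mx -mulmxA E0Kproj mulmx0 subr0. Qed.

Lemma KprojC : 1%:M - Kproj = E0 *m E0 ^t*.
Proof. by rewrite /Kproj opprB addrC subrK. Qed.

End ChartProjection.

Lemma swap_bc_alg (F : fieldType) n p (S A B : 'M[F]_n) (X V : 'M[F]_(n, p)) :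
  (S *m A - B) *m X + (S *m B + A) *m V =
  S *m (A *m X + B *m V) + (A *m V - B *m X).
Proof.
rewrite mulmxBl mulmxDl mulmxDr addrACA !mulmxA.
by congr (_ + _); rewrite addrC.
Qed.

Lemma pencil_top_alg (F : fieldType) m n k q (A B : 'M[F]_m) (T' : 'M[F]_(m, n))
    (P S : 'M[F]_n) (T : 'M[F]_(n, m)) (E : 'M[F]_(n, k)) (U : 'M[F]_(m, q)) (p : 'M[F]_(k, q)) :
  (A + T' *m P *m S *m P *m T - B) *m U + T' *m (P *m S - 1%:M) *m E *m p =
  (A - B) *m U - T' *m (E *m p - P *m S *m (P *m T *m U + E *m p)).
Proof.
rewrite addrAC mulmxDl -addrA; congr (_ + _).
rewrite -mulmxN opprB mulmxBr mulmx1 !mulmxBl mulmxBr !mulmxDr !mulmxA.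
by rewrite addrA.
Qed.

Lemma pencil_bottom_alg (F : fieldType) m n k q (E' : 'M[F]_(k, n))
    (P S : 'M[F]_n) (T : 'M[F]_(n, m)) (E : 'M[F]_(n, k)) (U : 'M[F]_(m, q)) (p : 'M[F]_(k, q)) :
  E' *m ((S *m P - 1%:M) *m T) *m U + E' *m S *m E *m p =
  E' *m S *m (P *m T *m U + E *m p) - E' *m T *m U.
Proof.
rewrite mulmxBl mulmxBr mulmxBl mul1mx mulmxDr !mulmxA addrAC.
by [].
Qed.

Section ChartPencil.
Context {R : realType} {d m : nat}.
Local Notation C := R[i].
Variables (K : {set 'I_(d + d)}) (H W : 'M[C]_m) (T : 'M[C]_(d + d, m)).
Hypotheses (hH : H \is hermsymmx) (hW : W \is hermsymmx) (pW : posdefmx W).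
Hypothesis TT : T *m T ^t* = 1%:M.
Local Notation n := (d + d)%N.
Local Notation E0 := (E0hat K : 'M[C]_(n, #|K|)).
Local Notation Pi := (Kproj K).

(** In the chart [K] the boundary condition is solved for the momenta outside [K]
    and for the positions in [K].  Substituting the former in [(H - z W) U = T^* V]
    leaves as unknowns [U] and the momenta [p] in [K], and the latter as the second
    row of a bordered Hermitian system, whose corner [chartB S] is the block of [S]
    on [K]. *)
Definition chartH (S : 'M[C]_n) : 'M[C]_m := H + T ^t* *m Pi *m S *m Pi *m T.
Definition chartG (S : 'M[C]_n) : 'M[C]_(m, #|K|) := T ^t* *m (Pi *m S - 1%:M) *m E0.
Definition chartB (S : 'M[C]_n) : 'M[C]_#|K| := E0 ^t* *m S *m E0.

Definition chart_pencil (S : 'M[C]_n) (z : C) : 'M[C]_(m + #|K|) :=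
  pencil (chartH S) W (chartG S) (chartB S) z.

Lemma chartH_herm S : S \is hermsymmx -> chartH S \is hermsymmx.
Proof.
move=> hS; rewrite hermP /chartH ctrD hermE //; apply/eqP; congr (_ + _).
by rewrite !ctrM trmxCK Kproj_herm hermE // !mulmxA.
Qed.

Lemma chartB_herm S : S \is hermsymmx -> chartB S \is hermsymmx.
Proof. exact: herm_congr. Qed.

Lemma chartG_rank S : \rank (chartG S) = #|K|.
Proof.
apply: col_free_rank => c; rewrite /chartG => e.
have : E0 ^t* *m T *m (T ^t* *m (Pi *m S - 1%:M) *m E0 *m c) = 0 by rewrite e mulmx0.
rewrite !mulmxA -(mulmxA _ T) TT mulmx1 mulmxBr !mulmxA E0Kproj mul0mx sub0r mulmx1.
by rewrite !mulNmx E0hat_ortho mul1mx => /eqP; rewrite oppr_eq0 => /eqP.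
Qed.

(** The boundary condition of the chart, read on the boundary data: after the
    swap of the coordinates in [K] by [EK], it is the graph of [-S]. *)
Lemma chart_bc (S : 'M[C]_n) p (X V : 'M[C]_(n, p)) :
  lsubmx (row_mx S 1%:M *m EK K) *m X + rsubmx (row_mx S 1%:M *m EK K) *m V =
  S *m (Pi *m X + E0 *m E0 ^t* *m V) + (Pi *m V - E0 *m E0 ^t* *m X).
Proof.
rewrite EK_block mul_row_block row_mxKl row_mxKr !mul1mx -KprojC.
rewrite -[Pi - 1%:M]opprB KprojC.
exact: swap_bc_alg.
Qed.

Lemma chart_pencil_kernel S z (U : 'cV[C]_m) (p : 'cV[C]_#|K|) :
  S \is hermsymmx ->
  chart_pencil S z *m col_mx U p = 0 <->
  let V := E0 *m p - Pi *m S *m (Pi *m T *m U + E0 *m p) in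
  (H - z *: W) *m U = T ^t* *m V /\
  E0 ^t* *m T *m U = E0 ^t* *m S *m (Pi *m T *m U + E0 *m p).
Proof.
move=> hS; rewrite /chart_pencil /pencil mul_block_col -(col_mx0 _ m #|K|) /=.
have -> : (chartH S - z *: W) *m U + chartG S *m p = (H - z *: W) *m U -
    T ^t* *m (E0 *m p - Pi *m S *m (Pi *m T *m U + E0 *m p)).
  exact: pencil_top_alg.
have -> : (chartG S) ^t* *m U + chartB S *m p =
    E0 ^t* *m S *m (Pi *m T *m U + E0 *m p) - E0 ^t* *m T *m U.
  rewrite /chartG /chartB !ctrM ctrB ctrM trmxCK ctr1 Kproj_herm hermE //.
  exact: pencil_bottom_alg.
split.
  move=> /eq_col_mx[/eqP e1 /eqP e2]; rewrite subr_eq0 in e1.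
  by rewrite subr_eq0 eq_sym in e2; split; apply/eqP.
by move=> [-> ->]; rewrite !subrr.
Qed.

Let M (S : 'M[C]_n) : 'M[C]_(n, n + n) := row_mx S 1%:M *m EK K.

(** All the boundary momenta, recovered from those in [K]. *)
Definition chartV (S : 'M[C]_n) (U : 'cV[C]_m) (p : 'cV[C]_#|K|) : 'cV[C]_n :=
  E0 *m p - Pi *m S *m (Pi *m T *m U + E0 *m p).

Lemma chart_kernel_solution S z (U : 'cV[C]_m) (p : 'cV[C]_#|K|) :
  S \is hermsymmx -> chart_pencil S z *m col_mx U p = 0 ->
  [/\ (H - z *: W) *m U = T ^t* *m chartV S U p, E0 ^t* *m chartV S U p = p &
      lsubmx (M S) *m (T *m U) + rsubmx (M S) *m chartV S U p = 0].
Proof.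
move=> hS /(chart_pencil_kernel _ _ _ hS)[e1 e2]; split=> //.
  by rewrite /chartV mulmxBr mulmxA E0hat_ortho mul1mx !mulmxA E0Kproj !mul0mx subr0.
have eE : E0 ^t* *m chartV S U p = p.
  by rewrite /chartV mulmxBr mulmxA E0hat_ortho mul1mx !mulmxA E0Kproj !mul0mx subr0.
set Y := Pi *m T *m U + E0 *m p in e2.
have eV : chartV S U p = E0 *m p - Pi *m (S *m Y) by rewrite (mulmxA Pi).
have eX : Pi *m (T *m U) + E0 *m E0 ^t* *m chartV S U p = Y.
  by rewrite -(mulmxA E0) eE (mulmxA Pi).
have eF : E0 *m E0 ^t* *m (T *m U) = E0 *m E0 ^t* *m (S *m Y).
  by move: (congr1 (mulmx E0) e2); rewrite !mulmxA.
have eP : Pi *m chartV S U p = - (Pi *m (S *m Y)).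
  by rewrite eV mulmxBr (mulmxA Pi E0) KprojE0 mul0mx sub0r (mulmxA Pi Pi) Kproj_idem.
have one : Pi + E0 *m E0 ^t* = 1%:M by rewrite -KprojC addrC subrK.
by rewrite chart_bc eX eF eP -opprD -mulmxDl one mul1mx subrr.
Qed.

Lemma chart_solution_kernel S z (U : 'cV[C]_m) (V : 'cV[C]_n) :
  S \is hermsymmx -> (H - z *: W) *m U = T ^t* *m V ->
  lsubmx (M S) *m (T *m U) + rsubmx (M S) *m V = 0 ->
  chart_pencil S z *m col_mx U (E0 ^t* *m V) = 0 /\ V = chartV S U (E0 ^t* *m V).
Proof.
move=> hS e1; rewrite chart_bc => e2.
set Y := Pi *m (T *m U) + E0 *m E0 ^t* *m V in e2.
have eY : Pi *m T *m U + E0 *m (E0 ^t* *m V) = Y by rewrite /Y !mulmxA.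
have PF q (X : 'M[C]_(n, q)) : Pi *m (E0 *m E0 ^t* *m X) = 0.
  by rewrite -(mulmxA E0) (mulmxA Pi E0) KprojE0 mul0mx.
have e3 : Pi *m V = - (Pi *m S *m Y).
  move: (congr1 (mulmx Pi) e2); rewrite mulmx0 mulmxDr mulmxBr PF subr0.
  rewrite (mulmxA Pi S) (mulmxA Pi Pi) Kproj_idem addrC => /eqP.
  by rewrite addr_eq0 => /eqP.
have e4 : E0 ^t* *m T *m U = E0 ^t* *m S *m Y.
  move: (congr1 (mulmx (E0 ^t*)) e2); rewrite mulmx0 mulmxDr mulmxBr.
  rewrite (mulmxA _ Pi) E0Kproj mul0mx sub0r -(mulmxA E0) (mulmxA _ E0) E0hat_ortho.
  by rewrite mul1mx (mulmxA _ S) !(mulmxA _ T) => /eqP; rewrite subr_eq0 => /eqP.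
have eV : V = chartV S U (E0 ^t* *m V).
  rewrite /chartV eY -e3 mulmxA -[LHS]mul1mx -(subrK Pi (1%:M : 'M[C]_n)) KprojC.
  by rewrite mulmxDl.
by split=> //; apply/chart_pencil_kernel => //=; rewrite -/(chartV S U _) -eV eY.
Qed.

End ChartPencil.

Section KernelFrame.
Context {F : fieldType}.

Lemma kernel_frame p n (D : 'M[F]_p) : (n <= p - \rank D)%N ->
  exists2 Z : 'M[F]_(p, n), D *m Z = 0 & \rank Z = n.
Proof.
rewrite -(mxrank_tr D) -mxrank_ker => nr.
exists ((pid_mx n : 'M[F]_(n, _)) *m row_base (kermx D^T))^T.
  apply: trmx_inj; rewrite trmx_mul trmxK trmx0 -mulmxA.
  have /sub_kermxP -> : (row_base (kermx D^T) <= kermx D^T)%MS by rewrite eq_row_base.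
  by rewrite mulmx0.
by rewrite mxrank_tr mxrankMfree ?row_base_free // rank_pid_mx.
Qed.

Lemma kernel_frame_max p n (D : 'M[F]_p) (Z : 'M[F]_(p, n)) :
  D *m Z = 0 -> \rank Z = n -> (n <= p - \rank D)%N.
Proof.
by move=> /mulmx0_rank_max + rZ; rewrite rZ => h; rewrite leq_subRL ?rank_leq_row.
Qed.

End KernelFrame.

(** * Multiplicities of the eigenvalues *)

Section HermitianIntegral.
Context {R : realType}.
Local Notation mu := (@lebesgue_measure R).
Local Notation C := R[i].

Lemma herm_mxintegral n (D : set R) (F : R -> 'M[C]_n) : measurable D ->
  mxintegrable D F -> {ae mu, forall x, D x -> F x \is hermsymmx} ->
  mxintegral D F \is hermsymmx.
Proof.
move=> mD Fi hF; rewrite hermP; apply/eqP/matrixP => i j; rewrite ctrE !mxE.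
have entry x : F x \is hermsymmx -> (F x j i)^*%R = F x i j.
  by move=> /hermE/matrixP/(_ i j); rewrite ctrE.
have [F1 F2] := Fi i j; have [F3 F4] := Fi j i.
rewrite /cintegral; apply/eqP; rewrite eq_complex /=; apply/andP; split; apply/eqP.
  apply: Rintegral_ae_eq => //; apply: ae_imply hF => x + Dx => /(_ Dx)/entry <-.
  by case: (F x j i).
rewrite -mulrN1 -RintegralZr //; apply: Rintegral_ae_eq => //.
  exact: integrableMb F4 (bounded_measurable_cst _ _).
apply: ae_imply hF => x + Dx => /(_ Dx)/entry <-.
by case: (F x j i) => ? ? /=; rewrite mulrN1.
Qed.

End HermitianIntegral.

Section Multiplicity.
Context {R : realType} {d N : nat}.
Local Notation mu := (@lebesgue_measure R).
Local Notation C := R[i].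
Variables (al be : nat -> R) (om : coefficients R d).
Hypotheses (N_gt0 : (0 < N)%N) (part : is_partition N al be) (omO : Omega N al be om).
Local Notation a := (al 0%N).
Local Notation b := (be N).
Local Notation m := (N.+1 * d)%N.
Local Notation n := (d + d)%N.

Local Notation P := (Pint al be om).
Local Notation Q := (Qint al be om).
Local Notation W := (Wint al be om).

Lemma Pint_unit j : (j < N)%N -> P j \in unitmx.
Proof. by move=> jN; have [_ _ /(_ j.+1 jN)[]] := omO. Qed.

Lemma Wint_pos i : (i <= N)%N -> posdefmx (W i).
Proof. by move=> iN; have [_ /(_ i iN)[]] := omO. Qed.

Let cc_sub s t : a <= s -> t <= b -> `]s, t[ `<=` `]a, b[.
Proof. by move=> as_ tb; apply: subset_itv; rewrite bnd_simp. Qed.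

Let herm_cc (F : R -> 'M[C]_d) s t : hermitian_L1 a b F -> a <= s -> t <= b ->
  mxintegral `[s, t] F \is hermsymmx.
Proof.
move=> [Fi hF] as_ tb; have sub := cc_sub as_ tb.
have Fi' : mxintegrable `]s, t[ F by apply: mxintegrableS Fi.
rewrite mxintegral_cc //; apply: herm_mxintegral => //.
by apply: ae_imply hF => x + /sub; apply.
Qed.

Lemma Pint_herm j : (j < N)%N -> P j \is hermsymmx.
Proof.
move=> jN; have [[hP _ _] _ _] := omO; apply: herm_cc => //.
  by rewrite (le_trans (partition_al part (ltnW jN))) // ltW // part.1 // ltnW.
by rewrite (le_trans (ltW (part.1 _ jN))) // (partition_be part).
Qed.

Lemma Qint_herm i : (i <= N)%N -> Q i \is hermsymmx.
Proof.
move=> iN; have [[_ hQ _] _ _] := omO; apply: herm_cc => //.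
  exact: (partition_al part iN).
exact: (partition_be part iN).
Qed.

Lemma Wint_herm i : (i <= N)%N -> W i \is hermsymmx.
Proof.
move=> iN; have [[_ _ hW] _ _] := omO; apply: herm_cc => //.
  exact: (partition_al part iN).
exact: (partition_be part iN).
Qed.

Definition SLH : 'M[C]_m := Hmx N P Q.
Definition SLW : 'M[C]_m := Wmx N W.
Definition SLT : 'M[C]_(n, m) := @Tmx R d N.

Lemma SLH_herm : SLH \is hermsymmx.
Proof. exact: (herm_Hmx Pint_herm Qint_herm). Qed.

Lemma SLW_herm : SLW \is hermsymmx.
Proof. exact: (herm_Wmx Wint_herm). Qed.

Lemma SLW_pos : posdefmx SLW.
Proof. exact: (posdef_Wmx Wint_pos). Qed.

Lemma SLT_ortho : SLT *m SLT ^t* = 1%:M.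
Proof. exact: Tmx_ortho. Qed.

Variable K : {set 'I_(d + d)}.
Local Notation E0 := (E0hat K : 'M[C]_(n, #|K|)).

Definition SLpencil (S : 'M[C]_n) (z : C) : 'M[C]_(m + #|K|) :=
  chart_pencil K SLH SLW SLT S z.

Local Notation M S := (row_mx S 1%:M *m EK K).

Lemma mul_col_comb p q (Z : 'M[C]_(p, q)) (c : 'cV[C]_q) :
  Z *m c = \sum_j c j 0 *: col j Z.
Proof.
apply/matrixP => i j; rewrite ord1 mxE summxE; apply: eq_bigr => k _.
by rewrite !mxE mulrC.
Qed.

Lemma col_ext p q (A B : 'M[C]_(p, q)) : (forall j, col j A = col j B) -> A = B.
Proof.
by move=> AB; apply/matrixP => i j; move/matrixP/(_ i 0): (AB j); rewrite !mxE.
Qed.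

Lemma vseq_sum k (c : 'I_k -> C) (U : 'I_k -> 'cV[C]_m) (V : 'I_k -> 'cV[C]_n) i :
  \sum_j c j *: vseq P (U j) (V j) i =
  vseq P (\sum_j c j *: U j) (\sum_j c j *: V j) i.
Proof.
case: i => [|i] /=; first by rewrite linear_sum; apply: eq_bigr => j _; rewrite linearZ.
case: ifP => _; last by rewrite linear_sum; apply: eq_bigr => j _; rewrite linearZ.
rewrite !mulmx_sumr -sumrB mulmx_sumr; apply: eq_bigr => j _.
by rewrite -!scalemxAr -scalerBr -scalemxAr.
Qed.

Lemma vseq0 i : vseq P (0 : 'cV[C]_m) (0 : 'cV[C]_n) i = 0.
Proof.
case: i => [|i] /=; first exact: linear0.
case: ifP => _; last exact: linear0.
by rewrite !mulmx0 subrr mulmx0.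
Qed.

Lemma chartV_linear (S : 'M[C]_n) : exists L : 'M[C]_(n, m + #|K|),
  forall U p, chartV SLT S U p = L *m col_mx U p.
Proof.
have alg p q r (E : 'M[C]_(n, p)) (A : 'M[C]_(n, r)) (B : 'M[C]_(r, q)) (E' : 'M[C]_(r, p))
    (U : 'cV[C]_q) (x : 'cV[C]_p) :
    E *m x - A *m (B *m U + E' *m x) = row_mx (- (A *m B)) (E - A *m E') *m col_mx U x.
  by rewrite mul_row_col mulNmx mulmxBl mulmxDr !mulmxA opprD addrCA.
by eexists=> U p; exact: alg.
Qed.

Lemma solution_right z u v : SL_solution a b om z u v -> u b = sample_u al u N.
Proof.
move=> /(solution_profile part omO)[_ /(_ N b (leqnn N)) h _].
by apply: (h _).1; rewrite lexx ltW // part.1.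
Qed.

(** A solution is determined by its samples and these by a kernel vector of the
    pencil, linearly at each stage.  So independence passes from eigenfunctions to
    kernel vectors and back. *)
Lemma independent_eigenfunctions_pencil (S : 'M[C]_n) z k : S \is hermsymmx ->
  has_independent_eigenfunctions a b om (M S) z k <->
  (k <= m + #|K| - \rank (SLpencil S z))%N.
Proof.
move=> hS; split.
  (* From eigenfunctions to kernel vectors. *)
  move=> [u [v [sol indep]]].
  pose U j : 'cV[C]_m := \sum_(i < N.+1) (sel d N i) ^t* *m sample_u al (u j) i.
  pose V j : 'cV[C]_n := col_mx (v j a) (v j b).
  have selU j i : (i <= N)%N -> sel d N i *m U j = sample_u al (u j) i.
    exact: sel_mk.
  have sys j : atkinson_system N al be om z (sample_u al (u j)) (sample_v al be (v j)).
    by have [] := solution_profile part omO (sol j).1.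
  have vseqE j i : (i <= N.+1)%N -> vseq P (U j) (V j) i = sample_v al be (v j) i.
    case: i => [_|i iN] /=; first by rewrite col_mxKu.
    have [iN'|Ni] := ltnP i N; last first.
      have {Ni} -> : i = N by apply/eqP; rewrite eqn_leq -ltnS iN.
      by rewrite col_mxKd.
    rewrite (selU j i.+1) // (selU j i (ltnW iN')).
    by rewrite (sys j).2 // addrC addKr mulKmx ?Pint_unit.
  have eqU j : (SLH - z *: SLW) *m U j = SLT ^t* *m V j.
    apply/eqP; rewrite -subr_eq0; apply/eqP/(@sel_ext _ d N) => i iN.
    rewrite mulmx0 sel_residual // selU // (vseqE j i (leqW iN)) (vseqE j i.+1 iN).
    apply/eqP; rewrite subr_eq0; apply/eqP; rewrite addrC.
    exact/esym/(sys j).1.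
  have bcU j : lsubmx (M S) *m (SLT *m U j) + rsubmx (M S) *m V j = 0.
    have -> : SLT *m U j = col_mx (- u j a) (u j b).
      rewrite /SLT /Tmx mul_col_mx mulNmx (selU j 0%N) // (selU j N) //.
      by rewrite -(solution_right (sol j).1).
    exact: (sol j).2.
  pose p j := E0 ^t* *m V j.
  have kern j' := chart_solution_kernel hS (eqU j') (bcU j').
  pose Z : 'M[C]_(m + #|K|, k) := \matrix_(i, j) col_mx (U j) (p j) i 0.
  have colZ j : col j Z = col_mx (U j) (p j).
    by apply/matrixP => i l; rewrite ord1 !mxE.
  apply: (@kernel_frame_max _ _ _ _ Z).
    by apply: col_ext => j; rewrite colE -mulmxA -colE colZ (kern j).1;
      apply/matrixP => ? ?; rewrite !mxE.
  apply: col_free_rank => c Zc.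
  have [L LV] := chartV_linear S.
  have comb0 : \sum_j c j 0 *: col j Z = 0 by rewrite -mul_col_comb.
  have sumV : \sum_j c j 0 *: V j = 0.
    rewrite (eq_bigr (fun j => L *m (c j 0 *: col j Z))) => [|j _].
      by rewrite -mulmx_sumr comb0 mulmx0.
    by rewrite -scalemxAr colZ -LV -(kern j).2.
  have sumU : \sum_j c j 0 *: U j = 0.
    rewrite (eq_bigr (fun j => usubmx (c j 0 *: col j Z))) => [|j _].
      by rewrite -linear_sum comb0 linear0.
    by rewrite linearZ /= colZ col_mxKu.
  have sumu i : (i <= N)%N -> \sum_j c j 0 *: sample_u al (u j) i = 0.
    move=> iN; rewrite (eq_bigr (fun j => sel d N i *m (c j 0 *: U j))) => [|j _].
      by rewrite -mulmx_sumr sumU mulmx0.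
    by rewrite -scalemxAr selU.
  have sumv i : (i <= N.+1)%N -> \sum_j c j 0 *: sample_v al be (v j) i = 0.
    move=> iN; rewrite (eq_bigr (fun j => c j 0 *: vseq P (U j) (V j) i)) => [|j _].
      by rewrite vseq_sum sumU sumV vseq0.
    by rewrite vseqE.
  apply/colP => j0; rewrite mxE; apply: (indep (fun j => c j 0)) => t; rewrite in_itv /= => tab.
  have prof j := solution_profile part omO (sol j).1.
  have [[i iN ti]|[i iN ti]] := partition_cover tab.
    have uv j : _ := let: And3 _ h _ := prof j in h i t iN ti.
    have su : \sum_j c j 0 *: u j t = 0.
      rewrite (eq_bigr (fun j => c j 0 *: sample_u al (u j) i)) ?sumu // => j _.
      by rewrite (uv j).1.
    split=> //; set I := mxintegral `]al i, t[ _ in uv.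
    transitivity (\sum_j c j 0 *: sample_v al be (v j) i +
                  I *m \sum_j c j 0 *: sample_u al (u j) i).
      rewrite mulmx_sumr -big_split; apply: eq_bigr => j _ /=.
      by rewrite (uv j).2 scalerDr -scalemxAr.
    by rewrite (sumu i iN) (sumv i (leqW iN)) mulmx0 addr0.
  have uv j : _ := let: And3 _ _ h := prof j in h i t iN ti.
  have sv : \sum_j c j 0 *: v j t = 0.
    rewrite (eq_bigr (fun j => c j 0 *: sample_v al be (v j) i.+1)) => [|j _].
      exact: (sumv i.+1 (leqW iN)).
    by rewrite (uv j).1.
  split=> //; set I := mxintegral `]be i, t[ _ in uv.
  transitivity (\sum_j c j 0 *: sample_u al (u j) i +
                I *m \sum_j c j 0 *: sample_v al be (v j) i.+1).
    rewrite mulmx_sumr -big_split; apply: eq_bigr => j _ /=.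
    by rewrite (uv j).2 scalerDr -scalemxAr.
  by rewrite (sumv i.+1 (leqW iN)) (sumu i (ltnW iN)) mulmx0 addr0.
(* From kernel vectors to eigenfunctions. *)
move=> /kernel_frame[Z DZ rZ].
pose U j := usubmx (col j Z); pose p j := dsubmx (col j Z).
have colZ j : col j Z = col_mx (U j) (p j) by rewrite vsubmxK.
have kerZ j : SLpencil S z *m col_mx (U j) (p j) = 0.
  rewrite -colZ colE mulmxA DZ; exact: mul0mx.
have ks j := chart_kernel_solution hS (kerZ j).
pose V j := chartV SLT S (U j) (p j).
have sysj j : atkinson_system N al be om z (fun i => sel d N i *m U j) (vseq P (U j) (V j)).
  split=> i iN; last by rewrite /= iN mulKVmx ?Pint_unit // addrC subrK.
  have [e _ _] := ks j; move/eqP: e; rewrite -subr_eq0 => /eqP/(congr1 (mulmx (sel d N i))).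
  rewrite mulmx0 sel_residual // => /eqP; rewrite subr_eq0 => /eqP <-.
  by rewrite addrC.
have ex j : exists uv : (R -> 'cV[C]_d) * (R -> 'cV[C]_d),
    [/\ SL_solution a b om z uv.1 uv.2,
    forall i, (i <= N)%N -> sample_u al uv.1 i = sel d N i *m U j &
    forall i, (i <= N.+1)%N -> sample_v al be uv.2 i = vseq P (U j) (V j) i].
  by have [us [vs h]] := solution_exists part omO (sysj j); exists (us, vs).
have [uv huv] := boolp.choice ex.
exists (fun j => (uv j).1), (fun j => (uv j).2); split=> [j|c hc].
  have [sol hu hv] := huv j; split=> //; rewrite /satisfies_bc.
  have [_ _ bc] := ks j.
  have -> : col_mx (- (uv j).1 a) ((uv j).1 b) = SLT *m U j.
    by rewrite /SLT /Tmx mul_col_mx mulNmx -!hu // -(solution_right sol); exact: erefl.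
  suff -> : col_mx ((uv j).2 a) ((uv j).2 b) = V j by exact: bc.
  rewrite -[RHS]vsubmxK; congr col_mx; first exact: (hv 0%N).
  by rewrite [LHS](hv N.+1) //= ltnn.
pose cv : 'cV[C]_k := \col_j c j.
suff /matrixP cv0 : cv = 0 by move=> j; have := cv0 j 0; rewrite !mxE.
apply: (col_inj_rank rZ); rewrite mul_col_comb.
have partab : a <= b.
  by rewrite ltW // (le_lt_trans (partition_al part (leqnn N))) // part.1.
have at_al i : (i <= N)%N -> al i \in `[a, b].
  move=> iN; rewrite in_itv /= (partition_al part iN).
  by rewrite (le_trans (ltW (part.1 _ iN))) // (partition_be part).
have sumU : \sum_j c j *: U j = 0.
  apply: (@sel_ext _ d N) => i iN; rewrite mulmx0 mulmx_sumr.
  rewrite -[RHS](hc _ (at_al i iN)).1; apply: eq_bigr => j _.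
  by have [_ hu _] := huv j; rewrite -scalemxAr -hu.
have sumV : \sum_j c j *: V j = 0.
  have Vu j : usubmx (V j) = (uv j).2 a.
    by have [_ _ hv] := huv j; rewrite [RHS](hv 0%N).
  have Vd j : dsubmx (V j) = (uv j).2 b.
    by have [_ _ hv] := huv j; rewrite [RHS](hv N.+1) //= ltnn.
  have zu : \sum_j c j *: usubmx (V j) = 0.
    have /hc[_ e] : a \in `[a, b] by rewrite in_itv /= lexx.
    by rewrite (eq_bigr (fun j => c j *: (uv j).2 a)) // => j _; rewrite Vu.
  have zd : \sum_j c j *: dsubmx (V j) = 0.
    have /hc[_ e] : b \in `[a, b] by rewrite in_itv /= lexx partab.
    by rewrite (eq_bigr (fun j => c j *: (uv j).2 b)) // => j _; rewrite Vd.
  rewrite -[LHS]vsubmxK; move: zu zd.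
  rewrite (eq_bigr (fun j => usubmx (c j *: V j))) => [|j _]; last by rewrite linearZ.
  rewrite -linear_sum => ->.
  rewrite (eq_bigr (fun j => dsubmx (c j *: V j))) => [|j _]; last by rewrite linearZ.
  by rewrite -linear_sum => ->; rewrite col_mx0.
have sump : \sum_j c j *: p j = 0.
  rewrite (eq_bigr (fun j => E0 ^t* *m (c j *: V j))) => [|j _].
    by rewrite -mulmx_sumr sumV mulmx0.
  by have [_ e _] := ks j; rewrite -scalemxAr e.
rewrite (eq_bigr (fun j => c j *: col j Z)) => [|j _]; last by rewrite mxE.
rewrite -[LHS]vsubmxK !linear_sum.
rewrite (eq_bigr (fun j => c j *: U j)) => [|j _]; last by rewrite linearZ.
rewrite sumU (eq_bigr (fun j => c j *: p j)) => [|j _]; last by rewrite linearZ.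
by rewrite sump col_mx0.
Qed.

End Multiplicity.

(** * Entrywise limits and semicontinuity of the inertia *)

Section EntrywiseConvergence.
Context {K : numFieldType} {T : Type} {F : set_system T} {FF : Filter F}.

(** Limits are computed on entries, where the operations of the field are
    continuous; [mxcvg_cvg] returns to the topology of matrices. *)
Definition mxcvg m n (f : T -> 'M[K]_(m, n)) (A : 'M[K]_(m, n)) : Prop :=
  forall i j, (fun x => f x i j) @ F --> A i j.

Lemma mxcvg_cst m n (A : 'M[K]_(m, n)) : mxcvg (fun=> A) A.
Proof. by move=> i j; exact: cvg_cst. Qed.

Lemma cvg_sum_seq I (s : seq I) (f : I -> T -> K) (l : I -> K) :
  (forall i, f i x @[x --> F] --> l i) ->
  \sum_(i <- s) f i x @[x --> F] --> \sum_(i <- s) l i.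
Proof.
move=> fl; elim: s => [|i s IH].
  by rewrite big_nil; under eq_fun do rewrite big_nil; exact: cvg_cst.
by rewrite big_cons; under eq_fun do rewrite big_cons; exact: cvgD.
Qed.

Lemma cvg_prod_seq I (s : seq I) (f : I -> T -> K) (l : I -> K) :
  (forall i, f i x @[x --> F] --> l i) ->
  \prod_(i <- s) f i x @[x --> F] --> \prod_(i <- s) l i.
Proof.
move=> fl; elim: s => [|i s IH].
  by rewrite big_nil; under eq_fun do rewrite big_nil; exact: cvg_cst.
by rewrite big_cons; under eq_fun do rewrite big_cons; exact: cvgM.
Qed.

Lemma mxcvgM m n p f (A : 'M[K]_(m, n)) g (B : 'M[K]_(n, p)) :
  mxcvg f A -> mxcvg g B -> mxcvg (fun x => f x *m g x) (A *m B).
Proof.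
move=> fA gB i j; rewrite mxE; under eq_fun do rewrite mxE.
by apply: cvg_sum_seq => k; exact: cvgM.
Qed.

Lemma mxcvgD m n f (A : 'M[K]_(m, n)) g (B : 'M[K]_(m, n)) :
  mxcvg f A -> mxcvg g B -> mxcvg (fun x => f x + g x) (A + B).
Proof.
by move=> fA gB i j; rewrite mxE; under eq_fun do rewrite mxE; exact: cvgD.
Qed.

Lemma mxcvgN m n f (A : 'M[K]_(m, n)) : mxcvg f A -> mxcvg (fun x => - f x) (- A).
Proof.
by move=> fA i j; rewrite mxE; under eq_fun do rewrite mxE; exact: cvgN.
Qed.

Lemma mxcvg_lsub m n p f (A : 'M[K]_(m, n + p)) :
  mxcvg f A -> mxcvg (fun x => lsubmx (f x)) (lsubmx A).
Proof. by move=> fA i j; rewrite mxE; under eq_fun do rewrite mxE; exact: fA. Qed.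

Lemma mxcvg_rsub m n p f (A : 'M[K]_(m, n + p)) :
  mxcvg f A -> mxcvg (fun x => rsubmx (f x)) (rsubmx A).
Proof. by move=> fA i j; rewrite mxE; under eq_fun do rewrite mxE; exact: fA. Qed.

Lemma mxcvg_block m1 m2 n1 n2 fa (A : 'M[K]_(m1, n1)) fb (B : 'M[K]_(m1, n2))
    fc (C : 'M[K]_(m2, n1)) fd (D : 'M[K]_(m2, n2)) :
  mxcvg fa A -> mxcvg fb B -> mxcvg fc C -> mxcvg fd D ->
  mxcvg (fun x => block_mx (fa x) (fb x) (fc x) (fd x)) (block_mx A B C D).
Proof.
move=> hA hB hC hD i j.
case: (split_ordP i) => i' ->; case: (split_ordP j) => j' ->.
- by rewrite block_mxEul; under eq_fun do rewrite block_mxEul; exact: hA.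
- by rewrite block_mxEur; under eq_fun do rewrite block_mxEur; exact: hB.
- by rewrite block_mxEdl; under eq_fun do rewrite block_mxEdl; exact: hC.
- by rewrite block_mxEdr; under eq_fun do rewrite block_mxEdr; exact: hD.
Qed.

Lemma mxcvg_cvg m n f (A : 'M[K]_(m, n)) : mxcvg f A -> f @ F --> A.
Proof.
move=> fA; apply/cvg_ballP => e e0; near=> x; split=> //; near: x.
apply: filter_forall => i; apply: filter_forall => j.
by have /cvg_ballP := fA i j; apply.
Unshelve. all: by end_near. Qed.

Lemma cvg_det n f (A : 'M[K]_n) :
  mxcvg f A -> \det (f x) @[x --> F] --> \det A.
Proof.
move=> fA; apply: cvg_sum_seq => s; apply: cvgM; first exact: cvg_cst.
by apply: cvg_prod_seq => i; exact: fA.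
Qed.

Lemma near_unitmx n f (A : 'M[K]_n) : mxcvg f A -> A \in unitmx ->
  \forall x \near F, f x \in unitmx.
Proof.
move=> /cvg_det/cvgrPdist_lt fA; rewrite unitmxE unitfE -normr_gt0 => /fA.
apply: filterS => x; rewrite unitmxE unitfE => Ax; apply/negP => /eqP fx0.
by move: Ax; rewrite fx0 subr0 ltxx.
Qed.

Lemma mxcvg_inv n f (A : 'M[K]_n) : mxcvg f A -> A \in unitmx ->
  mxcvg (fun x => invmx (f x)) (invmx A).
Proof.
move=> fA uA i j.
have cof : cofactor (f x) j i @[x --> F] --> cofactor A j i.
  apply: cvgM; first exact: cvg_cst.
  apply: cvg_det => k l; rewrite !mxE; under eq_fun do rewrite !mxE.
  exact: fA.
have lim : (\det (f x))^-1 * cofactor (f x) j i @[x --> F] -->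
    (\det A)^-1 * cofactor A j i.
  apply: cvgM => //; apply: cvgV; last exact: cvg_det.
  by move: uA; rewrite unitmxE unitfE.
have -> : invmx A i j = (\det A)^-1 * cofactor A j i by rewrite /invmx uA !mxE.
apply: cvg_trans lim; apply: near_eq_cvg.
apply: filterS (near_unitmx fA uA) => x ux.
by rewrite /invmx ux !mxE.
Qed.

End EntrywiseConvergence.

Section ConjugateConvergence.
Context {K : numClosedFieldType} {T : Type} {F : set_system T} {FF : Filter F}.

Lemma mxcvg_ctr m n f (A : 'M[K]_(m, n)) :
  mxcvg (F := F) f A -> mxcvg (F := F) (fun x => (f x) ^t*) (A ^t*).
Proof.
move=> fA i j; apply/cvgrPdist_lt => e e0.
have /cvgrPdist_lt/(_ e e0) := fA j i; apply: filterS => x.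
by rewrite !ctrE -rmorphB norm_conjC.
Qed.

End ConjugateConvergence.

Section InertiaSemicontinuity.
Context {R : realType}.
Local Notation C := R[i].

(** Since [2 |x_i| |x_j| <= |x_i|^2 + |x_j|^2], the form of [E] at [x] is at most
    [n / (n + 1)] times the square norm of [x]. *)
Lemma posdef_near1 n (E : 'M[C]_n) :
  (forall i j, `|E i j| <= (n.+1%:R)^-1) -> E \is hermsymmx -> posdefmx (1%:M - E).
Proof.
move=> hE hermE_ x x0.
have quad : (x ^t* *m (1%:M - E) *m x) 0 0 =
    \sum_i `|x i 0| ^+ 2 - (x ^t* *m E *m x) 0 0.
  by rewrite mulmxBr mulmx1 mulmxBl mxE [X in _ + X]mxE sqnorm_cV.
set s := \sum_i _ in quad.
have s0 : 0 < s by rewrite /s -sqnorm_cV sqnorm_cV_gt0.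
have bound : `|(x ^t* *m E *m x) 0 0| <= n%:R * (n.+1%:R)^-1 * s.
  rewrite -mulmxA mxE (le_trans (ler_norm_sum _ _ _)) //.
  apply: (@le_trans _ _ (\sum_i \sum_j (n.+1%:R)^-1 * (2^-1 * (`|x i 0| ^+ 2 + `|x j 0| ^+ 2)))).
    apply: ler_sum => i _; rewrite ctrE normrM norm_conjC mxE.
    rewrite (le_trans (ler_wpM2l (normr_ge0 _) (ler_norm_sum _ _ _))) // mulr_sumr.
    apply: ler_sum => j _; rewrite normrM mulrCA ler_pM ?mulr_ge0 //.
    rewrite ler_pdivlMl ?ltr0n // mulr_natl -subr_ge0.
    have -> : `|x i 0| ^+ 2 + `|x j 0| ^+ 2 - `|x i 0| * `|x j 0| *+ 2 =
       (`|x i 0| - `|x j 0|) ^+ 2 by rewrite sqrrB addrAC.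
    by rewrite real_exprn_even_ge0 // rpredB ?normr_real.
  have dbl : \sum_i \sum_j (`|x i 0| ^+ 2 + `|x j 0| ^+ 2) = 2%:R * (n%:R * s).
    under eq_bigr do rewrite big_split /= sumr_const card_ord.
    by rewrite big_split /= sumr_const card_ord sumrMnl -/s mulr_natl mulr_natl mulr2n.
  under eq_bigr do rewrite -mulr_sumr -mulr_sumr.
  rewrite -mulr_sumr -mulr_sumr dbl mulKf ?pnatr_eq0 //.
  by rewrite mulrCA mulrA.
have small : n%:R * (n.+1%:R)^-1 * s < s.
  by rewrite gtr_pMl // ltr_pdivrMr ?ltr0n // mul1r ltr_nat.
have Er : (x ^t* *m E *m x) 0 0 \is Num.real.
  by rewrite CrealE -ctrE !ctrM trmxCK hermE // mulmxA.
rewrite quad subr_gt0; apply: le_lt_trans (le_lt_trans bound small).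
exact: real_ler_norm.
Qed.

(** Lower semicontinuity of the negative inertia: a subspace on which the form
    is [-1] remains negative under small perturbations. *)
Lemma rminus_semicontinuous n (T : Type) (F : set_system T) (FF : Filter F)
    (f : T -> 'M[C]_n) (M : 'M[C]_n) :
  mxcvg (K := R[i] : numFieldType) (F := F) f M -> M \is hermsymmx ->
  (\forall x \near F, f x \is hermsymmx) ->
  \forall x \near F, (rminus M <= rminus (f x))%N.
Proof.
move=> fM hM hf; have [Y eY] := rminus_basis hM.
have cE : mxcvg (K := R[i] : numFieldType) (F := F)
    (fun x => Y ^t* *m f x *m Y) (Y ^t* *m M *m Y).
  by apply: mxcvgM; [apply: mxcvgM => //; exact: mxcvg_cst|exact: mxcvg_cst].
have near_ij i j : \forall x \near F,
    `|(Y ^t* *m M *m Y) i j - (Y ^t* *m f x *m Y) i j| < ((rminus M).+1%:R)^-1.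
  have /cvgrPdist_lt := cE i j; apply; by rewrite invr_gt0 ltr0n.
have near_all := filter_forall _ (fun i => filter_forall _ (near_ij i)).
near=> x.
have hfx : f x \is hermsymmx by near: x.
have small : forall i j, `|(Y ^t* *m M *m Y) i j - (Y ^t* *m f x *m Y) i j|
    < ((rminus M).+1%:R)^-1 by near: x; exact: near_all.
apply: (rminus_max (Y := Y)) => //.
have -> : - (Y ^t* *m f x *m Y) = 1%:M - (Y ^t* *m f x *m Y - Y ^t* *m M *m Y).
  by rewrite eY opprB addrA subrr sub0r.
apply: posdef_near1 => [i j|].
  by rewrite mxE [X in _ + X]mxE distrC; exact/ltW/small.
by rewrite hermP ctrB !ctrM trmxCK !hermE // !mulmxA.
Unshelve. all: by end_near. Qed.

End InertiaSemicontinuity.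

(** * The space of boundary conditions and its charts *)

Section BoundarySpace.
Context {R : realType} {d : nat}.
Local Notation C := R[i].
Local Notation n := (d + d)%N.
Local Notation Knum := (R[i] : numFieldType).

Definition mk_pair (M : bcmx R d) (hM : sa_pairs M) : sabc R d := exist _ M (mem_set hM).

Lemma mk_pairE M (hM : sa_pairs M) : set_val (mk_pair hM) = M.
Proof. by rewrite set_valE. Qed.

Lemma sabcP (p : sabc R d) : sa_pairs (set_val p).
Proof. exact: set_valP. Qed.

Lemma sabc_entries (p : sabc R d) :
  mxcvg (K := Knum) (F := nbhs p) (fun q : sabc R d => (set_val q : 'M[C]_(n, n + n)))
    (set_val p : 'M[C]_(n, n + n)).
Proof.
move=> i j.
have c1 : set_val q @[q --> p] --> (set_val p : bcmx R d).
  exact: (@initial_continuous _ _ (set_val : sabc R d -> bcmx R d) p).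
have c2 := @coord_continuous Knum n (n + n) i j (set_val p).
exact: (cvg_comp _ _ c1 c2).
Qed.

Lemma gl_pair (T : 'M[C]_n) (M : bcmx R d) : T \in unitmx ->
  sa_pairs M -> sa_pairs (T *m (M : 'M[C]_(n, n + n)) : bcmx R d).
Proof.
move=> uT [rM hM]; split; first by rewrite eqmxMfull ?row_full_unit.
move: hM; rewrite /bcA /bcB => hM.
have el : lsubmx (T *m (M : 'M[C]_(n, n + n))) = T *m lsubmx (M : 'M[C]_(n, n + n)).
  by rewrite -{1}[M]hsubmxK mul_mx_row row_mxKl.
have er : rsubmx (T *m (M : 'M[C]_(n, n + n))) = T *m rsubmx (M : 'M[C]_(n, n + n)).
  by rewrite -{1}[M]hsubmxK mul_mx_row row_mxKr.
rewrite el er !ctrM !mulmxA -(mulmxA T (lsubmx _)) hM -(mulmxA T (rsubmx _)).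
by [].
Qed.

Lemma bcclass_eq (p q : sabc R d) : bcclass p = bcclass q <->
  exists2 T : 'M[C]_n, T \in unitmx &
    (set_val q : 'M[C]_(n, n + n)) = T *m (set_val p : 'M[C]_(n, n + n)).
Proof.
split=> [e|].
  by apply/asboolP; rewrite -/(gl_equiv p q); apply/eqmodP.
by move=> h; apply/eqmodP/asboolP.
Qed.

(** The class map is open: the set of pairs equivalent to an element of an open set
    [V] is the union of the translates of [V] by the invertible matrices.  Hence
    local properties of a class can be checked on pairs near a representative. *)
Lemma nbhs_bcclass (p : sabc R d) (U : set (bcspace R d)) :
  nbhs (bcclass p) U <-> nbhs p ((@bcclass R d) @^-1` U).
Proof.
split; first by move=> nU; have := @pi_continuous _ {eq_quot (@gl_equiv R d)} p _ nU.
rewrite nbhsE; move=> [V [oV Vp] VU].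
pose act (T : 'M[C]_n) (uT : T \in unitmx) (q : sabc R d) : sabc R d :=
  mk_pair (gl_pair uT (sabcP q)).
have act_cont T uT : continuous (@act T uT).
  apply: continuous_comp_initial => q.
  have -> : set_val \o @act T uT =
      (fun q => T *m (set_val q : 'M[C]_(n, n + n)) : bcmx R d).
    by apply/funext => q' /=; rewrite mk_pairE.
  have hT : mxcvg (K := Knum) (F := nbhs q) (fun=> (T : 'M[Knum]_n)) T.
    exact: mxcvg_cst.
  have Fq : Filter (nbhs q) by exact: nbhs_filter.
  have h := mxcvg_cvg (mxcvgM hT (@sabc_entries q)).
  exact: (h Fq Fq).
suff oW : open ((@bcclass R d) @` V).
  exists ((@bcclass R d) @` V); first by split=> //; exists p.
  by move=> _ [q Vq <-]; exact: VU.
suff : open ((@bcclass R d) @^-1` ((@bcclass R d) @` V)) by [].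
have -> : (@bcclass R d) @^-1` ((@bcclass R d) @` V) =
    \bigcup_(T in [set T : 'M[C]_n | T \in unitmx])
      \bigcup_(uT in [set: T \in unitmx]) (@act T uT @^-1` V).
  apply/seteqP; split => q /=.
    move=> [q' Vq' /bcclass_eq[T uT e]].
    have uT' : invmx T \in unitmx by rewrite unitmx_inv.
    exists (invmx T) => //; exists uT' => //=.
    have -> // : act _ uT' q = q'.
    have : set_val (act _ uT' q) = set_val q' by rewrite mk_pairE e mulKmx.
    by rewrite !set_valE; exact: val_inj.
  move=> [T _ [uT _ /= Vact]]; exists (act T uT q) => //.
  apply/esym/bcclass_eq; exists T => //; exact: mk_pairE.
apply: bigcup_open => T _; apply: bigcup_open => uT _.
by move/continuousP: (act_cont T uT); apply.
Qed.

End BoundarySpace.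

Section ChartsOfPairs.
Context {R : realType} {d : nat}.
Local Notation C := R[i].
Local Notation n := (d + d)%N.
Implicit Types (K : {set 'I_(d + d)}) (p : sabc R d).

Lemma Kproj_split K : Kproj K + E0hat K *m (E0hat K) ^t* = 1%:M :> 'M[C]_n.
Proof. by rewrite -KprojC addrC subrK. Qed.

Lemma KprojE0E0 K : Kproj K *m (E0hat K *m (E0hat K) ^t*) = 0 :> 'M[C]_n.
Proof. by rewrite mulmxA KprojE0 mul0mx. Qed.

Lemma E0E0Kproj K : E0hat K *m (E0hat K) ^t* *m Kproj K = 0 :> 'M[C]_n.
Proof. by rewrite -mulmxA E0Kproj mulmx0. Qed.

Lemma E0E0_idem K : E0hat K *m (E0hat K) ^t* *m (E0hat K *m (E0hat K) ^t*) =
  E0hat K *m (E0hat K) ^t* :> 'M[C]_n.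
Proof. by rewrite mulmxA -(mulmxA (E0hat K)) E0hat_ortho mulmx1. Qed.

Definition EKinv K : 'M[C]_(n + n) :=
  block_mx (Kproj K) (- (E0hat K *m (E0hat K) ^t*)) (E0hat K *m (E0hat K) ^t*) (Kproj K).

Lemma EK_mulV K : EK K *m EKinv K = 1%:M.
Proof.
rewrite EK_block -[Kproj K - 1%:M]opprB KprojC /EKinv mulmx_block.
rewrite !(mulNmx, mulmxN) Kproj_idem E0E0_idem KprojE0E0 E0E0Kproj !oppr0 opprK !addr0.
by rewrite (addrC (E0hat K *m _)) Kproj_split -scalar_mx_block.
Qed.

Lemma EK_Vmul K : EKinv K *m EK K = 1%:M.
Proof. exact/mulmx1C/EK_mulV. Qed.

(** The pair [(A', B')] such that [(A | B) = (A' | B') EK].  The class lies in the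
    chart [K] when [B'] is invertible, with coordinate [B'^-1 A']. *)
Definition swapA K (p : sabc R d) : 'M[C]_n :=
  lsubmx ((set_val p : 'M[C]_(n, n + n)) *m EKinv K).
Definition swapB K (p : sabc R d) : 'M[C]_n :=
  rsubmx ((set_val p : 'M[C]_(n, n + n)) *m EKinv K).
Definition chartS K p : 'M[C]_n := invmx (swapB K p) *m swapA K p.

Lemma swapAE K p : swapA K p = bcA (set_val p) *m Kproj K +
  bcB (set_val p) *m (E0hat K *m (E0hat K) ^t*).
Proof.
rewrite /swapA /bcA /bcB -{1}[set_val p : 'M[C]_(n, n + n)]hsubmxK /EKinv.
by rewrite mul_row_block row_mxKl.
Qed.

Lemma swapBE K p : swapB K p = bcB (set_val p) *m Kproj K -
  bcA (set_val p) *m (E0hat K *m (E0hat K) ^t*).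
Proof.
rewrite /swapB /bcA /bcB -{1}[set_val p : 'M[C]_(n, n + n)]hsubmxK /EKinv.
by rewrite mul_row_block row_mxKr mulmxN addrC.
Qed.

(** Exchanging positions and momenta, up to sign, in the range of [Q] is a symplectic
    map, so it preserves the condition of self-adjointness. *)
Lemma swap_lagrangian (F : numClosedFieldType) q (A B P Q : 'M[F]_q) :
  P ^t* = P -> Q ^t* = Q -> P *m P = P -> Q *m Q = Q -> P *m Q = 0 -> Q *m P = 0 ->
  P + Q = 1%:M -> A *m B ^t* = B *m A ^t* ->
  (A *m P + B *m Q) *m (B *m P - A *m Q) ^t* = (B *m P - A *m Q) *m (A *m P + B *m Q) ^t*.
Proof.
move=> hP hQ PP QQ PQ QP PQ1 AB.
have expand : forall X Y : 'M[F]_q, (X *m P + Y *m Q) *m (B *m P - A *m Q) ^t* =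
    X *m P *m B ^t* - Y *m Q *m A ^t*.
  move=> X Y; rewrite ctrB !ctrM hP hQ mulmxDl !mulmxBr !mulmxA.
  rewrite -!(mulmxA _ P P) -!(mulmxA _ Q Q) -!(mulmxA _ P Q) -!(mulmxA _ Q P).
  by rewrite PP QQ PQ QP !mulmx0 !mul0mx subr0 sub0r.
have expand2 : (B *m P - A *m Q) *m (A *m P + B *m Q) ^t* = B *m P *m A ^t* - A *m Q *m B ^t*.
  rewrite ctrD !ctrM hP hQ mulmxBl !mulmxDr !mulmxA.
  rewrite -!(mulmxA _ P P) -!(mulmxA _ Q Q) -!(mulmxA _ P Q) -!(mulmxA _ Q P).
  by rewrite PP QQ PQ QP !mulmx0 !mul0mx addr0 add0r.
rewrite expand expand2; apply/eqP; rewrite -subr_eq0 opprB addrACA.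
rewrite -opprD -!mulmxDl -!mulmxDr PQ1 (addrC Q) PQ1 !mulmx1 AB.
by rewrite subrr.
Qed.

Lemma chart_lagrangian K p : swapA K p *m (swapB K p) ^t* = swapB K p *m (swapA K p) ^t*.
Proof.
rewrite swapAE swapBE; apply: swap_lagrangian.
- exact: Kproj_herm.
- by rewrite ctrM trmxCK.
- exact: Kproj_idem.
- exact: E0E0_idem.
- exact: KprojE0E0.
- exact: E0E0Kproj.
- exact: Kproj_split.
- exact: (sabcP p).2.
Qed.

Lemma chartS_herm K p : swapB K p \in unitmx -> chartS K p \is hermsymmx.
Proof.
move=> uB; have uBs : (swapB K p) ^t* \in unitmx by rewrite unitmx_ctr.
rewrite hermP; apply/eqP; rewrite /chartS ctrM.
rewrite -[LHS](mulKmx uB); congr (_ *m _).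
by rewrite mulmxA -chart_lagrangian -mulmxA -ctrM mulVmx // ctr1 mulmx1.
Qed.

Lemma chart_decomposition K p : swapB K p \in unitmx ->
  (set_val p : 'M[C]_(n, n + n)) = swapB K p *m (row_mx (chartS K p) 1%:M *m EK K).
Proof.
move=> uB; rewrite mulmxA mul_mx_row mulmx1 /chartS mulKVmx //.
by rewrite /swapA /swapB hsubmxK -mulmxA EK_Vmul mulmx1.
Qed.

Lemma chart_coord_unit K p (S : 'M[C]_n) : chart_coord K (bcclass p) S ->
  swapB K p \in unitmx /\ S = chartS K p.
Proof.
move=> [hS [q qM /esym/bcclass_eq[T uT e]]].
have eB : (set_val p : 'M[C]_(n, n + n)) *m EKinv K = row_mx (T *m S) T.
  by rewrite e qM -!mulmxA EK_mulV mulmx1 mul_mx_row mulmx1.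
have -> : chartS K p = invmx T *m (T *m S).
  by rewrite /chartS /swapA /swapB eB row_mxKl row_mxKr.
by rewrite /swapB eB row_mxKr mulKmx.
Qed.

Lemma chart_pair K (S : 'M[C]_n) : S \is hermsymmx ->
  sa_pairs (row_mx S 1%:M *m EK K : bcmx R d).
Proof.
move=> hS; split.
  rewrite mxrankMfree; last by rewrite row_free_unit; have [] := mulmx1_unit (EK_mulV K).
  apply/eqP; rewrite eqn_leq rank_leq_row /= -[X in (X <= _)%N](mxrank1 C n).
  rewrite -[X in (\rank X <= _)%N](_ : row_mx S 1%:M *m col_mx 0 1%:M = 1%:M).
    exact: mxrankM_maxl.
  by rewrite mul_row_col mulmx0 add0r mulmx1.
rewrite /bcA /bcB EK_block -[Kproj K - 1%:M]opprB KprojC mul_row_block row_mxKl row_mxKr.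
rewrite !mul1mx.
have := @swap_lagrangian _ _ S (- 1%:M) (Kproj K) (E0hat K *m (E0hat K) ^t*).
rewrite !mulNmx !mul1mx -opprD !ctrN !mulmxN !mulNmx => h.
rewrite [_ + Kproj K]addrC; apply: oppr_inj; apply: h.
- exact: Kproj_herm.
- by rewrite ctrM trmxCK.
- exact: Kproj_idem.
- exact: E0E0_idem.
- exact: KprojE0E0.
- exact: E0E0Kproj.
- exact: Kproj_split.
- by rewrite ctr1 hermE // mulmx1.
Qed.

Definition chart_point K (S : 'M[C]_n) (hS : S \is hermsymmx) : sabc R d :=
  mk_pair (chart_pair K hS).

Lemma chart_point_coord K (S : 'M[C]_n) (hS : S \is hermsymmx) :
  chart_coord K (bcclass (chart_point K hS)) S.
Proof. by split=> //; exists (chart_point K hS) => //; exact: mk_pairE. Qed.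

Lemma chart_unit_coord K p : swapB K p \in unitmx ->
  chart_coord K (bcclass p) (chartS K p).
Proof.
move=> uB; have hS := chartS_herm uB; split=> //.
exists (chart_point K hS); first exact: mk_pairE.
apply/esym/bcclass_eq; exists (swapB K p) => //.
by rewrite mk_pairE; exact: chart_decomposition.
Qed.

Lemma chart_unitP K p : (exists S, chart_coord K (bcclass p) S) <-> swapB K p \in unitmx.
Proof.
by split=> [[S /chart_coord_unit[]]|/chart_unit_coord] //; exists (chartS K p).
Qed.

Lemma SmxE K p : swapB K p \in unitmx -> Smx K (bcclass p) = chartS K p.
Proof.
move=> uB; rewrite /Smx; case: xgetP => [S _ /= /chart_coord_unit[]//|h].
by case: (h (chartS K p)); exact: chart_unit_coord.
Qed.

Lemma SKAE K p : swapB K p \in unitmx -> SKA K (bcclass p) = chartB K (chartS K p).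
Proof. by move=> uB; rewrite /SKA SmxE. Qed.

(** Up to an invertible left factor [B] is [S F + (1 - F)] with [F] the projection on
    [K].  A kernel vector of that matrix is determined by its part in [K], which can
    be any kernel vector of the block of [S] on [K]. *)
Lemma corank_chart K p : swapB K p \in unitmx ->
  (n - \rank (bcB (set_val p)))%N = r0 (chartB K (chartS K p)).
Proof.
move=> uB; have hS := chartS_herm uB; set S := chartS K p in hS *.
rewrite r0_rank; last exact: chartB_herm.
have -> : \rank (bcB (set_val p)) =
    \rank (S *m (E0hat K *m (E0hat K) ^t*) + Kproj K)%R.
  rewrite /bcB (chart_decomposition uB) EK_block -/S mul_row_block mul1mx.
  by rewrite mul_mx_row row_mxKr mul1mx KprojC eqmxMfull ?row_full_unit.
set E := E0hat K; set B1 := _ + _.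
suff iff k : (k <= n - \rank B1)%N = (k <= #|K| - \rank (chartB K S))%N.
  by apply/eqP; rewrite eqn_leq -iff leqnn iff leqnn.
apply/idP/idP => /kernel_frame[Z BZ rZ].
  have EB : E ^t* *m B1 = E ^t* *m S *m E *m E ^t*.
    by rewrite mulmxDr E0Kproj addr0 !mulmxA.
  have PB : Kproj K *m Z = - (Kproj K *m S *m E *m (E ^t* *m Z)).
    have B1Z : B1 *m Z = S *m E *m (E ^t* *m Z) + Kproj K *m Z.
      by rewrite [LHS]mulmxDl !mulmxA.
    have /eqP := congr1 (mulmx (Kproj K)) BZ; rewrite mulmx0 B1Z (mulmxDr (Kproj K)).
    rewrite (mulmxA (Kproj K) (Kproj K)) Kproj_idem addrC addr_eq0 => /eqP ->.
    by rewrite !mulmxA.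
  apply: (@kernel_frame_max _ _ _ _ (E ^t* *m Z)).
    by rewrite mulmxA -EB -mulmxA BZ mulmx0.
  apply: col_free_rank => c Zc; apply: (col_inj_rank rZ).
  rewrite -[Z]mul1mx -(Kproj_split K) mulmxDl PB mulmxDl mulNmx.
  by rewrite -!mulmxA (mulmxA _ Z) Zc !mulmx0 oppr0 addr0.
apply: (@kernel_frame_max _ _ _ _ (E *m Z - Kproj K *m S *m E *m Z)).
  have CZ : E *m E ^t* *m (S *m E *m Z) = 0.
    by rewrite -[RHS](mulmx0 _ E) -BZ /chartB !mulmxA.
  have -> : B1 *m (E *m Z - Kproj K *m S *m E *m Z) = E *m E ^t* *m (S *m E *m Z).
    have B1E (q : nat) (y : 'M[C]_(#|K|, q)) : B1 *m (E *m y) = S *m E *m y.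
      rewrite [LHS]mulmxDl (mulmxA (Kproj K)) KprojE0 mul0mx addr0.
      by rewrite -!mulmxA (mulmxA _ E y) E0hat_ortho mul1mx.
    have B1P (q : nat) (y : 'M[C]_(n, q)) : B1 *m (Kproj K *m y) = Kproj K *m y.
      rewrite [LHS]mulmxDl (mulmxA (Kproj K) (Kproj K)) Kproj_idem -!mulmxA.
      by rewrite (mulmxA _ (Kproj K) y) E0Kproj mul0mx !mulmx0 add0r.
    rewrite mulmxBr B1E -!(mulmxA (Kproj K)) B1P.
    rewrite -{1}[S *m E *m Z]mul1mx -{1}(Kproj_split K) [X in X - _]mulmxDl.
    by rewrite addrC addrA !mulmxA addNr add0r.
  exact: CZ.
apply: col_free_rank => c /(congr1 (mulmx (E ^t*))).
rewrite mulmx0 mulmxBl mulmxBr -!mulmxA (mulmxA _ E) E0hat_ortho mul1mx.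
rewrite (mulmxA _ (Kproj K)) E0Kproj mul0mx subr0.
exact: col_inj_rank.
Qed.

End ChartsOfPairs.

Section ChartExists.
Context {R : realType} {d : nat}.
Local Notation C := R[i].
Local Notation n := (d + d)%N.

(** Take for [K] the complement of a maximal set of independent columns of [B].  If
    [y] kills the columns of [B] outside [K] and those of [A] in [K], then [y B = 0];
    since [A B^* = B A^*], the row [y A], supported outside [K], is orthogonal to
    these independent columns of [B], hence [y A = 0], and [y = 0] by the rank
    condition. *)
Lemma chart_exists (p : sabc R d) : exists K, swapB K p \in unitmx.
Proof.
have [rM sym] := sabcP p.
set A : 'M[C]_n := bcA (set_val p) in sym *; set B : 'M[C]_n := bcB (set_val p) in sym *.
pose f := maxrankfun B^T.
pose K : {set 'I_n} := [set i | i \notin codom f]%SET.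
have inK i : (i \notin K) = (i \in codom f) by rewrite finset.inE negbK.
exists K; rewrite -row_free_unit -kermx_eq0; apply/rowV0P => y /sub_kermxP.
rewrite swapBE -/A -/B mulmxBr => e.
set F := E0hat K *m (E0hat K) ^t* in e.
have yBP : y *m B *m Kproj K = 0.
  move: (congr1 (mulmx^~ (Kproj K)) e); rewrite mul0mx mulmxBl.
  by rewrite -(mulmxA y (A *m F)) -(mulmxA A) E0E0Kproj !mulmx0 subr0 -!mulmxA Kproj_idem.
have yAF : y *m A *m F = 0.
  move: (congr1 (mulmx^~ F) e); rewrite mul0mx mulmxBl -(mulmxA y (B *m _)).
  rewrite -(mulmxA B) KprojE0E0 !mulmx0 sub0r -!(mulmxA y) -(mulmxA A) E0E0_idem => /eqP.
  by rewrite oppr_eq0 => /eqP.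
have colPout (v : 'rV[C]_n) i : i \notin K -> (v *m Kproj K) 0 i = v 0 i.
  by move=> iK; rewrite Kproj_diag mul_mx_diag !mxE iK mulr1.
have colP0 (v : 'rV[C]_n) i : i \in K -> (v *m Kproj K) 0 i = 0.
  by move=> iK; rewrite Kproj_diag mul_mx_diag !mxE iK mulr0.
have /submxP[X eX] : (B^T <= rowsub f B^T)%MS by rewrite eq_maxrowsub.
have yB : y *m B = 0.
  apply: trmx_inj; rewrite trmx_mul trmx0 eX -mulmxA.
  suff -> : rowsub f B^T *m y^T = 0 by rewrite mulmx0.
  apply/matrixP => i j; rewrite ord1 [LHS]mxE [RHS]mxE.
  have e1 : \sum_l y 0 l * B l (f i) = 0.
    have := colPout (y *m B) (f i); rewrite inK codom_f yBP => /(_ isT).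
    by rewrite [LHS]mxE [RHS]mxE => <-.
  by rewrite -[RHS]e1; apply: eq_bigr => l _; rewrite !mxE mulrC.
have split1 : Kproj K + F = 1%:M := Kproj_split K.
have yA : y *m A *m Kproj K = y *m A.
  by rewrite -[RHS]mulmx1 -split1 [RHS]mulmxDr yAF addr0.
have yAB : y *m A *m B ^t* = 0.
  by rewrite -mulmxA sym mulmxA yB mul0mx.
have [v vE] : exists v : 'rV[C]_n, v = map_mx Num.conj (y *m A) by eexists.
have vB : v *m B^T = 0.
  rewrite vE; have := congr1 (map_mx Num.conj) yAB; rewrite map_mxM map_mx0 -map_mx_comp.
  by rewrite (map_mx_id (@conjCK _)).
have v_out i : i \in K -> v 0 i = 0.
  by move=> iK; rewrite vE mxE -yA colP0 // rmorph0.
pose w : 'rV[C]_(\rank B^T) := \row_j v 0 (f j).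
have wv : w *m rowsub f 1%:M = v.
  apply/rowP => i; rewrite mxE; have [iK|] := boolP (i \in K).
    rewrite v_out // big1 // => j _; rewrite !mxE.
    have [e1|_] := eqVneq (f j) i; last by rewrite mulr0.
    by move: iK; rewrite -[_ \in _]negbK inK -e1 codom_f.
  rewrite inK => /codomP[j ->]; rewrite (bigD1 j) //= !mxE eqxx mulr1 big1 ?addr0 //.
  by move=> k kj; rewrite !mxE (inj_eq (@maxrankfun_inj _ _ _ _)) (negPf kj) mulr0.
have w0 : w = 0.
  apply: (row_free_inj (maxrowsub_free B^T)).
  by rewrite mul0mx rowsubE mulmxA wv.
have yA0 : y *m A = 0.
  have v0 : v = 0 by rewrite -wv w0 mul0mx.
  apply/rowP => i; move/rowP/(_ i): v0; rewrite vE [LHS]mxE !mxE => /eqP.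
  by rewrite fmorph_eq0 => /eqP.
have y0 : y *m (set_val p : 'M[C]_(n, n + n)) = 0.
  rewrite -[set_val p : 'M[C]_(n, n + n)]hsubmxK mul_mx_row.
  by rewrite -[lsubmx _]/A -[rsubmx _]/B yA0 yB row_mx0.
apply: (row_free_inj (A := (set_val p : 'M[C]_(n, n + n)))); last by rewrite y0 mul0mx.
by rewrite /row_free rM.
Qed.

End ChartExists.

(** * Counting eigenvalues near a boundary condition *)

Section EigenvalueList.
Context {R : realType} {d N : nat}.
Local Notation C := R[i].
Local Notation n := (d + d)%N.
Local Notation m := (N.+1 * d)%N.
Variables (al be : nat -> R) (om : coefficients R d).
Hypotheses (N_gt0 : (0 < N)%N) (part : is_partition N al be) (omO : Omega N al be om).
Local Notation a := (al 0%N).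
Local Notation b := (be N).

Lemma satisfies_bc_gl (T : 'M[C]_n) (M M' : bcmx R d) u v : T \in unitmx ->
  (M' : 'M[C]_(n, n + n)) = T *m (M : 'M[C]_(n, n + n)) ->
  satisfies_bc a b M u v <-> satisfies_bc a b M' u v.
Proof.
move=> uT e; rewrite /satisfies_bc /bcA /bcB.
have el : lsubmx (M' : 'M[C]_(n, n + n)) = T *m lsubmx (M : 'M[C]_(n, n + n)).
  by rewrite e -{1}[M]hsubmxK mul_mx_row row_mxKl.
have er : rsubmx (M' : 'M[C]_(n, n + n)) = T *m rsubmx (M : 'M[C]_(n, n + n)).
  by rewrite e -{1}[M]hsubmxK mul_mx_row row_mxKr.
rewrite el er -!mulmxA -mulmxDr; split=> [->|h]; first by rewrite mulmx0.
have := congr1 (mulmx (invmx T)) h; rewrite mulKmx // mulmx0; exact.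
Qed.

Lemma independent_gl (T : 'M[C]_n) (M M' : bcmx R d) z k : T \in unitmx ->
  (M' : 'M[C]_(n, n + n)) = T *m (M : 'M[C]_(n, n + n)) ->
  has_independent_eigenfunctions a b om M z k <->
  has_independent_eigenfunctions a b om M' z k.
Proof.
move=> uT e; split=> -[u [v [sol ind]]]; exists u, v; split=> // j.
  by have [s1 s2] := sol j; split=> //; apply/(satisfies_bc_gl _ _ uT e).
by have [s1 s2] := sol j; split=> //; apply/(satisfies_bc_gl _ _ uT e).
Qed.

Lemma sorted_count_eq (s t : seq R) : sorted <=%R s -> sorted <=%R t ->
  (forall z : C, count_mem z [seq x%:C | x <- s] = count_mem z [seq x%:C | x <- t]) ->
  s = t.
Proof.
move=> ss st e; apply: (sorted_eq le_trans le_anti) => //.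
apply/allP => x _ /=; apply/eqP.
have cnt (r : seq R) : count_mem x%:C [seq y%:C | y <- r] = count_mem x r.
  by rewrite count_map; apply: eq_count => y /=; rewrite eq_complex /= eqxx andbT.
by have := e x%:C; rewrite !cnt.
Qed.

Local Notation SLp K := (SLpencil al be om K (N := N)).

(** The list is chosen by its specification for an arbitrary representative of the
    class.  The eigenfunctions do not depend on the representative, and a sorted list
    is determined by its multiplicities; so it is the spectrum of the pencil. *)
Lemma eigenvalue_list_chart K (A : bcspace R d) (S : 'M[C]_n) : chart_coord K A S ->
  let s := eigenvalue_list a b om A in
  [/\ sorted <=%R s, size s = (m - r0 (chartB K S))%N,
      forall x : R, rminus (SLp K S x%:C) =
        (count (fun y => (y < x)%R) s + (rminus (chartB K S) + r0 (chartB K S)))%N &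
      forall z : C, (m + #|K| - \rank (SLp K S z))%N = count_mem z [seq y%:C | y <- s]].
Proof.
move=> coord s; have hS := coord.1.
have [t [st sz cnt mult]] := pencil_spectrum
  (chartH_herm K SLT (SLH_herm part omO) hS) (SLW_herm part omO) (SLW_pos omO)
  (chartB_herm K hS) (chartG_rank K (SLT_ortho N_gt0) S).
suff -> : s = t by [].
have [p pM Ap] := coord.2.
have [T uT eT] : exists2 T : 'M[C]_n, T \in unitmx &
    (bcrepr A : 'M[C]_(n, n + n)) = T *m (row_mx S 1%:M *m EK K).
  have : bcclass p = bcclass (repr (A : {eq_quot (@gl_equiv R d)})).
    by rewrite -Ap /bcclass reprK.
  by move=> /bcclass_eq[T uT e]; exists T; [exact: uT|rewrite -pM; exact: e].
have multE z k : multiplicity a b om (bcrepr A) z k <->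
    k = (m + #|K| - \rank (SLp K S z))%N.
  have ge := fun k => independent_eigenfunctions_pencil part omO K z k hS.
  have eq k' : has_independent_eigenfunctions a b om (bcrepr A) z k' <->
      (k' <= m + #|K| - \rank (SLp K S z))%N.
    by rewrite -ge; apply: iff_sym; exact: independent_gl uT eT.
  rewrite /multiplicity !eq; split=> [[k1 /negP k2]|->].
    by apply/eqP; rewrite eqn_leq k1 leqNgt.
  by rewrite leqnn ltnn.
have isl r : is_eigenvalue_list a b om (bcrepr A) r <-> r = t.
  split=> [[sr hr]|->].
    by apply: sorted_count_eq => // z; rewrite -mult; apply/multE.
  by split=> // z; apply/multE; rewrite mult.
rewrite /s /eigenvalue_list; case: xgetP => [r _ /isl //|h].
by case: (h t); apply/isl.
Qed.

End EigenvalueList.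

Section LocalCounting.
Context {R : realType} {d N : nat}.
Local Notation C := R[i].
Local Notation Knum := (R[i] : numFieldType).
Local Notation n := (d + d)%N.
Local Notation m := (N.+1 * d)%N.

Section Chart.
Variables (K : {set 'I_(d + d)}) (p : sabc R d).
Hypothesis uB : swapB K p \in unitmx.

Let Fp : Filter (nbhs p). Proof. exact: nbhs_filter. Qed.

Let swap_cvg : mxcvg (K := Knum) (F := nbhs p)
  (fun q : sabc R d => (set_val q : 'M[Knum]_(n, n + n)) *m (EKinv K : 'M[Knum]_(n + n)))
  ((set_val p : 'M[Knum]_(n, n + n)) *m (EKinv K : 'M[Knum]_(n + n))).
Proof. by apply: mxcvgM; [exact: sabc_entries|exact: mxcvg_cst]. Qed.

Let chB_cvg : mxcvg (K := Knum) (F := nbhs p) (swapB K : sabc R d -> 'M[Knum]_n) (swapB K p).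
Proof. exact: (mxcvg_rsub swap_cvg). Qed.

Let chA_cvg : mxcvg (K := Knum) (F := nbhs p) (swapA K : sabc R d -> 'M[Knum]_n) (swapA K p).
Proof. exact: (mxcvg_lsub swap_cvg). Qed.

Lemma near_chart : \forall q \near p, swapB K q \in unitmx.
Proof. exact: (near_unitmx chB_cvg uB). Qed.

Lemma chartS_cvg :
  mxcvg (K := Knum) (F := nbhs p) (chartS K : sabc R d -> 'M[Knum]_n) (chartS K p).
Proof. exact: (mxcvgM (mxcvg_inv chB_cvg uB) chA_cvg). Qed.

Lemma chartB_cvg : mxcvg (K := Knum) (F := nbhs p)
  (fun q => chartB K (chartS K q) : 'M[Knum]_#|K|) (chartB K (chartS K p)).
Proof.
apply: mxcvgM; last exact: mxcvg_cst.
by apply: mxcvgM; [exact: mxcvg_cst|exact: chartS_cvg].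
Qed.

Lemma chart_pencil_cvg (H W : 'M[C]_m) (T : 'M[C]_(n, m)) (z : C) :
  mxcvg (K := Knum) (F := nbhs p)
    (fun q => chart_pencil K H W T (chartS K q) z : 'M[Knum]_(m + #|K|))
    (chart_pencil K H W T (chartS K p) z).
Proof.
have cG : mxcvg (K := Knum) (F := nbhs p)
    (fun q => chartG K T (chartS K q) : 'M[Knum]_(m, #|K|)) (chartG K T (chartS K p)).
  apply: mxcvgM; last exact: mxcvg_cst.
  apply: mxcvgM; first exact: mxcvg_cst.
  apply: mxcvgD; last exact: mxcvg_cst.
  by apply: mxcvgM; [exact: mxcvg_cst|exact: chartS_cvg].
apply: mxcvg_block => //; last exact: chartB_cvg.
  apply: mxcvgD; last exact: mxcvg_cst.
  apply: mxcvgD; first exact: mxcvg_cst.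
  do 2 (apply: mxcvgM; last exact: mxcvg_cst).
  by apply: mxcvgM; [exact: mxcvg_cst|exact: chartS_cvg].
exact: mxcvg_ctr cG.
Qed.

Lemma herm_near : \forall q \near p, chartS K q \is hermsymmx.
Proof. by near=> q; apply: chartS_herm; near: q; exact: near_chart.
Unshelve. all: by end_near. Qed.

Lemma inertia_semicontinuous k (f : sabc R d -> 'M[C]_k) :
  mxcvg (K := Knum) (F := nbhs p) (f : sabc R d -> 'M[Knum]_k) (f p) ->
  f p \is hermsymmx -> (\forall q \near p, f q \is hermsymmx) ->
  \forall q \near p, (rminus (f p) <= rminus (f q))%N /\ (rplus (f p) <= rplus (f q))%N.
Proof.
move=> fc hp hq.
have h1 : \forall q \near p, (rminus (f p) <= rminus (f q))%N.
  by have h := rminus_semicontinuous Fp fc hp hq; exact h.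
have hqN : \forall q \near p, - f q \is hermsymmx.
  by near=> q; apply: hermN; near: q.
have h2 : \forall q \near p, (rminus (- f p) <= rminus (- f q))%N.
  have fcN : mxcvg (K := Knum) (F := nbhs p) (fun q => - f q : 'M[Knum]_k) (- f p : 'M[Knum]_k).
    exact: mxcvgN.
  by have h := rminus_semicontinuous Fp fcN (hermN hp) hqN; exact h.
have hh := @filterI _ _ Fp _ _ (@filterI _ _ Fp _ _ h1 h2) hq.
apply: (@filterS _ _ Fp _ _ _ hh) => q [[q1 q2] q3]; split=> //.
by move: q2; have [_ _ ->] := inertia_opp hp; have [_ _ ->] := inertia_opp q3.
Unshelve. all: by end_near. Qed.

Lemma chartB_inertia_near : \forall q \near p,
  (rminus (chartB K (chartS K p)) <= rminus (chartB K (chartS K q)))%N /\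
  (rplus (chartB K (chartS K p)) <= rplus (chartB K (chartS K q)))%N.
Proof.
apply: (inertia_semicontinuous (f := fun q => chartB K (chartS K q))).
- exact: chartB_cvg.
- exact/chartB_herm/chartS_herm.
- by near=> q; apply: chartB_herm; near: q; exact: herm_near.
Unshelve. all: by end_near. Qed.

Section Counting.
Variables (al be : nat -> R) (om : coefficients R d).
Hypotheses (N_gt0 : (0 < N)%N) (part : is_partition N al be) (omO : Omega N al be om).
Local Notation a := (al 0%N).
Local Notation b := (be N).
Local Notation ev q := (eigenvalue_list a b om (bcclass q)).
Local Notation CB q := (chartB K (chartS K q)).

(** Away from the eigenvalues at [p] the pencil is invertible, hence its inertia
    is locally constant: the number of eigenvalues below [x] changes near [p]
    only as much as the inertia of the block [CB]. *)
Lemma count_near (x : R) : x \notin ev p ->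
  \forall q \near p,
    (count (fun y => (y < x)%R) (ev q) + (rminus (CB q) + r0 (CB q)) =
     count (fun y => (y < x)%R) (ev p) + (rminus (CB p) + r0 (CB p)))%N.
Proof.
move=> xp; pose D q := SLpencil al be om K (N := N) (chartS K q) x%:C.
have hD q : swapB K q \in unitmx -> D q \is hermsymmx.
  move=> uq; have hS := chartS_herm uq.
  exact: herm_pencil (chartH_herm K _ (SLH_herm part omO) hS) (SLW_herm part omO)
    (chartB_herm K hS) x.
have cD : mxcvg (K := Knum) (F := nbhs p) (D : sabc R d -> 'M[Knum]_(m + #|K|)) (D p).
  exact: chart_pencil_cvg.
have cnt q : swapB K q \in unitmx -> rminus (D q) =
    (count (fun y => (y < x)%R) (ev q) + (rminus (CB q) + r0 (CB q)))%N.
  move=> uq.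
  by have [_ _ h _] := eigenvalue_list_chart N_gt0 part omO (chart_unit_coord uq); exact: h.
have rp : r0 (D p) = 0%N.
  have [_ _ _ mult] := eigenvalue_list_chart N_gt0 part omO (chart_unit_coord uB).
  rewrite r0_rank; last exact: hD.
  rewrite mult; apply/count_memPn; apply: contra xp => /mapP[y yp].
  by move=> [->].
clearbody D.
have hDn : \forall q \near p, D q \is hermsymmx.
  by near=> q; apply: hD; near: q; exact: near_chart.
have semi := inertia_semicontinuous cD (hD p uB) hDn.
have hh := @filterI _ _ Fp _ _ semi near_chart.
apply: (@filterS _ _ Fp _ _ _ hh) => q [[sm sp] uq].
have ip := inertia_sum (hD p uB); have iq := inertia_sum (hD q uq).
apply: etrans (esym (cnt q uq)) (etrans _ (cnt p uB)).
clear -sm sp ip iq rp; lia.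
Unshelve. all: by end_near. Qed.

End Counting.
End Chart.
End LocalCounting.

(** * Limits of the entries of sorted lists *)

Section SortedLists.
Context {R : realType}.
Implicit Types (s : seq R) (x : R).

Lemma nth_lt_count s j x : sorted <=%R s -> (j < size s)%N ->
  (nth 0 s j < x) = (j < count (fun y => (y < x)%R) s)%N.
Proof.
elim: s j => [|y s IH] j ss js; first by rewrite ltn0 in js.
have [yx|xy] := ltP y x.
  case: j js => [|j] js /=; first by rewrite yx.
  by rewrite yx ltnS (IH j (path_sorted ss) js).
have ge_x z : z \in y :: s -> x <= z.
  rewrite inE => /predU1P[->//|zs]; apply: le_trans xy _.
  by move: ss; rewrite /= path_sortedE; [case/andP => /allP/(_ z zs)|exact: le_trans].
have -> : count (fun z => (z < x)%R) (y :: s) = 0%N.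
  apply/eqP; rewrite -leqn0 leqNgt -has_count; apply/hasPn => z zs.
  by rewrite -leNgt ge_x.
by rewrite ltn0; apply/negbTE; rewrite -leNgt ge_x // mem_nth.
Qed.

Lemma avoid_seq s (u v : R) : u < v -> exists2 x, u < x < v & x \notin s.
Proof.
elim: s u v => [|y s IH] u v uv; first by exists ((u + v) / 2); rewrite // !midf_lt.
have [w uw wv] : exists2 w, u < w & w < v by exists ((u + v) / 2); rewrite midf_lt.
have [yw|wy] := leP y w.
  have [x /andP[wx xv] xs] := IH _ _ wv; exists x; first by rewrite xv (lt_trans uw).
  by rewrite inE negb_or xs andbT gt_eqF // (le_lt_trans yw).
have [x /andP[ux xw] xs] := IH _ _ uw; exists x; first by rewrite ux (lt_trans xw).
by rewrite inE negb_or xs andbT lt_eqF // (lt_trans xw).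
Qed.

(** The entry of index [j] of a sorted list is below [x] exactly when more than [j]
    entries are.  So counting functions that become that of [s] shifted by [c], at
    each [x] outside [s], determine the limit of every entry, finite or not. *)
Section CountingConvergence.
Variables (T : Type) (F : set_system T) (FF : Filter F).
Variables (L : T -> seq R) (s : seq R) (c : nat).
Hypothesis sorted_s : sorted <=%R s.
Hypothesis sorted_L : \forall t \near F, sorted <=%R (L t).
Hypothesis count_L : forall x, x \notin s -> \forall t \near F,
  count (fun y => (y < x)%R) (L t) = (count (fun y => (y < x)%R) s + c)%N.

Let count_le_size (r : seq R) x : (count (fun y => (y < x)%R) r <= size r)%N.
Proof. exact: count_size. Qed.

Lemma near_nth_lt x j : x \notin s -> (j < count (fun y => (y < x)%R) s + c)%N ->
  \forall t \near F, nth 0 (L t) j < x.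
Proof.
move=> xs jc; near=> t.
have e : count (fun y => (y < x)%R) (L t) = (count (fun y => (y < x)%R) s + c)%N.
  by near: t; exact: count_L.
have st : sorted <=%R (L t) by near: t; exact: sorted_L.
by rewrite nth_lt_count // ?e // (leq_trans jc) // -e.
Unshelve. all: by end_near. Qed.

Lemma near_nth_ge x j : x \notin s -> (count (fun y => (y < x)%R) s + c <= j)%N ->
  (\forall t \near F, (j < size (L t))%N) -> \forall t \near F, x <= nth 0 (L t) j.
Proof.
move=> xs jc sz; near=> t.
have e : count (fun y => (y < x)%R) (L t) = (count (fun y => (y < x)%R) s + c)%N.
  by near: t; exact: count_L.
have st : sorted <=%R (L t) by near: t; exact: sorted_L.
have szt : (j < size (L t))%N by near: t; exact: sz.
by rewrite leNgt nth_lt_count // e -leqNgt.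
Unshelve. all: by end_near. Qed.

Lemma nth_cvg_ninfty j : (j < c)%N -> nth 0 (L t) j @[t --> F] --> -oo.
Proof.
move=> jc; apply/cvgrNyPle => A.
have [x /andP[_ xA] xs] := @avoid_seq s (A - 1) A ltac:(by rewrite ltrBlDr ltrDl).
have h := near_nth_lt xs (ltn_addl _ jc).
by apply: filterS h => t /ltW/le_trans; apply; exact: ltW.
Qed.

Lemma nth_cvg_pinfty j : (size s + c <= j)%N ->
  (\forall t \near F, (j < size (L t))%N) -> nth 0 (L t) j @[t --> F] --> +oo.
Proof.
move=> jc sz; apply/cvgryPge => A.
have [x /andP[Ax _] xs] := @avoid_seq s A (A + 1) ltac:(by rewrite ltrDl).
have h := near_nth_ge xs (leq_trans (leq_add (count_le_size _ _) (leqnn c)) jc) sz.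
by apply: filterS h => t; apply: le_trans; exact: ltW.
Qed.

Lemma nth_cvg_finite j : (j < size s)%N ->
  nth 0 (L t) (j + c) @[t --> F] --> nth 0 s j.
Proof.
move=> js; apply/cvgrPdist_le => e e0; set l := nth 0 s j.
have [x1 /andP[lx1 x1l] x1s] := @avoid_seq s (l - e) l ltac:(by rewrite ltrBlDr ltrDl).
have [x2 /andP[lx2 x2l] x2s] := @avoid_seq s l (l + e) ltac:(by rewrite ltrDl).
have c2 : (j + c < count (fun y => (y < x2)%R) s + c)%N.
  by rewrite ltn_add2r -nth_lt_count.
have c1 : (count (fun y => (y < x1)%R) s + c <= j + c)%N.
  by rewrite leq_add2r leqNgt -nth_lt_count // -leNgt ltW.
have h2 := near_nth_lt x2s c2.
have sz : \forall t \near F, (j + c < size (L t))%N.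
  have := count_L x2s; apply: filterS => t et.
  by rewrite (leq_trans c2) // -et count_le_size.
have h1 := near_nth_ge x1s c1 sz.
apply: filterS (filterI h1 h2) => t [t1 t2].
rewrite ler_distlC; apply/andP; split.
  by rewrite (le_trans (ltW lx1)).
by rewrite (le_trans (ltW t2)) // ltW.
Qed.

End CountingConvergence.
End SortedLists.

(** * Continuity and jumps of the eigenvalues *)

Section Assembly.
Context {R : realType} {d N : nat}.
Local Notation C := R[i].
Local Notation n := (d + d)%N.
Local Notation m := (N.+1 * d)%N.
Variables (al be : nat -> R) (om : coefficients R d).
Hypotheses (N_gt0 : (0 < N)%N) (part : is_partition N al be) (omO : Omega N al be om).
Local Notation a := (al 0%N).
Local Notation b := (be N).
Local Notation ev := (eigenvalue_list a b om).
Local Notation cnt x s := (count (fun y => (y < x)%R) s).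
Implicit Types (A B : bcspace R d) (K : {set 'I_(d + d)}).

Lemma bcspace_class A : exists p, A = bcclass p.
Proof. by exists (repr (A : {eq_quot (@gl_equiv R d)})); rewrite /bcclass reprK. Qed.

Lemma OK_class K (p : sabc R d) : OK K (bcclass p) <-> swapB K p \in unitmx.
Proof. exact: chart_unitP. Qed.

Lemma OK_exists A : exists K, OK K A.
Proof.
have [p ->] := bcspace_class A; have [K uB] := chart_exists p.
by exists K; apply/OK_class.
Qed.

Lemma SKA_herm K A : OK K A -> SKA K A \is hermsymmx.
Proof.
have [p ->] := bcspace_class A; move=> /OK_class uB; rewrite SKAE //.
exact/chartB_herm/chartS_herm.
Qed.

Lemma SKA_sum K A : OK K A -> (r0 (SKA K A) + rplus (SKA K A) + rminus (SKA K A))%N = #|K|.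
Proof. by move=> /SKA_herm/inertia_sum. Qed.

Lemma ev_sorted A : sorted <=%R (ev A).
Proof.
have [K [S coord]] := OK_exists A.
by have [] := eigenvalue_list_chart N_gt0 part omO coord.
Qed.

Lemma ev_size K A : OK K A -> size (ev A) = (m - r0 (SKA K A))%N.
Proof.
have [p ->] := bcspace_class A; move=> /OK_class uB; rewrite SKAE //.
by have [] := eigenvalue_list_chart N_gt0 part omO (chart_unit_coord uB).
Qed.

Lemma Sigma_chart K A k : OK K A -> Sigma k A <-> r0 (SKA K A) = k.
Proof.
move=> OKA; split=> [[p pk pA]|rk].
  by move: OKA; rewrite -pA => /OK_class uB; rewrite SKAE // -corank_chart.
have [p Ap] := bcspace_class A; exists p => //=.
by move: OKA rk; rewrite Ap => /OK_class uB; rewrite SKAE // -corank_chart.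
Qed.

Lemma near_inertia K A : OK K A -> \forall B \near A,
  [/\ OK K B, (rminus (SKA K A) <= rminus (SKA K B))%N &
      (rplus (SKA K A) <= rplus (SKA K B))%N].
Proof.
have [p ->] := bcspace_class A; move=> /OK_class uB.
apply/nbhs_bcclass.
have Fp : Filter (nbhs p) by exact: nbhs_filter.
have hh := @filterI _ _ Fp _ _ (chartB_inertia_near uB) (near_chart uB).
apply: (@filterS _ _ Fp _ _ _ hh) => q [[h1 h2] uq].
by rewrite /preimage /= !SKAE //; split=> //; apply/OK_class.
Qed.

(** The negative inertia of the pencil at [x] is locally constant: eigenvalues enter
    or leave the half-line below [x] only through the inertia of [SKA]. *)
Lemma near_count K A x : OK K A -> x \notin ev A -> \forall B \near A,
  (cnt x (ev B) + (rminus (SKA K B) + r0 (SKA K B)) =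
   cnt x (ev A) + (rminus (SKA K A) + r0 (SKA K A)))%N.
Proof.
have [p ->] := bcspace_class A; move=> /OK_class uB xA.
apply/nbhs_bcclass.
have Fp : Filter (nbhs p) by exact: nbhs_filter.
have hh := @filterI _ _ Fp _ _ (count_near uB N_gt0 part omO xA) (near_chart uB).
apply: (@filterS _ _ Fp _ _ _ hh) => q [h1 uq].
by rewrite /preimage /= !SKAE.
Qed.

Lemma OK0_Sigma : OK finset.set0 = Sigma 0 :> set (bcspace R d).
Proof.
apply/seteqP; split=> A.
  move=> OKA; apply/(Sigma_chart _ OKA).
  have h : (r0 (SKA finset.set0 A) + rplus (SKA finset.set0 A) +
      rminus (SKA finset.set0 A))%N = 0%N by rewrite SKA_sum // cards0.
  by clear -h; lia.
move=> [p /= pk <-]; apply/OK_class.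
have F0 : E0hat finset.set0 *m (E0hat finset.set0) ^t* = 0 :> 'M[C]_n.
  apply/matrixP => i j; rewrite !mxE big1 // => l _.
  by have := leq_trans (ltn_ord l) (eq_leq (cards0 _)); rewrite ltn0.
rewrite swapBE F0 mulmx0 subr0 /Kproj F0 subr0 mulmx1 -row_free_unit /row_free.
by rewrite eqn_leq rank_leq_row /= -subn_eq0 pk.
Qed.

Lemma near_within_count (X : set (bcspace R d)) K A c : OK K A ->
  (\forall B \near A, X B ->
    (rminus (SKA K B) + r0 (SKA K B) + c = rminus (SKA K A) + r0 (SKA K A))%N) ->
  forall x, x \notin ev A -> \forall B \near within X (nbhs A),
    cnt x (ev B) = (cnt x (ev A) + c)%N.
Proof.
move=> OKA shift x xA; rewrite near_withinE.
have h := near_count OKA xA.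
have FA : Filter (nbhs A) by exact: nbhs_filter.
apply: (@filterS _ _ FA _ _ _ (@filterI _ _ FA _ _ h shift)) => B [h1 h2] XB.
have h2' := h2 XB.
clear -h1 h2'; lia.
Qed.

Lemma near_ev_sorted (X : set (bcspace R d)) A :
  \forall B \near within X (nbhs A), sorted <=%R (ev B).
Proof. by near=> B; exact: ev_sorted.
Unshelve. all: by end_near. Qed.

Lemma chart_card K : (#|K| <= d + d)%N.
Proof. by rewrite (leq_trans (max_card _)) // card_ord. Qed.

Lemma Sigma_OK K A k : OK K A -> Sigma k A -> r0 (SKA K A) = k.
Proof. by move=> /Sigma_chart => ->. Qed.

(** On [Sigma k] the corank of [SKA] is constant; as neither [rplus] nor [rminus] can
    be smaller near a point than at it, the whole inertia is locally constant and
    the counts of [near_count] do not jump. *)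
Lemma Sigma_continuous k nn : (1 <= nn <= m - k)%N ->
  lambda_continuous_on a b om nn (Sigma k).
Proof.
move=> /andP[n1 nk]; have dom A : Sigma k A -> lambda_dom a b om nn A.
  move=> kA; have [K OKA] := OK_exists A.
  by rewrite /lambda_dom /= n1 (ev_size OKA) (Sigma_OK OKA kA).
split=> //; apply/subspace_continuousP => A kA.
have [K OKA] := OK_exists A.
have FA : Filter (nbhs A) by exact: nbhs_filter.
have shift : \forall B \near A, Sigma k B ->
    (rminus (SKA K B) + r0 (SKA K B) + 0 = rminus (SKA K A) + r0 (SKA K A))%N.
  apply: (@filterS _ _ FA _ _ _ (near_inertia OKA)) => B [OKB le1 le2] kB.
  have rA := Sigma_OK OKA kA; have rB := Sigma_OK OKB kB.
  have sA := SKA_sum OKA; have sB := SKA_sum OKB.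
  clear -rA rB sA sB le1 le2; lia.
have Fw : Filter (within (Sigma k) (nbhs A)) by exact: within_filter.
have := @nth_cvg_finite R _ _ Fw (fun B => ev B) (ev A) 0 (ev_sorted A)
  (near_ev_sorted _ _) (near_within_count OKA shift) nn.-1.
rewrite addn0; apply.
by have /andP[_] := dom A kA; rewrite -{1}(prednK n1).
Qed.

Section Strata.
Variables (K : {set 'I_(d + d)}) (s0 sp sm t0 tp tm : nat).
Hypotheses (sumS : (s0 + sp + sm = #|K|)%N) (sumT : (t0 + tp + tm = #|K|)%N).
Hypotheses (st0 : (s0 < t0)%N) (tsp : (tp <= sp)%N) (tsm : (tm <= sm)%N).
Variables (A : bcspace R d) (JA : JK K t0 tp tm A).
Local Notation F := (within (JK K s0 sp sm) (nbhs A)).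

Let sizeA : size (ev A) = (m - t0)%N.
Proof. by have [OKA [<- _ _]] := JA; exact: ev_size. Qed.

Let sizeB B : JK K s0 sp sm B -> size (ev B) = (m - s0)%N.
Proof. by move=> [OKB [<- _ _]]; exact: ev_size. Qed.

Let t0_le : (t0 <= m)%N.
Proof.
have h := chart_card K; have : (2 * d <= N.+1 * d)%N by rewrite leq_mul2r ltnS N_gt0 orbT.
move: h sumT; lia.
Qed.

Let FF : Filter F. Proof. by apply: within_filter; exact: nbhs_filter. Qed.

(* The shift is [(t0 + tm) - (s0 + sm)], which is [sp - tp] since both triples have
   the same sum. *)
Let count_shift : forall x, x \notin ev A -> \forall B \near F,
  cnt x (ev B) = (cnt x (ev A) + (sp - tp))%N.
Proof.
have [OKA [rA pA mA]] := JA; apply: (near_within_count OKA).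
have FA : Filter (nbhs A) by exact: nbhs_filter.
apply: (@nearW _ (nbhs A)) => B [_ [rB pB mB]].
rewrite rA mA rB mB; move: sumS sumT tsp; clear; lia.
Qed.

Lemma JK_dom nn : (1 <= nn <= m - s0)%N -> JK K s0 sp sm `<=` lambda_dom a b om nn.
Proof. by move=> h B JB; rewrite /lambda_dom /= sizeB. Qed.

Lemma JK_cvg_ninfty nn : (1 <= nn <= sp - tp)%N ->
  lambda a b om nn B @[B --> F] --> -oo.
Proof.
move=> /andP[n1 n2].
have := @nth_cvg_ninfty R _ _ FF (fun B => ev B) (ev A) _
  (near_ev_sorted _ _) count_shift nn.-1.
by apply; rewrite prednK.
Qed.

Lemma JK_cvg_finite nn : (sp - tp < nn <= m - s0 - (sm - tm))%N ->
  lambda_dom a b om (nn - (sp - tp))%N A /\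
  lambda a b om nn B @[B --> F] --> lambda a b om (nn - (sp - tp))%N A.
Proof.
move=> h; have domA : (1 <= nn - (sp - tp) <= m - t0)%N.
  move: h sumS sumT t0_le tsp tsm; clear; lia.
split; first by rewrite /lambda_dom /= sizeA.
have := @nth_cvg_finite R _ _ FF (fun B => ev B) (ev A) _ (ev_sorted A)
  (near_ev_sorted _ _) count_shift (nn - (sp - tp)).-1.
have -> : ((nn - (sp - tp)).-1 + (sp - tp) = nn.-1)%N.
  move: h; clear; lia.
apply; rewrite sizeA; move: domA; clear; lia.
Qed.

Lemma JK_cvg_pinfty nn : (m - s0 - (sm - tm) < nn <= m - s0)%N ->
  lambda a b om nn B @[B --> F] --> +oo.
Proof.
move=> h.
have := @nth_cvg_pinfty R _ _ FF (fun B => ev B) (ev A) _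
  (near_ev_sorted _ _) count_shift nn.-1.
apply.
  rewrite sizeA; move: h sumS sumT t0_le tsp tsm; clear; lia.
rewrite near_withinE; have FA : Filter (nbhs A) by exact: nbhs_filter.
apply: nearW => B JB; rewrite sizeB //; move: h; clear; lia.
Qed.

End Strata.

End Assembly.

(** * The singular set *)

Section SingularSet.
Context {R : realType} {d N : nat}.
Local Notation C := R[i].
Local Notation Knum := (R[i] : numFieldType).
Local Notation n := (d + d)%N.
Local Notation m := (N.+1 * d)%N.
Implicit Types (A B : bcspace R d) (K : {set 'I_(d + d)}).

Lemma real_complex_cvg (t0 : R) :
  (t%:C : Knum) @[t --> t0] --> (t0%:C : Knum).
Proof.
have F0 : Filter (nbhs t0) by exact: nbhs_filter.
apply/cvgrPdist_lt => -[e e']; rewrite ltcE => /andP[/eqP/= -> /= e0].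
have h : \forall t \near t0, `|t0 - t| < e.
  have c : t @[t --> t0] --> t0 by exact: cvg_id.
  by move/cvgrPdist_lt : c; apply.
apply: (@filterS _ _ F0 _ _ _ h) => t te.
by rewrite -rmorphB normc_def /= expr0n addr0 sqrtr_sqr ltcR.
Qed.

Section ShiftedCondition.
Variables (K : {set 'I_(d + d)}) (S : 'M[C]_n) (hS : S \is hermsymmx).

Lemma shift_herm (t : R) : S + (t%:C)%:M \is hermsymmx.
Proof.
rewrite hermP ctrD; apply/eqP; congr (_ + _); first exact/eqP/(etrans (esym (hermP _))).
by apply/matrixP => i j; rewrite ctrE !mxE eq_sym rmorphMn /= conjCR.
Qed.

Definition shift_point (t : R) : sabc R d := chart_point K (shift_herm t).

Lemma shift_pointE t : (set_val (shift_point t) : 'M[C]_(n, n + n)) =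
  row_mx (S + (t%:C)%:M) 1%:M *m EK K.
Proof. exact: mk_pairE. Qed.

Lemma shift_point_continuous : continuous shift_point.
Proof.
apply: continuous_comp_initial => t0.
have F0 : Filter (nbhs t0) by exact: nbhs_filter.
have c0 : mxcvg (K := Knum) (F := nbhs t0) (fun t => (t%:C)%:M : 'M[Knum]_n)
    ((t0%:C)%:M : 'M[Knum]_n).
  move=> i j; rewrite mxE; under eq_fun do rewrite mxE.
  by case: (i == j); rewrite ?mulr1n ?mulr0n; [exact: real_complex_cvg|exact: cvg_cst].
have cS : mxcvg (K := Knum) (F := nbhs t0) (fun t => S + (t%:C)%:M : 'M[Knum]_n)
    (S + (t0%:C)%:M : 'M[Knum]_n).
  by have h := @mxcvgD Knum _ _ F0 _ _ _ _ _ _ (@mxcvg_cst Knum _ _ F0 _ _ S) c0; exact: h.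
have c1 : mxcvg (K := Knum) (F := nbhs t0)
    (fun t => row_mx (S + (t%:C)%:M) 1%:M *m EK K : 'M[Knum]_(n, n + n))
    (row_mx (S + (t0%:C)%:M) 1%:M *m EK K).
  apply: mxcvgM; last exact: mxcvg_cst.
  move=> i j; rewrite -(splitK j) /unsplit; case: (fintype.split j) => l.
    rewrite row_mxEl; under eq_fun do rewrite row_mxEl.
    exact: cS.
  by rewrite row_mxEr; under eq_fun do rewrite row_mxEr; exact: cvg_cst.
have h := mxcvg_cvg c1.
have -> : set_val \o shift_point =
    (fun t => row_mx (S + (t%:C)%:M) 1%:M *m EK K : bcmx R d).
  by apply/funext => t; exact: shift_pointE.
exact: h.
Qed.

Lemma chartB_shift t : chartB K (S + (t%:C)%:M) = chartB K S + (t%:C)%:M.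
Proof.
by rewrite /chartB mulmxDr mulmxDl mul_mx_scalar -scalemxAl E0hat_ortho scalemx1.
Qed.

(** The shift moves all the eigenvalues of the block on [K] by [t], and only finitely
    many [t] send one of them to zero. *)
Lemma near_shift_regular (e : R) : 0 < e ->
  exists2 t : R, 0 < t < e & r0 (chartB K (S + (t%:C)%:M)) = 0%N.
Proof.
have [V [x [VV VV' eB]]] := herm_diag (chartB_herm K hS).
move=> e0; have [t te tx] := avoid_seq [seq - x i | i <- enum 'I_#|K|] e0.
exists t => //; rewrite chartB_shift eB.
have -> : V ^t* *m diag_mx (\row_i (x i)%:C) *m V + (t%:C)%:M =
    V ^t* *m diag_mx (\row_i (x i + t)%:C) *m V.
  have -> : \row_i (x i + t)%:C = \row_i (x i)%:C + const_mx (t%:C) :> 'rV[C]_#|K|.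
    by apply/rowP => i; rewrite !mxE rmorphD.
  rewrite linearD /= diag_const_mx mulmxDr mulmxDl mul_mx_scalar -scalemxAl VV'.
  by rewrite scalemx1.
rewrite r0_diag //; apply: eq_card0 => i; rewrite inE /= addr_eq0.
apply: contraNF tx => /eqP xi; apply/mapP; exists i; first by rewrite mem_enum.
by rewrite xi opprK.
Qed.

Lemma shift_regular t : r0 (chartB K (S + (t%:C)%:M)) = 0%N ->
  OK K (bcclass (shift_point t)) /\ r0 (SKA K (bcclass (shift_point t))) = 0%N.
Proof.
move=> r0t; have coord := chart_point_coord K (shift_herm t).
have [uB eS] := chart_coord_unit coord.
have e : SKA K (bcclass (shift_point t)) = chartB K (S + (t%:C)%:M).
  by rewrite eS; exact: SKAE.
by split; [exists (S + (t%:C)%:M); exact: coord|rewrite e].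
Qed.

End ShiftedCondition.

Lemma regular_dense K A : OK K A ->
  closure [set B | OK K B /\ r0 (SKA K B) = 0%N] A.
Proof.
move=> [S [hS [q qS ->]]] U.
have -> : q = shift_point K hS 0.
  have : set_val q = set_val (shift_point K hS 0) by rewrite shift_pointE raddf0 addr0.
  by rewrite !set_valE; exact: val_inj.
move=> nbU; have nU := (nbhs_bcclass (shift_point K hS 0) U).1 nbU.
have nU' := @shift_point_continuous K S hS 0 _ nU.
have /nbhs_ballP[e /= e0 eU] : nbhs (0 : R)
  (shift_point K hS @^-1` ((@bcclass R d) @^-1` U)) by exact: nU'.
have [t /andP[t0 te] rt] := near_shift_regular K hS e0.
have [h1 h2] := shift_regular hS rt.
exists (bcclass (shift_point K hS t)); split; first by [].
by apply: eU; rewrite /ball /= sub0r normrN gtr0_norm.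
Qed.

Variables (al be : nat -> R) (om : coefficients R d).
Hypotheses (N_gt0 : (0 < N)%N) (part : is_partition N al be) (omO : Omega N al be om).
Local Notation a := (al 0%N).
Local Notation b := (be N).
Local Notation ev := (eigenvalue_list a b om).

Lemma corank0_continuous_at A nn : Sigma 0 A -> (1 <= nn <= m)%N ->
  lambda_dom a b om nn A /\
  lambda a b om nn B @[B --> within (lambda_dom a b om nn) (nbhs A)] -->
    lambda a b om nn A.
Proof.
rewrite -OK0_Sigma => OKA /andP[n1 nm].
have r00 B : OK finset.set0 B -> (r0 (SKA finset.set0 B) = 0 /\
    rminus (SKA finset.set0 B) = 0)%N.
  move=> OKB; have h : (r0 (SKA finset.set0 B) + rplus (SKA finset.set0 B) +
      rminus (SKA finset.set0 B))%N = 0%N by rewrite SKA_sum // cards0.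
  clear -h; lia.
have szA : size (ev A) = m.
  by rewrite (ev_size N_gt0 part omO OKA) (r00 A OKA).1 subn0.
split; first by rewrite /lambda_dom /= n1 szA.
have FA : Filter (nbhs A) by exact: nbhs_filter.
have shift : \forall B \near A, lambda_dom a b om nn B ->
    (rminus (SKA finset.set0 B) + r0 (SKA finset.set0 B) + 0 =
     rminus (SKA finset.set0 A) + r0 (SKA finset.set0 A))%N.
  apply: (@filterS _ _ FA _ _ _ (near_inertia OKA)) => B [OKB _ _] _.
  by rewrite (r00 A OKA).1 (r00 A OKA).2 (r00 B OKB).1 (r00 B OKB).2.
have Fw : Filter (within (lambda_dom a b om nn) (nbhs A)) by exact: within_filter.
have := @nth_cvg_finite R _ _ Fw (fun B => ev B) (ev A) 0 (ev_sorted N_gt0 part omO A)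
  (near_ev_sorted N_gt0 part omO _ _) (near_within_count N_gt0 part omO OKA shift) nn.-1.
by rewrite addn0; apply; rewrite szA prednK.
Qed.

Lemma size_ev_le A : (size (ev A) <= m)%N.
Proof.
by have [K OKA] := OK_exists A; rewrite (ev_size N_gt0 part omO OKA) leq_subr.
Qed.

(** At a point of [Sigma k] there are [m - k] eigenvalues, but [m] at nearby points
    of corank zero. *)
Lemma corank_singular A k : Sigma k A -> (1 <= k <= m)%N ->
  closure (lambda_dom a b om (m - k).+1) A /\ ~ lambda_dom a b om (m - k).+1 A.
Proof.
move=> kA /andP[k1 km]; have [K OKA] := OK_exists A.
split; last first.
  by rewrite /lambda_dom /= (ev_size N_gt0 part omO OKA) (Sigma_OK OKA kA) ltnn.
move=> U /(regular_dense OKA)[B [[OKB r0B] UB]]; exists B; split=> //.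
by rewrite /lambda_dom /= (ev_size N_gt0 part omO OKB) r0B subn0 ltn_subrL k1 (leq_trans k1).
Qed.

Lemma singular_setE :
  singular_set a b om = \bigcup_(k in [set k | (1 <= k <= d + d)%N]) Sigma k.
Proof.
have dm : (d + d <= m)%N by rewrite addnn -mul2n leq_mul2r ltnS N_gt0 orbT.
apply/seteqP; split=> A.
  move=> [nn n1 [clA discA]]; have [K OKA] := OK_exists A.
  have kA : Sigma (r0 (SKA K A)) A by apply/(Sigma_chart _ OKA).
  have [k0|k0] := posnP (r0 (SKA K A)); last first.
    exists (r0 (SKA K A)) => //=; rewrite k0 /=.
    by rewrite (leq_trans _ (chart_card K)) // -[X in (_ <= X)%N](SKA_sum OKA) -addnA leq_addr.
  case: discA; apply: corank0_continuous_at; first by rewrite -k0.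
  rewrite n1 /=; have [B [/andP[_ nB] _]] := clA setT filterT.
  exact: leq_trans nB (size_ev_le B).
move=> [k /= /andP[k1 k2] kA]; exists (m - k).+1 => //.
have [|cl ndom] := @corank_singular A k kA; first by rewrite k1 (leq_trans k2).
by split=> // -[].
Qed.

End SingularSet.

Theorem theorem5p9 (R : realType) (d N : nat) (al be : nat -> R)
    (om : coefficients R d) (d_ge1 : (1 <= d)%N) (N_gt1 : (1 < N)%N)
    (part : is_partition N al be) (om_Omega : Omega N al be om) :
  let a := al 0%N in
  let b := be N in
  let lam := lambda a b om in
  let dom := lambda_dom a b om in
  [/\ forall k : nat, (k <= d + d)%N ->
        forall n : nat, (1 <= n <= N.+1 * d - k)%N ->
          lambda_continuous_on a b om n (Sigma k),
      forall n : nat, (1 <= n <= N.+1 * d)%N ->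
        lambda_continuous_on a b om n (OK finset.set0),
      forall (K : {set 'I_(d + d)}) (s0 sp sm t0 tp tm : nat),
        K != finset.set0 ->
        (s0 + sp + sm = #|K|)%N -> (t0 + tp + tm = #|K|)%N ->
        (s0 < t0 <= #|K|)%N -> (tp <= sp)%N -> (tm <= sm)%N ->
        forall A : bcspace R d, JK K t0 tp tm A ->
        [/\ forall n : nat, (1 <= n <= N.+1 * d - s0)%N ->
              JK K s0 sp sm `<=` dom n,
            forall n : nat, (1 <= n <= sp - tp)%N ->
              lam n B @[B --> within (JK K s0 sp sm) (nbhs A)] --> -oo,
            forall n : nat,
              (sp - tp < n <= N.+1 * d - s0 - (sm - tm))%N ->
              dom (n - (sp - tp))%N A /\
              lam n B @[B --> within (JK K s0 sp sm) (nbhs A)] -->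
                lam (n - (sp - tp))%N A &
            forall n : nat,
              (N.+1 * d - s0 - (sm - tm) < n <= N.+1 * d - s0)%N ->
              lam n B @[B --> within (JK K s0 sp sm) (nbhs A)] --> +oo] &
      singular_set a b om = \bigcup_(k in [set k | (1 <= k <= d + d)%N]) Sigma k].
Proof.
have N_gt0 := ltnW N_gt1.
move=> a b lam dom; split.
- by move=> k _ n nk; exact: (Sigma_continuous N_gt0 part om_Omega nk).
- move=> n nm; rewrite OK0_Sigma.
  by apply: (Sigma_continuous N_gt0 part om_Omega); rewrite subn0.
- move=> K s0 sp sm t0 tp tm _ sumS sumT /andP[st0 _] tsp tsm A JA; split=> n nb.
  + exact: (JK_dom N_gt0 part om_Omega).
  + by apply: (JK_cvg_ninfty N_gt0 part om_Omega sumS sumT tsp JA nb).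
  + by apply: (JK_cvg_finite N_gt0 part om_Omega sumS sumT st0 tsp tsm JA nb).
  + by apply: (JK_cvg_pinfty N_gt0 part om_Omega sumS sumT st0 tsp tsm JA nb).
- exact: (singular_setE N_gt0 part om_Omega).
Qed.
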